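(* Let $M$ be a manifold, $\{(\mathcal{U}_i,h_i)\}_{i\in\mathbb{I}}$ a countable locally finite atlas of $M$ where each $\mathcal{U}_i$ has compact closure, $\nu$ a countably additive positive measure on the Borel $\sigma$-algebra of $M$, $\{\mathcal{A}_i\}_{i\in\mathbb{I}}$ local algebras, $\mathcal{B}$ a $C^*$-algebra, and $\{\mathrm{hom}_i\}_{i\in\mathbb{I}}$ local homomorphisms $\mathrm{hom}_i:\mathcal{A}_i\to\mathcal{B}$. Let $\mathcal{A}\subset\mathcal{B}(L_2(M,\nu))$ be the set of operators defined in the context. Then: (1) $\mathcal{A}$ is a $C^*$-algebra which contains $\mathcal{A}_i$ for every $i\in\mathbb{I}$ and $\mathcal{K}(L_2(M,\nu))$; (2) there exists a $*$-homomorphism $\mathrm{hom}:\mathcal{A}\to\mathcal{B}$ such that (a) $\mathrm{hom}=\mathrm{hom}_i$ on $\mathcal{A}_i$ for every $i\in\mathbb{I}$, and (b) $\ker(\mathrm{hom})=\mathcal{K}(L_2(M,\nu))$; (3) the $*$-homomorphism as in (2) is unique.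
   Context: An atlas is locally finite if each point of $M$ lies in only finitely many $\mathcal{U}_i$. $M_\phi$ denotes multiplication by $\phi$ on $L_2(M,\nu)$; $\mathcal{B}(H)$ and $\mathcal{K}(H)$ are the bounded and compact operators on $H$. An operator $T$ is compactly supported in an open set $\mathcal{U}$ if there is a function $\psi$ with compact support in $\mathcal{U}$ with $T=M_\psi T=TM_\psi$. **Local algebras.** $\{\mathcal{A}_i\}_{i\in\mathbb{I}}$ are local algebras if for every $i\in\mathbb{I}$: (1) $\mathcal{A}_i$ is a $*$-subalgebra of $\mathcal{B}(L_2(M,\nu))$; (2) every element of $\mathcal{A}_i$ is compactly supported in $\mathcal{U}_i$; (3) for every $j\in\mathbb{I}$, if $T\in\mathcal{A}_i$ is compactly supported in $\mathcal{U}_i\cap\mathcal{U}_j$, then $T\in\mathcal{A}_j$; (4) if $T\in\mathcal{K}(L_2(M,\nu))$ is compactly supported in $\mathcal{U}_i$, then $T\in\mathcal{A}_i$; (5) if $\phi\in C_c(\mathcal{U}_i)$, then $M_\phi\in\mathcal{A}_i$; (6) if $\phi\in C_c(\mathcal{U}_i)$, then the closure of $M_\phi\mathcal{A}_iM_\phi$ in the operator norm is contained in $\mathcal{A}_i$; (7) if $T\in\mathcal{A}_i$ and $\phi\in C_c(\mathcal{U}_i)$, then $[T,M_\phi]\in\mathcal{K}(L_2(M,\nu))$. **The set $\mathcal{A}$.** $T\in\mathcal{B}(L_2(M,\nu))$ belongs to $\mathcal{A}$ if: (1) for every $i\in\mathbb{I}$ and $\phi\in C_c(\mathcal{U}_i)$,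 $M_\phi TM_\phi\in\mathcal{A}_i$; (2) for every $\phi\in C_c(M)$, $[T,M_\phi]$ is compact; (3) there exists a sequence $(\psi_n)$ in $C_c(M)$ such that $M_{\psi_n}T\to T$ in operator norm. **Local homomorphisms.** $\{\mathrm{hom}_i\}_{i\in\mathbb{I}}$ are local homomorphisms if: (1) for every $i$, $\mathrm{hom}_i:\mathcal{A}_i\to\mathcal{B}$ is a $*$-homomorphism; (2) for all $i,j$, $\mathrm{hom}_i=\mathrm{hom}_j$ on $\mathcal{A}_i\cap\mathcal{A}_j$; (3) $T\in\mathcal{A}_i$ is compact if and only if $\mathrm{hom}_i(T)=0$; (4) there exists a $*$-homomorphism $\mathrm{Hom}:C_0(M)\to\mathcal{B}$ such that $\mathrm{Hom}(\phi)=\mathrm{hom}_i(M_\phi)$ for all $\phi\in C_c(\mathcal{U}_i)$, $i\in\mathbb{I}$. *)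

(* Defs.v *)
From HB Require Import structures.
From mathcomp Require Import all_boot all_order all_algebra.
From mathcomp Require Import complex.
From mathcomp Require Import all_classical all_reals all_analysis.
From mathcomp Require Import measurable_realfun.

Set Implicit Arguments.
Unset Strict Implicit.
Unset Printing Implicit Defensive.

Import Order.TTheory GRing.Theory Num.Theory.
Import numFieldNormedType.Exports.
Import ComplexField.Normc.

Local Open Scope classical_set_scope.
Local Open Scope ring_scope.
Local Open Scope complex_scope.
Local Open Scope quotient_scope.

Local Notation ReC := (@complex.Re _).
Local Notation ImC := (@complex.Im _).

Section complex_measurability.
Context d (T : measurableType d) (R : realType).
Implicit Types f g : T -> R[i].

Definition cmeasurable f :=
  measurable_fun [set: T] (ReC \o f) /\
  measurable_fun [set: T] (ImC \o f).

Lemma normcE2 (z : R[i]) : normc z = Num.sqrt (ReC z ^+ 2 + ImC z ^+ 2).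
Proof. by case: z. Qed.

Lemma cmeasurable_normc f :
  cmeasurable f -> measurable_fun [set: T] (@normc R \o f).
Proof.
move=> [mr mi].
rewrite (_ : @normc R \o f = fun x =>
  ((ReC \o f) x ^+ 2 + (ImC \o f) x ^+ 2) `^ 2^-1).
  have mp : measurable_fun [set: R] (@powR R ^~ 2^-1) by exact: measurable_powR.
  apply: (measurableT_comp mp).
  by apply: measurable_funD; apply: measurable_funX.
by apply/funext => x /=; rewrite normcE2 powR12_sqrt// addr_ge0// sqr_ge0.
Qed.

Lemma cmeasurable0 : cmeasurable 0.
Proof. by split; exact: measurable_cst. Qed.

Lemma cmeasurableD f g : cmeasurable f -> cmeasurable g -> cmeasurable (f + g).
Proof.
move=> [fr fi] [gr gi]; split.
  rewrite (_ : _ \o _ = (ReC \o f) \+ (ReC \o g)).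
    exact: measurable_funD.
  by apply/funext => x /=; rewrite raddfD.
rewrite (_ : _ \o _ = (ImC \o f) \+ (ImC \o g)).
  exact: measurable_funD.
by apply/funext => x /=; rewrite raddfD.
Qed.

Lemma cmeasurableM f g :
  cmeasurable f -> cmeasurable g -> cmeasurable (fun x => f x * g x).
Proof.
move=> [fr fi] [gr gi]; split.
  rewrite (_ : _ \o _ = (fun x => (ReC \o f) x * (ReC \o g) x
     - (ImC \o f) x * (ImC \o g) x)).
    by apply: measurable_funB; apply: measurable_funM.
  by apply/funext => x /=; case: (f x) (g x) => [a b] [a' b'].
rewrite (_ : _ \o _ = (fun x => (ReC \o f) x * (ImC \o g) x
   + (ImC \o f) x * (ReC \o g) x)).
  by apply: measurable_funD; apply: measurable_funM.
by apply/funext => x /=; case: (f x) (g x) => [a b] [a' b'].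
Qed.

Lemma cmeasurable_cst (c : R[i]) : cmeasurable (cst c).
Proof. by split; exact: measurable_cst. Qed.

Lemma cmeasurableZ c f : cmeasurable f -> cmeasurable (c *: f).
Proof. exact: (cmeasurableM (cmeasurable_cst c)). Qed.

End complex_measurability.

Section square_integrable.
Context d (T : measurableType d) (R : realType).
Variable mu : {measure set T -> \bar R}.
Implicit Types f g : T -> R[i].

Definition L2normE f : \bar R := Lnorm mu 2%:E (EFin \o (@normc R \o f)).

Definition sqint : {pred T -> R[i]} :=
  [pred f | `[< cmeasurable f /\ (L2normE f < +oo)%E >]].

Lemma le_Lnorm2 (u v : T -> R) :
  measurable_fun setT u -> measurable_fun setT v ->
  (forall x, 0 <= u x <= v x) ->
  (Lnorm mu 2%:E (EFin \o u) <= Lnorm mu 2%:E (EFin \o v))%E.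
Proof.
move=> mu' mv uv; rewrite unlock.
have m (w : T -> R) : measurable_fun setT w ->
    measurable_fun setT (fun x => `|(EFin \o w) x| `^ 2)%E.
  move=> mw; apply: (measurableT_comp (measurable_poweR 2)).
  by apply: measurableT_comp => //; apply/measurable_EFinP.
apply: gt0_ler_poweR.
- by rewrite invr_ge0.
- by rewrite in_itv/= leey andbT integral_ge0// => x _; exact: poweR_ge0.
- by rewrite in_itv/= leey andbT integral_ge0// => x _; exact: poweR_ge0.
apply: ge0_le_integral => //.
- by move=> x _; exact: poweR_ge0.
- exact: m.
- exact: m.
move=> x _ /=; have /andP[u0 uvx] := uv x.
rewrite !lee_fin; apply: ge0_ler_powR => //; rewrite ?nnegrE ?normr_ge0//.
by rewrite !ger0_norm// (le_trans u0).
Qed.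

Lemma L2normE0 : L2normE 0 = 0%E.
Proof.
rewrite /L2normE (_ : _ \o _ = cst 0%E) ?Lnorm0//.
by apply/funext => x /=; rewrite expr0n/= addr0 sqrtr0.
Qed.

Lemma L2normED f g : cmeasurable f -> cmeasurable g ->
  (L2normE (f + g)%R <= L2normE f + L2normE g)%E.
Proof.
move=> mf mg; have mf' := cmeasurable_normc mf; have mg' := cmeasurable_normc mg.
apply: (le_trans _ (eminkowski _ mf' mg' _)); last by rewrite lee1n.
apply: le_Lnorm2.
- exact/cmeasurable_normc/cmeasurableD.
- exact: measurable_funD.
by move=> x /=; rewrite le_normcD andbT normcE2 sqrtr_ge0.
Qed.

Lemma normc_ge0 (z : R[i]) : 0 <= normc z.
Proof. by rewrite normcE2 sqrtr_ge0. Qed.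

Lemma L2normEZ c f : cmeasurable f ->
  L2normE (c *: f)%R = ((normc c)%:E * L2normE f)%E.
Proof.
move=> mf; rewrite /L2normE unlock.
have c0 : 0 <= normc c := normc_ge0 c.
have E x : (`|(EFin \o (@normc R \o (c *: f)%R)) x| `^ 2 =
    (normc c)%:E `^ 2 * `|(EFin \o (@normc R \o f)) x| `^ 2)%E.
  have -> : (EFin \o (@normc R \o (c *: f)%R)) x =
      ((normc c)%:E * (EFin \o (@normc R \o f)) x)%E.
    by rewrite -EFinM/= -normcM.
  by rewrite abseM poweRM// gee0_abs.
under eq_integral => x _ do rewrite E.
rewrite ge0_integralZl//; last 3 first.
- apply: (measurableT_comp (measurable_poweR 2)).
  apply: measurableT_comp => //; apply/measurable_EFinP.
  exact: cmeasurable_normc.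
- by move=> x _; exact: poweR_ge0.
- exact: poweR_ge0.
rewrite poweRM ?poweR_ge0//; last first.
  by apply: integral_ge0 => x _; exact: poweR_ge0.
by rewrite -poweRrM mulfV ?pnatr_eq0// poweRe1.
Qed.

Lemma sqintP f : reflect (cmeasurable f /\ (L2normE f < +oo)%E) (f \in sqint).
Proof. exact: asboolP. Qed.

Lemma sqint_submod_closed : submod_closed sqint.
Proof.
split=> [|c f g /sqintP[mf nf] /sqintP[mg ng]]; apply/sqintP.
  by split; [exact: cmeasurable0|rewrite L2normE0].
have mcf := cmeasurableZ c mf; split; first exact: cmeasurableD.
apply: (le_lt_trans (L2normED mcf mg)).
by rewrite lte_add_pinfty// L2normEZ// lte_mul_pinfty// lee_fin normc_ge0.
Qed.

HB.instance Definition _ := GRing.isSubmodClosed.Build _ _ sqint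
  sqint_submod_closed.

End square_integrable.

Section L2.
Context d (T : measurableType d) (R : realType).
Variable mu : {measure set T -> \bar R}.

Local Notation L2normE := (L2normE mu).

Record L2fun := MkL2fun { L2fun_val : T -> R[i]; _ : L2fun_val \in sqint mu }.
HB.instance Definition _ := [isSub for L2fun_val].
HB.instance Definition _ := [Choice of L2fun by <:].
HB.instance Definition _ := [SubChoice_isSubLmodule of L2fun by <:].

Coercion L2fun_val : L2fun >-> Funclass.

Implicit Types f g : L2fun.

Lemma L2funP (f : L2fun) : cmeasurable f /\ (L2normE f < +oo)%E.
Proof. exact/sqintP/(valP f). Qed.

Definition L2_eq (f g : L2fun) : bool := `[< (f : T -> R[i]) = g %[ae mu] >].

Lemma L2_eq_refl : reflexive L2_eq.
Proof. by move=> f; apply/asboolP; exact: ae_eq_refl. Qed.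

Lemma L2_eq_sym : symmetric L2_eq.
Proof. by move=> f g; apply/idP/idP => /asboolP h; apply/asboolP/ae_eq_sym. Qed.

Lemma L2_eq_trans : transitive L2_eq.
Proof.
by move=> f g h /asboolP gf /asboolP fh; apply/asboolP/(ae_eq_trans gf fh).
Qed.

Canonical L2_eq_equiv := EquivRel L2_eq L2_eq_refl L2_eq_sym L2_eq_trans.

Definition L2 : Type := {eq_quot L2_eq}.
HB.instance Definition _ := Choice.on L2.
HB.instance Definition _ := EqQuotient.on L2.

Definition L2class (f : L2fun) : L2 := \pi_L2 f.

Lemma L2classP f g : L2class f = L2class g <-> (f : T -> R[i]) = g %[ae mu].
Proof.
split=> [/eqP|fg]; first by rewrite eqmodE => /asboolP.
by apply/eqP; rewrite eqmodE; exact/asboolP.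
Qed.

Lemma L2class_repr (u : L2) : L2class (repr u) = u.
Proof. exact: reprK. Qed.

Lemma repr_L2class (f : L2fun) : (repr (L2class f) : T -> R[i]) = f %[ae mu].
Proof. by apply/L2classP; rewrite L2class_repr. Qed.

Let add (u v : L2) : L2 := L2class (repr u + repr v).
Let opp (u : L2) : L2 := L2class (- repr u).
Let scale (c : R[i]) (u : L2) : L2 := L2class (c *: repr u).

Let addE f g : add (L2class f) (L2class g) = L2class (f + g).
Proof.
apply/L2classP; apply: filterS2 (repr_L2class f) (repr_L2class g) => x + + _.
by move=> /(_ I) fx /(_ I) gx; rewrite /= !fctE fx gx.
Qed.

Let oppE f : opp (L2class f) = L2class (- f).
Proof.
apply/L2classP; apply: filterS (repr_L2class f) => x + _.
by move=> /(_ I) fx; rewrite /= !fctE fx.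
Qed.

Let scaleE c f : scale c (L2class f) = L2class (c *: f).
Proof.
apply/L2classP; apply: filterS (repr_L2class f) => x + _.
by move=> /(_ I) fx; rewrite /= !fctE fx.
Qed.

Let L2ind (P : L2 -> Prop) : (forall f, P (L2class f)) -> forall u, P u.
Proof. by move=> Pf u; rewrite -(L2class_repr u). Qed.

Let addA : associative add.
Proof.
elim/L2ind => f; elim/L2ind => g; elim/L2ind => h.
by rewrite !addE addrA.
Qed.

Let addC : commutative add.
Proof. by elim/L2ind => f; elim/L2ind => g; rewrite !addE addrC. Qed.

Let add0 : left_id (L2class 0) add.
Proof. by elim/L2ind => f; rewrite addE add0r. Qed.

Let addN : left_inverse (L2class 0) opp add.
Proof. by elim/L2ind => f; rewrite oppE addE addNr. Qed.

HB.instance Definition _ := GRing.isZmodule.Build L2 addA addC add0 addN.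

Let scaleA a b u : scale a (scale b u) = scale (a * b) u.
Proof. by elim/L2ind: u => f; rewrite !scaleE scalerA. Qed.

Let scale1 : left_id 1 scale.
Proof. by elim/L2ind => f; rewrite scaleE scale1r. Qed.

Let scaleDr : right_distributive scale +%R.
Proof.
move=> c; elim/L2ind => f; elim/L2ind => g.
by rewrite [in LHS]/GRing.add/= [in RHS]/GRing.add/= addE !scaleE addE scalerDr.
Qed.

Let scaleDl u : {morph scale^~ u : a b / a + b}.
Proof.
move=> a b; elim/L2ind: u => f.
by rewrite [in RHS]/GRing.add/= !scaleE addE scalerDl.
Qed.

HB.instance Definition _ := GRing.Zmodule_isLmodule.Build R[i] L2
  scaleA scale1 scaleDr scaleDl.

Lemma L2classD f g : L2class (f + g) = L2class f + L2class g.
Proof. by rewrite -addE. Qed.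

Lemma L2classZ c f : L2class (c *: f) = c *: L2class f.
Proof. by rewrite -scaleE. Qed.

Lemma L2class0 : L2class 0 = 0. Proof. by []. Qed.

Let norm (u : L2) : R[i] := (fine (L2normE (repr u)))%:C.

Let normE f : norm (L2class f) = (fine (L2normE f))%:C.
Proof.
congr (fine _)%:C; rewrite /L2normE unlock; congr (_ `^ _)%E.
have m (h : L2fun) :
    measurable_fun setT (fun x => `|(EFin \o (@normc R \o h)) x| `^ 2)%E.
  apply: (measurableT_comp (measurable_poweR 2)).
  apply: measurableT_comp => //; apply/measurable_EFinP.
  exact/cmeasurable_normc/(L2funP h).1.
apply: ge0_ae_eq_integral => //.
- by move=> x _; exact: poweR_ge0.
- by move=> x _; exact: poweR_ge0.
by apply: filterS (repr_L2class f) => x + _ => /(_ I) /= ->.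
Qed.

Let finE (f : L2fun) : (fine (L2normE f))%:E = L2normE f.
Proof.
have [_ foo] := L2funP f; rewrite fineK// ge0_fin_numE//.
exact: Lnorm_ge0.
Qed.

Let ler_normD u v : norm (u + v) <= norm u + norm v.
Proof.
elim/L2ind: u => f; elim/L2ind: v => g.
rewrite -L2classD !normE -rmorphD lecR -lee_fin EFinD !finE.
by apply: L2normED; [exact: (L2funP f).1|exact: (L2funP g).1].
Qed.

Let normrZ c u : norm (c *: u) = `|c| * norm u.
Proof.
elim/L2ind: u => f; rewrite -L2classZ !normE.
rewrite [in LHS]/= [L2normE _](L2normEZ _ _ (L2funP f).1) -finE -EFinM/=.
by rewrite rmorphM; case: c.
Qed.

Let normr0_eq0 u : norm u = 0 -> u = 0.
Proof.
elim/L2ind: u => f; rewrite normE => /(congr1 ReC)/= f0.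
have f0' : L2normE f = 0%E by rewrite -finE f0.
rewrite -L2class0; apply/L2classP.
have mf : measurable_fun setT (EFin \o (@normc R \o f)).
  by apply/measurable_EFinP; exact/cmeasurable_normc/(L2funP f).1.
have := Lnorm_eq0_eq0 mf _ f0'; rewrite lte_fin ltr0n => /(_ isT).
apply: filterS => x /(_ I) [] /eq0_normc fx _; exact: fx.
Qed.

HB.instance Definition _ := Lmodule_isNormed.Build R[i] L2
  ler_normD normrZ normr0_eq0.

Lemma L2norm_classE f : `|L2class f| = (fine (L2normE f))%:C.
Proof. exact: normE. Qed.

End L2.

Lemma normCE (R : realType) (c : R[i]) : `|c| = (normc c)%:C.
Proof. by case: c. Qed.

Section bounded_operators.
Context (R : realType) (V : normedModType R[i]).

Definition bounded_operator : {pred V -> V} := [pred T : V -> V |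
  `[< linear T /\ exists K : R, forall v, `|T v| <= K%:C * `|v| >]].

Lemma bounded_operatorP (T : V -> V) : reflect
  (linear T /\ exists K : R, forall v, `|T v| <= K%:C * `|v|)
  (T \in bounded_operator).
Proof. exact: asboolP. Qed.

Lemma bounded_operator_submod_closed : submod_closed bounded_operator.
Proof.
split=> [|c S T /bounded_operatorP[lS [K KS]] /bounded_operatorP[lT [L LT]]].
  have E w : (0 : V -> V) w = 0 by [].
  apply/bounded_operatorP; split=> [a u v|]; first by rewrite !E scaler0 addr0.
  by exists 0 => v; rewrite E normr0 mul0r.
have E w : (c *: S + T) w = c *: S w + T w by [].
apply/bounded_operatorP; split=> [a u v|].
  rewrite !E lS lT !scalerDr !scalerA (mulrC c a).
  by rewrite addrACA.
exists (normc c * K + L) => v; rewrite E (le_trans (ler_normD _ _))//.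
rewrite rmorphD/= mulrDl lerD// normrZ rmorphM -mulrA.
rewrite normCE.
by rewrite ler_wpM2l// lecR normc_ge0.
Qed.

HB.instance Definition _ := GRing.isSubmodClosed.Build _ _ bounded_operator
  bounded_operator_submod_closed.

Record bop := MkBop { bop_val : V -> V; _ : bop_val \in bounded_operator }.
HB.instance Definition _ := [isSub for bop_val].
HB.instance Definition _ := [Choice of bop by <:].
HB.instance Definition _ := [SubChoice_isSubLmodule of bop by <:].

Coercion bop_val : bop >-> Funclass.

Implicit Types S T : bop.

Lemma bopP S T : S =1 T -> S = T.
Proof. by move=> ST; apply/val_inj/funext. Qed.

Lemma bop_linear T : linear T.
Proof. by have /bounded_operatorP[] := valP T. Qed.

Lemma bopD T u v : T (u + v) = T u + T v.
Proof. by have := bop_linear T 1 u v; rewrite !scale1r. Qed.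

Lemma bop0 T : T 0 = 0.
Proof. by apply: (addIr (T 0)); rewrite -bopD !add0r. Qed.

Lemma bopZ T c u : T (c *: u) = c *: T u.
Proof. by have := bop_linear T c u 0; rewrite bop0 !addr0. Qed.

Lemma bop_bounded T : exists K : R, forall v, `|T v| <= K%:C * `|v|.
Proof. by have /bounded_operatorP[] := valP T. Qed.

Lemma bop_one_subproof : id \in bounded_operator.
Proof.
by apply/bounded_operatorP; split=> //; exists 1 => v; rewrite mul1r.
Qed.

Lemma bop_mul_subproof S T : S \o T \in bounded_operator.
Proof.
apply/bounded_operatorP; split=> [c u v /=|].
  by rewrite bopD bopZ bopD bopZ.
have [K KS] := bop_bounded S; have [L LT] := bop_bounded T.
have K0 : K%:C <= (Num.max K 0)%:C by rewrite lecR le_max lexx.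
exists (Num.max K 0 * L) => v /=.
rewrite (le_trans (KS _))// (le_trans (ler_wpM2r _ K0))//.
rewrite rmorphM -mulrA ler_wpM2l ?LT//.
by rewrite lecR le_max lexx orbT.
Qed.

Definition bop_one := MkBop bop_one_subproof.
Definition bop_mul S T := MkBop (bop_mul_subproof S T).

Let mulA : associative bop_mul.
Proof. by move=> S T W; exact: bopP. Qed.
Let mul1 : left_id bop_one bop_mul.
Proof. by move=> S; exact: bopP. Qed.
Let mulr1 : right_id bop_one bop_mul.
Proof. by move=> S; exact: bopP. Qed.
Let mulDl : left_distributive bop_mul +%R.
Proof. by move=> S T W; exact: bopP. Qed.
Let mulDr : right_distributive bop_mul +%R.
Proof. by move=> S T W; apply: bopP => v /=; rewrite bopD. Qed.

HB.instance Definition _ := GRing.Zmodule_isPzRing.Build bop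
  mulA mul1 mulr1 mulDl mulDr.

Lemma normrRe (v : V) : (ReC `|v|)%:C = `|v|.
Proof.
have : 0 <= `|v| by []; case: `|v| => a b; rewrite lecE/= => /andP[/eqP-> _].
by [].
Qed.

Let opnorm T : R := sup [set ReC `|T v| | v in [set v : V | `|v| <= 1]].

Let opnorm_ub T (K : R) :
  (forall v, `|T v| <= K%:C * `|v|) -> 0 <= K -> opnorm T <= K.
Proof.
move=> TK K0; apply: ge_sup.
  by exists (ReC `|T 0|), 0 => //=; rewrite normr0.
move=> _ [v /= v1 <-]; rewrite -lecR normrRe (le_trans (TK v))//.
by rewrite ler_piMr// lecR.
Qed.

Let opnorm_ge0 T : 0 <= opnorm T.
Proof.
have [K TK] := bop_bounded T.
apply: (@le_trans _ _ (ReC `|T 0|)); first by rewrite bop0 normr0.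
apply: ub_le_sup; last by exists 0 => //=; rewrite normr0.
exists (Num.max K 0) => _ [v /= v1 <-].
rewrite -lecR normrRe (le_trans (TK v))//.
apply: (@le_trans _ _ ((Num.max K 0)%:C * `|v|)).
  by rewrite ler_wpM2r// lecR le_max lexx.
by rewrite ler_piMr// lecR le_max lexx orbT.
Qed.

Let opnormP T v : `|T v| <= (opnorm T)%:C * `|v|.
Proof.
have [->|v0] := eqVneq v 0; first by rewrite bop0 normr0 mulr0.
have nv0 : 0 < `|v| by rewrite normr_gt0.
have [w w1 vw] : exists2 w : V, `|w| = 1 & v = `|v| *: w.
  exists (`|v|^-1 *: v); first by rewrite normrZ normfV normr_id mulVf ?gt_eqF.
  by rewrite scalerA divff ?scale1r ?gt_eqF.
rewrite [in leLHS]vw bopZ normrZ normr_id mulrC ler_wpM2r//.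
rewrite -normrRe lecR; have [K TK] := bop_bounded T.
apply: ub_le_sup; last by exists w => //=; rewrite w1.
exists (Num.max K 0) => _ [x /= x1 <-].
rewrite -lecR normrRe (le_trans (TK x))//.
apply: (@le_trans _ _ ((Num.max K 0)%:C * `|x|)).
  by rewrite ler_wpM2r// lecR le_max lexx.
by rewrite ler_piMr// lecR le_max lexx orbT.
Qed.

Let norm T : R[i] := (opnorm T)%:C.

Let ler_normD S T : norm (S + T) <= norm S + norm T.
Proof.
rewrite /norm -rmorphD lecR; apply: opnorm_ub; last by rewrite addr_ge0.
move=> v; rewrite rmorphD mulrDl.
by rewrite (le_trans (ler_normD _ _))// lerD.
Qed.

Let le_normZ c T : norm (c *: T) <= `|c| * norm T.
Proof.
rewrite normCE.
rewrite /norm -rmorphM lecR; apply: opnorm_ub; last first.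
  by rewrite mulr_ge0// normc_ge0.
move=> v; have -> : (c *: T) v = c *: T v by [].
rewrite normrZ rmorphM -mulrA.
rewrite normCE.
by rewrite ler_wpM2l// lecR normc_ge0.
Qed.

Let normrZ c T : norm (c *: T) = `|c| * norm T.
Proof.
apply/le_anti; rewrite le_normZ/=.
have [->|c0] := eqVneq c 0.
  by rewrite normr0 mul0r lecR.
rewrite -ler_pdivlMl ?normr_gt0// -normfV.
apply: le_trans (le_normZ _ _).
by rewrite scalerA mulVf// scale1r.
Qed.

Let normr0_eq0 T : norm T = 0 -> T = 0.
Proof.
move=> /(congr1 ReC)/= T0; apply: bopP => v; apply/eqP.
by rewrite -normr_le0 (le_trans (opnormP T v))// T0 mul0r.
Qed.

HB.instance Definition _ := Lmodule_isNormed.Build R[i] bop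
  ler_normD normrZ normr0_eq0.

Lemma bop_normE T :
  `|T| = (sup [set ReC `|T v| | v in [set v : V | `|v| <= 1]])%:C.
Proof. by []. Qed.

Lemma le_bop_norm T v : `|T v| <= `|T| * `|v|.
Proof. exact: opnormP. Qed.

Definition compact_operator T := precompact (T @` [set v : V | `|v| <= 1]).

End bounded_operators.

Section L2_operators.
Context d (T : measurableType d) (R : realType).
Variable mu : {measure set T -> \bar R}.
Local Notation H := (L2 mu).
Implicit Types (phi : T -> R[i]) (u v : H) (A B : bop H).

Definition L2dot u v : R[i] :=
  let w x := repr u x * (repr v x)^* in
  (\int[mu]_x ReC (w x)) +i* (\int[mu]_x ImC (w x)).

Definition is_adjoint A B := forall u v, L2dot (A u) v = L2dot u (B v).

(* [insubd] only matters when [phi] fails to be bounded and measurable: see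
   [mulopE] below. *)
Definition mulop_fun phi u : H :=
  L2class (insubd (0 : L2fun mu) (fun x => phi x * repr u x)).

Definition mulop phi : bop H := insubd (0 : bop H) (mulop_fun phi).

Section mulop_theory.
Variables (phi : T -> R[i]) (K : R).
Hypotheses (mphi : cmeasurable phi) (phiK : forall x, normc (phi x) <= K).

Let K0 : 0 <= K.
Proof. by apply: le_trans (phiK point); exact: normc_ge0. Qed.

Let nK : normc K%:C = K.
Proof. by rewrite /= expr0n/= addr0 sqrtr_sqr ger0_norm. Qed.

Let normc_mul_le (f : T -> R[i]) x : normc (phi x * f x) <= normc (K%:C * f x).
Proof. by rewrite !normcM nK ler_wpM2r ?normc_ge0. Qed.

Lemma sqint_mul (f : L2fun mu) : (fun x => phi x * f x) \in sqint mu.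
Proof.
have [mf ff] := L2funP f; have mpf := cmeasurableM mphi mf.
apply/sqintP; split => //.
have mKf := cmeasurableZ K%:C mf.
apply: (@le_lt_trans _ _ (L2normE mu (K%:C *: (f : T -> R[i])))).
  apply: le_Lnorm2; [exact: cmeasurable_normc..|].
  move=> x; apply/andP; split; first exact: normc_ge0.
  exact: normc_mul_le.
by rewrite L2normEZ// lte_mul_pinfty// lee_fin normc_ge0.
Qed.

Lemma mulop_funE (f g : L2fun mu) : (forall x, g x = phi x * f x) ->
  mulop_fun phi (L2class f) = L2class g.
Proof.
move=> gE; apply/L2classP.
rewrite /= insubdK; last exact: sqint_mul.
by apply: filterS (repr_L2class f) => x + _ => /(_ I) /= ->; rewrite gE.
Qed.

Lemma L2norm_mul (f g : L2fun mu) : (forall x, g x = phi x * f x) ->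
  `|L2class g| <= K%:C * `|L2class f|.
Proof.
move=> gE; rewrite !L2norm_classE -rmorphM lecR.
have [mf ff] := L2funP f; have [mg fg] := L2funP g.
rewrite -lee_fin EFinM !fineK ?ge0_fin_numE ?Lnorm_ge0//.
rewrite -[X in (X%:E * _)%E]nK -L2normEZ//.
apply: le_Lnorm2; [exact: cmeasurable_normc|
  exact: cmeasurable_normc (cmeasurableZ _ _)|].
move=> x; apply/andP; split; first exact: normc_ge0.
by rewrite [X in X <= _]/(normc (g x)) gE; exact: normc_mul_le.
Qed.

Lemma mulop_fun_bounded : mulop_fun phi \in bounded_operator (V := H).
Proof.
have E (f : L2fun mu) : exists2 g : L2fun mu, (forall x, g x = phi x * f x) &
    mulop_fun phi (L2class f) = L2class g.
  have gE x : MkL2fun (sqint_mul f) x = phi x * f x by [].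
  by exists (MkL2fun (sqint_mul f)) => //; exact: mulop_funE.
apply/bounded_operatorP; split=> [c u v|]; last first.
  exists K => v; rewrite -(L2class_repr v); have [g gE ->] := E (repr v).
  exact: L2norm_mul.
rewrite -(L2class_repr u) -(L2class_repr v).
have [g1 g1E ->] := E (repr u); have [g2 g2E ->] := E (repr v).
rewrite -!L2classZ -!L2classD.
apply: mulop_funE => x /=.
transitivity (c * g1 x + g2 x) => //; rewrite g1E g2E.
by transitivity (phi x * (c * repr u x + repr v x)) => //; rewrite mulrDr mulrCA.
Qed.

Lemma mulopE (f g : L2fun mu) : (forall x, g x = phi x * f x) ->
  mulop phi (L2class f) = L2class g.
Proof.
move=> gE; have -> : mulop phi = mulop_fun phi :> (H -> H).
  by rewrite /mulop insubdK//; exact: mulop_fun_bounded.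
exact: mulop_funE.
Qed.

End mulop_theory.

Definition star_subalgebra (S : set (bop H)) := [/\
  S 0,
  (forall A B, S A -> S B -> S (A + B)),
  (forall (c : R[i]) A, S A -> S (c *: A)),
  (forall A B, S A -> S B -> S (A * B)) &
  (forall A, S A -> exists2 B, S B & is_adjoint A B)].

(* [closed] is for the topology of the operator norm. *)
Definition operator_cstar_algebra (S : set (bop H)) :=
  star_subalgebra S /\ closed S.

End L2_operators.

(* not necessarily unital *)
HB.mixin Record isCStarAlgebra (R : realType) B & CompleteNormedModule R[i] B := {
  cmul : B -> B -> B ;
  cstar : B -> B ;
  cmulA : associative cmul ;
  cmulDl : left_distributive cmul +%R ;
  cmulDr : right_distributive cmul +%R ;
  cmulZl : forall (c : R[i]) a b, cmul (c *: a) b = c *: cmul a b ;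
  cmulZr : forall (c : R[i]) a b, cmul a (c *: b) = c *: cmul a b ;
  cmul_norm : forall a b, `|cmul a b| <= `|a| * `|b| ;
  cstarK : involutive cstar ;
  cstarD : {morph cstar : a b / a + b} ;
  cstarZ : forall (c : R[i]) a, cstar (c *: a) = c^* *: cstar a ;
  cstarM : forall a b, cstar (cmul a b) = cmul (cstar b) (cstar a) ;
  cstar_norm : forall a, `|cmul (cstar a) a| = `|a| ^+ 2
}.

#[short(type="cstarAlgType")]
HB.structure Definition CStarAlgebra (R : realType) :=
  {B of CompleteNormedModule R[i] B & isCStarAlgebra R B}.

(* [M] has to be pointed because measurable types are inhabited. *)
Notation borelType M := (g_sigma_algebraType (@open M)).

Section function_spaces.
Context (R : realType) (M : ptopologicalType).
Implicit Types (U : set M) (phi : M -> R[i]).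

Definition csupport phi : set M := closure [set x | phi x != 0].

(* Functions on an open set [U] with compact support are identified with their
   extensions by zero to [M]. *)
Definition Cc U : set (M -> R[i]) := [set phi |
  [/\ continuous (phi : M -> R[i]^o), compact (csupport phi) &
      csupport phi `<=` U]].

Definition C0 : set (M -> R[i]) := [set phi |
  continuous (phi : M -> R[i]^o) /\
  forall e : R, 0 < e ->
    exists2 K, compact K & forall x, ~ K x -> `|phi x| < e%:C].

Lemma normc_ge_Im (z : R[i]) : `|ImC z|%:C <= `|z|.
Proof.
rewrite normCE lecR normcE2 -sqrtr_sqr ler_wsqrtr// lerDr.
exact: sqr_ge0.
Qed.

Lemma continuous_comp_Lip (F : R[i] -> R) phi :
  (forall z w, `|F z - F w|%:C <= `|z - w|) ->
  continuous (phi : M -> R[i]^o) -> continuous (F \o phi : M -> R).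
Proof.
move=> LF cphi x; apply/cvgrPdist_lt => e e0 /=.
have e0' : 0 < e%:C by rewrite ltcR.
have /cvgrPdist_lt/(_ _ e0') := cphi x.
apply: filterS => t h; rewrite -ltcR (le_lt_trans (LF _ _))//.
Qed.

Lemma continuous_borel_measurable (g : M -> R) : continuous g ->
  measurable_fun [set: borelType M] (g : borelType M -> R).
Proof.
move=> cg; apply: (measurability _ (RGenOInfty.measurableE R)).
move=> _ [_ [x ->] <-]; rewrite setTI; apply: sub_sigma_algebra.
by move/continuousP: cg; apply; exact: interval_open.
Qed.

Lemma continuous_cmeasurable phi : continuous (phi : M -> R[i]^o) ->
  cmeasurable (phi : borelType M -> R[i]).
Proof.
move=> cphi; split; apply: continuous_borel_measurable;
  apply: continuous_comp_Lip => // z w.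
- by rewrite -raddfB; exact: normc_ge_Re.
- by rewrite -raddfB; exact: normc_ge_Im.
Qed.

Lemma Cc_bounded U phi : Cc U phi -> exists K : R, forall x, normc (phi x) <= K.
Proof.
move=> [cphi kphi _].
have cn : continuous (@normc R \o phi : M -> R).
  apply: continuous_comp_Lip => // z w.
  have h (a b : R[i]) : normc a <= normc b + normc (a - b).
    by have := le_normcD b (a - b); rewrite [b + _]addrC subrK.
  rewrite normCE lecR ler_distl lerBlDr h andbT.
  by rewrite -(normcN (z - w)) opprB h.
have /compact_bounded[K [_ KP]] :
    compact ((@normc R \o phi : M -> R) @` csupport phi).
  by apply: continuous_compact => //; exact: continuous_subspaceT.
exists (Num.max (K + 1) 0) => x; have [->|x0] := eqVneq (phi x) 0.
  by rewrite normc0 le_max lexx orbT.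
rewrite le_max; apply/orP; left.
have /(_ (K + 1)) := KP; rewrite ltrDl ltr01 => /(_ isT) h.
have := h (normc (phi x)); rewrite /= ger0_norm ?normc_ge0//; apply.
by exists x => //; exact: subset_closure.
Qed.

Variable nu : {measure set (borelType M) -> \bar R}.

Lemma mulop_CcE U phi (f : L2fun nu) : Cc U phi ->
  exists2 g : L2fun nu, (forall x, g x = phi x * f x) &
    mulop nu phi (L2class f) = L2class g.
Proof.
move=> Uphi; have [K phiK] := Cc_bounded Uphi.
have mphi := continuous_cmeasurable (let: And3 c _ _ := Uphi in c).
exists (MkL2fun (sqint_mul mphi phiK f)) => //.
exact: (mulopE mphi phiK).
Qed.

End function_spaces.

Section manifolds.
Context (R : realType) (d : nat) (M : ptopologicalType).

Definition is_chart (U : set M) (h : M -> 'rV[R]_d) : Prop :=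
  [/\ open U, open (h @` U), {within U, continuous h} &
      exists2 g : 'rV[R]_d -> M,
        (forall x, U x -> g (h x) = x) & {within h @` U, continuous g}].

Definition is_manifold : Prop :=
  [/\ hausdorff_space M, @second_countable M &
      forall x : M, exists U h, U x /\ is_chart U h].

Definition is_atlas (I : Type) (U : I -> set M) (h : I -> M -> 'rV[R]_d) :=
  (forall i, is_chart (U i) (h i)) /\ \bigcup_i U i = [set: M].

(* Only point-finiteness: a point need not have a neighbourhood that meets
   finitely many [U i]. *)
Definition locally_finite_cover (I : Type) (U : I -> set M) :=
  forall x : M, finite_set [set i | U i x].

End manifolds.

Section local_data.
Context (R : realType) (M : ptopologicalType).
Variable nu : {measure set (borelType M) -> \bar R}.
Local Notation H := (L2 nu).
Local Notation mul := (mulop nu).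
Implicit Types (T : bop H) (phi psi : M -> R[i]).

Definition compactly_supported (U : set M) T :=
  exists2 psi, Cc U psi & T = mul psi * T /\ T = T * mul psi.

Section families.
Context (I : Type) (U : I -> set M) (Aloc : I -> set (bop H)).

Record local_algebras : Prop := {
  local_star_subalgebra : forall i, star_subalgebra (Aloc i) ;
  local_compactly_supported :
    forall i T, Aloc i T -> compactly_supported (U i) T ;
  local_overlap : forall i j T, Aloc i T ->
    compactly_supported (U i `&` U j) T -> Aloc j T ;
  local_compact_operator : forall i T, compact_operator T ->
    compactly_supported (U i) T -> Aloc i T ;
  local_mulop : forall i phi, Cc (U i) phi -> Aloc i (mul phi) ;
  local_closure : forall i phi, Cc (U i) phi ->
    closure [set mul phi * T * mul phi | T in Aloc i] `<=` Aloc i ;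
  local_commutator : forall i T phi, Aloc i T -> Cc (U i) phi ->
    compact_operator (T * mul phi - mul phi * T)
}.

Definition global_algebra : set (bop H) := [set T |
  [/\ forall i phi, Cc (U i) phi -> Aloc i (mul phi * T * mul phi),
      forall phi, Cc [set: M] phi ->
        compact_operator (T * mul phi - mul phi * T) &
      exists2 psi : nat -> M -> R[i],
        (forall n, Cc [set: M] (psi n)) &
        (fun n => mul (psi n) * T) @ \oo --> T]].

Context (B : cstarAlgType R).

Definition star_hom_on (S : set (bop H)) (F : bop H -> B) := [/\
  (forall T1 T2, S T1 -> S T2 -> F (T1 + T2) = F T1 + F T2),
  (forall (c : R[i]) T, S T -> F (c *: T) = c *: F T),
  (forall T1 T2, S T1 -> S T2 -> F (T1 * T2) = cmul (F T1) (F T2)) &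
  (forall T1 T2, S T1 -> S T2 -> is_adjoint T1 T2 -> F T2 = cstar (F T1))].

Definition star_hom_C0 (F : (M -> R[i]) -> B) := [/\
  (forall phi psi, C0 phi -> C0 psi ->
     F (fun x => phi x + psi x) = F phi + F psi),
  (forall (c : R[i]) phi, C0 phi -> F (fun x => c * phi x) = c *: F phi),
  (forall phi psi, C0 phi -> C0 psi ->
     F (fun x => phi x * psi x) = cmul (F phi) (F psi)) &
  (forall phi, C0 phi -> F (fun x => (phi x)^*) = cstar (F phi))].

(* [hom i] is only relevant on [Aloc i], and [Hom] on [C0]. *)
Record local_homs (hom : I -> bop H -> B) : Prop := {
  local_hom_star : forall i, star_hom_on (Aloc i) (hom i) ;
  local_hom_overlap : forall i j T,
    Aloc i T -> Aloc j T -> hom i T = hom j T ;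
  local_hom_kernel : forall i T, Aloc i T ->
    (compact_operator T <-> hom i T = 0) ;
  local_hom_mulop : exists2 Hom : (M -> R[i]) -> B, star_hom_C0 Hom &
    forall i phi, Cc (U i) phi -> Hom phi = hom i (mul phi)
}.

Definition global_hom (homloc : I -> bop H -> B) (hom : bop H -> B) := [/\
  star_hom_on global_algebra hom,
  (forall i T, Aloc i T -> hom T = homloc i T) &
  [set T | global_algebra T /\ hom T = 0] = [set T | compact_operator T]].

End families.
End local_data.

(* Main.v *)
Require Import Defs.
From mathcomp Require Import all_boot all_order all_algebra.
From mathcomp Require Import complex.
From mathcomp Require Import all_classical all_reals all_analysis.
From mathcomp Require Import measurable_realfun finmap lra ring.

(** Modulo compact operators, an operator T of the global algebra commutes with
    all multiplications M_phi, phi in C_c(M). Hence, if f_k are functions in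
    C_c(U_(i_k)) such that the sum of the f_k^2 is 1 on the support of T, then T
    equals the sum of its compressions f_k T f_k up to a compact operator
    ([local_decomposition]). Each compression lies in a local algebra, so
    whatever a homomorphism does on the global algebra is decided by what it
    does on the local ones.

    That the global algebra is a C*-algebra is checked on its defining
    conditions. The approximation of T by some sequence M_(psi_n) T is first
    replaced by E_n T --> T for one fixed sequence E_n of multiplications by
    cutoffs that eventually equal 1 on every compact set ([global_algebraP]).
    Stability under adjoints then comes from T^* E_n = E_n T^* + compact,
    together with the theorem of Schauder ([compact_adjoint_for]) and the
    convergence E_n K --> K for compact K ([compact_operator_strong]). Adjoints
    of arbitrary bounded operators exist because L2 is complete
    ([L2_complete], [riesz_representation]).

    The value of the global homomorphism at a compactly supported T is defined
    implicitly, as the only b in B which commutes with the image of C_c(M), is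
    compactly supported, and has the compressions
    Hom(phi) b Hom(phi) = hom_i(phi T phi). Uniqueness of such a symbol
    ([symbol_unique]) makes the resulting map a *-homomorphism without any
    choice of a partition of unity; existence ([symbol_exists]) is the
    decomposition above. The passage from compactly supported operators to the
    whole algebra is by continuity: a *-homomorphism on a norm-closed
    *-subalgebra is bounded, with an absolute constant ([star_hom_bounded]).
    Boundedness is proved without spectral theory: for a small selfadjoint a,
    the element a + i sqrt (1 - a^2) is unitary, and after its unit is
    subtracted everything takes place inside the algebra ([one_minus_sqrt],
    [rnorm_cayley]).

    The kernel consists of the compact operators because, if hom T = 0, then all
    compressions phi T phi to charts are compact by [local_hom_kernel], hence so
    is every E_n T. Two global homomorphisms agree on compactly supported
    operators by [local_decomposition], hence everywhere by boundedness. *)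

Set Implicit Arguments.
Unset Strict Implicit.
Unset Printing Implicit Defensive.
Import Order.TTheory GRing.Theory Num.Theory.
Import numFieldNormedType.Exports.
Import ComplexField.Normc.
Local Open Scope classical_set_scope.
Local Open Scope ring_scope.
Local Open Scope complex_scope.

Local Notation ReC := (@complex.Re _).
Local Notation ImC := (@complex.Im _).

(** * Complex numbers and real-valued norms *)

Section complex_parts.
Context (R : realType).
Implicit Types (a b c : R[i]).

Lemma ReD a b : ReC (a + b) = ReC a + ReC b.
Proof. by case: a b => [? ?] [? ?]. Qed.

Lemma ReN a : ReC (- a) = - ReC a.
Proof. by case: a. Qed.

Lemma ReM a b : ReC (a * b) = ReC a * ReC b - ImC a * ImC b.
Proof. by case: a b => [? ?] [? ?]. Qed.

Lemma ImM a b : ImC (a * b) = ReC a * ImC b + ImC a * ReC b.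
Proof. by case: a b => [? ?] [? ?]. Qed.

Lemma ReJ a : ReC a^* = ReC a.
Proof. by case: a. Qed.

Lemma ImJ a : ImC a^* = - ImC a.
Proof. by case: a. Qed.

Lemma normc_sqr a : normc a ^+ 2 = ReC a ^+ 2 + ImC a ^+ 2.
Proof. by rewrite normcE2 sqr_sqrtr// addr_ge0 ?sqr_ge0. Qed.

Lemma normcR (x : R) : normc x%:C = `|x|.
Proof. by rewrite normcE2/= expr0n addr0 sqrtr_sqr. Qed.

Lemma complexP a b : ReC a = ReC b -> ImC a = ImC b -> a = b.
Proof. by case: a b => [? ?] [? ?] /= -> ->. Qed.

Lemma Im_le_normc a : `|ImC a| <= normc a.
Proof. by rewrite normcE2 -sqrtr_sqr ler_wsqrtr// lerDr sqr_ge0. Qed.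

Lemma abs_Re_le_normc a : `|ReC a| <= normc a.
Proof. by rewrite normcE2 -sqrtr_sqr ler_wsqrtr// lerDl sqr_ge0. Qed.

Lemma Re_le_normc a : ReC a <= normc a.
Proof. exact: le_trans (ler_norm _) (abs_Re_le_normc a). Qed.

Lemma normcJ a : normc a^* = normc a.
Proof. by rewrite !normcE2 ReJ ImJ sqrrN. Qed.

Lemma pos_complexE a : 0 < a -> a = (ReC a)%:C.
Proof. by case: a => x y; rewrite ltcE/= => /andP[/eqP-> _]. Qed.

End complex_parts.

Section real_norm.
Context (R : realType) (V : normedModType R[i]).
Implicit Types u v w : V.

(** The norm of a complex normed module takes values in R[i], whose order is only
    partial; its real part can be handled by the decision procedures for R. *)
Definition rnorm v : R := ReC `|v|.

Lemma rnormE v : `|v| = (rnorm v)%:C.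
Proof. by have h := normrRe v; rewrite -[LHS]h. Qed.

Lemma rnorm_ge0 v : 0 <= rnorm v.
Proof. rewrite -lecR -rnormE; exact: normr_ge0. Qed.

Lemma rnorm0 : rnorm 0 = 0.
Proof. by rewrite /rnorm normr0. Qed.

Lemma rnorm_eq0 v : rnorm v = 0 -> v = 0.
Proof. by move=> v0; apply/eqP; rewrite -normr_eq0 rnormE v0. Qed.

Lemma rnormN v : rnorm (- v) = rnorm v.
Proof. by rewrite /rnorm normrN. Qed.

Lemma rnormB u v : rnorm (u - v) = rnorm (v - u).
Proof. by rewrite -rnormN opprB. Qed.

Lemma rnormD u v : rnorm (u + v) <= rnorm u + rnorm v.
Proof. by rewrite -lecR rmorphD/= -!rnormE ler_normD. Qed.

Lemma rnormZ c v : rnorm (c *: v) = normc c * rnorm v.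
Proof. by rewrite /rnorm normrZ normCE !rnormE -rmorphM. Qed.

Lemma rnorm_triangle w u v : rnorm (u - v) <= rnorm (u - w) + rnorm (w - v).
Proof. by have := rnormD (u - w) (w - v); rewrite addrA subrK. Qed.

Lemma rnorm_small_eq0 v : (forall e : R, 0 < e -> rnorm v <= e) -> v = 0.
Proof.
move=> h; apply: rnorm_eq0; apply/le_anti; rewrite rnorm_ge0 andbT.
by apply/ler_addgt0Pl => e e0; rewrite addr0; exact: h.
Qed.

Lemma cvg_rnormP (u : nat -> V) (l : V) : u @ \oo --> l <->
  forall e : R, 0 < e -> exists N, forall n, (N <= n)%N -> rnorm (u n - l) < e.
Proof.
split=> [/cvgrPdist_lt ul e e0|ul].
  have e0' : 0 < e%:C by rewrite ltcR.
  have [N _ NP] := ul _ e0'; exists N => n Nn.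
  by rewrite rnormB -ltcR -rnormE; exact: NP.
apply/cvgrPdist_lt => e e0.
have eE := pos_complexE e0.
have [|N NP] := ul (ReC e); first by rewrite -ltcR -eE.
by exists N => // n Nn /=; rewrite rnormE rnormB eE ltcR; exact: NP.
Qed.

Lemma closure_rnormP (A : set V) (l : V) : closure A l <->
  forall e : R, 0 < e -> exists2 a, A a & rnorm (a - l) < e.
Proof.
split=> [cl e e0|h W].
  have e0' : 0 < e%:C by rewrite ltcR.
  have [a [Aa /=]] := cl _ (nbhsx_ballx l _ e0').
  rewrite -ball_normE/= => la; exists a => //.
  by rewrite rnormB -ltcR -rnormE.
move=> /nbhs_ballP[e /= e0 eW].
have eE := pos_complexE e0.
have [|a Aa al] := h (ReC e); first by rewrite -ltcR -eE.
exists a; split => //; apply: eW; rewrite -ball_normE/=.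
by rewrite rnormE rnormB eE ltcR.
Qed.

End real_norm.

(** * Bounded operators and limits *)

Section operator_norm.
Context (R : realType) (V : normedModType R[i]).
Implicit Types (S T : bop V) (u v w : V).

Lemma bopB T u v : T (u - v) = T u - T v.
Proof. by rewrite bopD -scaleN1r bopZ scaleN1r. Qed.

Lemma bopDE S T u : (S + T) u = S u + T u. Proof. by []. Qed.

Lemma bopBE S T u : (S - T) u = S u - T u. Proof. by []. Qed.

Lemma bopME S T u : (S * T) u = S (T u). Proof. by []. Qed.

Lemma bopZE c T u : (c *: T) u = c *: T u. Proof. by []. Qed.

Lemma rnorm_bop T v : rnorm (T v) <= rnorm T * rnorm v.
Proof. by rewrite -lecR rmorphM/= -!rnormE le_bop_norm. Qed.

Lemma rnorm_bop_le T (K : R) :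
  0 <= K -> (forall v, rnorm (T v) <= K * rnorm v) -> rnorm T <= K.
Proof.
move=> K0 TK; rewrite /rnorm bop_normE; apply: ge_sup.
  by exists (ReC `|T 0|), 0 => //=; rewrite normr0.
move=> _ [v /= v1 <-]; rewrite (le_trans (TK v))// ler_piMr//.
by rewrite -lecR -rnormE.
Qed.

Lemma rnormM S T : rnorm (S * T) <= rnorm S * rnorm T.
Proof.
apply: rnorm_bop_le => [|v]; first by rewrite mulr_ge0// rnorm_ge0.
rewrite bopME (le_trans (rnorm_bop _ _))// -mulrA ler_wpM2l ?rnorm_ge0//.
exact: rnorm_bop.
Qed.

Lemma bopZl c S T : (c *: S) * T = c *: (S * T).
Proof. by apply: bopP => v; rewrite bopME bopZE. Qed.

Lemma bopZr c S T : S * (c *: T) = c *: (S * T).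
Proof. by apply: bopP => v; rewrite bopME !bopZE bopZ. Qed.

End operator_norm.

Section limits.
Context (R : realType).

Lemma cvg_le0 (u w : nat -> R) : (forall n, 0 <= u n <= w n) ->
  w @ \oo --> 0 -> u @ \oo --> 0.
Proof.
move=> uw w0; apply: (@squeeze_cvgr _ _ _ _ (cst 0) w) => //.
  by near=> n; exact: uw.
exact: cvg_cst.
Unshelve. all: by end_near. Qed.

Lemma cvg_rnorm0 (V : normedModType R[i]) (u : nat -> V) (l : V) :
  u @ \oo --> l <-> (fun n => rnorm (u n - l)) @ \oo --> 0.
Proof.
rewrite cvg_rnormP; split=> [h|/cvgrPdist_lt h e e0].
  apply/cvgrPdist_lt => e e0; have [N NP] := h e e0.
  exists N => // n Nn /=.
  by rewrite sub0r normrN ger0_norm ?rnorm_ge0//; exact: NP.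
have [N _ NP] := h e e0; exists N => n Nn.
by have := NP n Nn; rewrite /= sub0r normrN ger0_norm ?rnorm_ge0.
Qed.

Lemma cvg_rnorm_le (V : normedModType R[i]) (u : nat -> V) (l : V)
    (w : nat -> R) :
  (forall n, rnorm (u n - l) <= w n) -> w @ \oo --> 0 -> u @ \oo --> l.
Proof.
move=> uw w0; apply/cvg_rnorm0; apply: cvg_le0 w0 => n.
by rewrite rnorm_ge0 uw.
Qed.

Lemma cvg_rnorm_bound (V : normedModType R[i]) (u : nat -> V) (l : V) :
  u @ \oo --> l -> exists2 K : R, 0 <= K & forall n, rnorm (u n) <= K.
Proof.
move=> /cvg_rnormP/(_ _ ltr01)[N NP].
exists (1 + rnorm l + \sum_(i < N) rnorm (u i)) => [|n].
  rewrite addr_ge0 ?sumr_ge0// ?addr_ge0 ?rnorm_ge0// => i _.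
  exact: rnorm_ge0.
have [Nn|nN] := leqP N n; last first.
  rewrite (bigD1 (Ordinal nN))//=.
  set s := \sum_(i < _ | _) _; have s0 : 0 <= s.
    by apply: sumr_ge0 => i _; exact: rnorm_ge0.
  have := rnorm_ge0 l; lra.
rewrite -[u n](subrK l) (le_trans (rnormD _ _))//.
rewrite -addrA lerD//; first exact/ltW/NP.
by rewrite lerDl sumr_ge0// => i _; exact: rnorm_ge0.
Qed.

(** Covers the products of operators, the evaluation of operators at vectors and
    the products in a C*-algebra. *)
Lemma cvg_bilinear (V W X : normedModType R[i]) (m : V -> W -> X)
    (mBl : forall a b c, m (a - b) c = m a c - m b c)
    (mBr : forall a b c, m a (b - c) = m a b - m a c)
    (m_le : forall a b, rnorm (m a b) <= rnorm a * rnorm b)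
    (u : nat -> V) (v : nat -> W) (a : V) (b : W) :
  u @ \oo --> a -> v @ \oo --> b -> (fun n => m (u n) (v n)) @ \oo --> m a b.
Proof.
move=> ua vb; have [K K0 KP] := cvg_rnorm_bound ua.
apply: (@cvg_rnorm_le _ _ _
  (fun n => K * rnorm (v n - b) + rnorm (u n - a) * rnorm b)) => [n|].
  rewrite (le_trans (rnorm_triangle (m (u n) b) _ _))// lerD//.
    rewrite -mBr (le_trans (m_le _ _))// ler_wpM2r ?rnorm_ge0//.
  by rewrite -mBl (le_trans (m_le _ _)).
rewrite -[0](addr0 0); apply: cvgD.
  rewrite -(mulr0 K); apply: cvgM; first exact: cvg_cst.
  by move/cvg_rnorm0: vb.
rewrite -(mul0r (rnorm b)); apply: cvgM; last exact: cvg_cst.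
by move/cvg_rnorm0: ua.
Qed.

Lemma seq_cvg_unique (V : normedModType R[i]) (u : nat -> V) (a b : V) :
  u @ \oo --> a -> u @ \oo --> b -> a = b.
Proof. exact: norm_cvg_unique. Qed.

Lemma cvg_bopM (V : normedModType R[i]) (S T : nat -> bop V) (A B : bop V) :
  S @ \oo --> A -> T @ \oo --> B -> (fun n => S n * T n) @ \oo --> A * B.
Proof.
apply: cvg_bilinear => [a b c|a b c|]; [exact: mulrBl|exact: mulrBr|].
exact: rnormM.
Qed.

Lemma cvg_bop_app (V : normedModType R[i]) (S : nat -> bop V) (A : bop V)
    (u : nat -> V) (v : V) :
  S @ \oo --> A -> u @ \oo --> v -> (fun n => S n (u n)) @ \oo --> A v.
Proof.
by apply: cvg_bilinear => [//|a b c|]; [exact: bopB|exact: rnorm_bop].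
Qed.

Lemma harmonic_lt (e : R) : 0 < e ->
  exists N, forall n, (N <= n)%N -> n.+1%:R^-1 < e.
Proof.
move=> e0; have /cvgrPdist_lt/(_ e e0)[N _ NP] := @cvg_harmonic R.
exists N => n Nn; have := NP n Nn.
by rewrite /= sub0r normrN ger0_norm// invr_ge0.
Qed.

End limits.

(** * Compact operators *)

Section totally_bounded.
Context (R : realType) (V : normedModType R[i]).
Implicit Types (A : set V) (S T : bop V).

Definition seq_complete := forall u : nat -> V,
  (forall e : R, 0 < e -> exists N, forall m n, (N <= m)%N -> (N <= n)%N ->
    rnorm (u m - u n) < e) ->
  exists l : V, u @ \oo --> l.

Definition tbounded A := forall e : R, 0 < e ->
  exists s : seq V, forall a, A a -> exists2 w, w \in s & rnorm (a - w) < e.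

Lemma precompact_tbounded A : precompact A -> tbounded A.
Proof.
rewrite precompactE compact_cover => cA e e0.
have e0' : 0 < e%:C by rewrite ltcR.
have [||s _ sP] := cA V setT (fun w => ball w e%:C).
- by move=> w _; exact: ball_open.
- by move=> a _; exists a => //; exact: ballxx.
exists (enum_fset s) => a Aa; have [w ws] := sP _ (subset_closure Aa).
rewrite -ball_normE/= => wa; exists w => //.
by rewrite rnormB -ltcR -rnormE.
Qed.

Lemma ultra_seq (F : set_system V) (s : seq V) (f : V -> set V) (A : set V) :
  UltraFilter F -> F A -> (forall a, A a -> exists2 w, w \in s & f w a) ->
  exists2 w, w \in s & F (f w).
Proof.
move=> UF; elim: s A => [|w s IH] A FA AP.
  by have [a /AP[]] := filter_ex FA.
have [Fw|Fnw] := in_ultra_setVsetC (f w) UF.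
  by exists w => //; rewrite mem_head.
have [||w' w's Fw'] := IH (A `&` ~` f w); first exact: filterI.
  move=> a [/AP[w']]; rewrite inE => /orP[/eqP-> //|w's fa _].
  by exists w'.
by exists w' => //; rewrite inE w's orbT.
Qed.

Lemma tbounded_closure A : tbounded A -> tbounded (closure A).
Proof.
move=> tA e e0; have e20 : 0 < e / 2 by rewrite divr_gt0.
have [s sP] := tA _ e20; exists s => a /closure_rnormP/(_ _ e20)[b Ab ab].
have [w ws wb] := sP _ Ab; exists w => //.
apply: le_lt_trans (rnorm_triangle b _ _) _.
by rewrite rnormB [ltRHS]splitr ltrD.
Qed.

(** An ultrafilter on a totally bounded set contains arbitrarily small balls,
    whose centres form a Cauchy sequence. *)
Lemma tbounded_precompact A : seq_complete -> tbounded A -> precompact A.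
Proof.
move=> cV /tbounded_closure tA; rewrite precompactE compact_ultra => F UF FA.
pose d n : R := n.+1%:R^-1; have d0 n : 0 < d n by rewrite invr_gt0.
have small n : exists w, F [set a | rnorm (a - w) < d n].
  have [s sP] := tA _ (d0 n).
  have [w _ Fw] := @ultra_seq F s (fun w => [set a | rnorm (a - w) < d n]) _
    UF FA sP.
  by exists w.
have [u uP] := choice small.
have dlt e : 0 < e -> exists N, forall n, (N <= n)%N -> d n < e.
  exact: harmonic_lt.
have uu m n : rnorm (u m - u n) < d m + d n.
  have [a [am an]] := filter_ex (filterI (uP m) (uP n)).
  apply: le_lt_trans (rnorm_triangle a _ _) _.
  by rewrite ltrD// rnormB.
have [e e0|l ul] := cV u.
  have [|N NP] := dlt (e / 2); first by rewrite divr_gt0.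
  exists N => m n Nm Nn; rewrite (lt_trans (uu m n))// [ltRHS]splitr.
  by rewrite ltrD// NP.
have Fl : F --> l.
  move=> W /nbhs_ballP[e' /= e'0 eW].
  have eE := pos_complexE e'0.
  pose e := ReC e'; have e0 : 0 < e by rewrite -ltcR -eE.
  have e20 : 0 < e / 2 by rewrite divr_gt0.
  have [N1 N1P] := dlt _ e20; have /cvg_rnormP/(_ _ e20)[N2 N2P] := ul.
  pose n := maxn N1 N2; apply: filterS (uP n) => a /= an; apply: eW.
  rewrite -ball_normE/= rnormE rnormB eE ltcR -/e.
  apply: le_lt_trans (rnorm_triangle (u n) _ _) _.
  rewrite [ltRHS]splitr ltrD//; last by apply: N2P; exact: leq_maxr.
  by rewrite (lt_trans an)// N1P// leq_maxl.
exists l; split => //.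
apply: (@closed_cvg _ _ F _ id (closure A)) => //.
exact: closed_closure.
Qed.

Hypothesis cV : seq_complete.

Lemma compact_operatorP T : compact_operator T <->
  forall e : R, 0 < e -> exists s : seq V, forall v, rnorm v <= 1 ->
    exists2 w, w \in s & rnorm (T v - w) < e.
Proof.
split=> [/precompact_tbounded tT e e0|tT].
  have [s sP] := tT e e0; exists s => v v1; apply: sP; exists v => //=.
  by rewrite rnormE lecR.
apply: tbounded_precompact => // e e0; have [s sP] := tT e e0; exists s.
by move=> _ [v /= v1 <-]; apply: sP; rewrite -lecR -rnormE.
Qed.

Lemma compact_operator0 : compact_operator (0 : bop V).
Proof.
apply/compact_operatorP => e e0; exists [:: 0] => v _; exists 0.
  by rewrite inE.
by rewrite subr0 rnorm0.
Qed.

Lemma compact_operatorD S T :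
  compact_operator S -> compact_operator T -> compact_operator (S + T).
Proof.
move=> /compact_operatorP cS /compact_operatorP cT.
apply/compact_operatorP => e e0; have e20 : 0 < e / 2 by rewrite divr_gt0.
have [s sP] := cS _ e20; have [t tP] := cT _ e20.
exists [seq x + y | x <- s, y <- t] => v v1.
have [x xs Sx] := sP v v1; have [y yt Ty] := tP v v1.
exists (x + y); first by apply/allpairsP; exists (x, y).
rewrite bopDE opprD addrACA (le_lt_trans (rnormD _ _))//.
by rewrite [ltRHS]splitr ltrD.
Qed.

Lemma compact_operatorMl S T : compact_operator T -> compact_operator (S * T).
Proof.
move=> /compact_operatorP cT; apply/compact_operatorP => e e0.
have K0 : 0 < rnorm S + 1 by rewrite ltr_wpDl ?rnorm_ge0.
have [|s sP] := cT (e / (rnorm S + 1)); first by rewrite divr_gt0.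
exists [seq S x | x <- s] => v v1; have [x xs Tx] := sP v v1.
exists (S x); first by apply/mapP; exists x.
rewrite bopME -bopB (le_lt_trans (rnorm_bop _ _))//.
rewrite ltr_pdivlMr// in Tx; rewrite (le_lt_trans _ Tx)// mulrC.
by rewrite ler_wpM2l ?rnorm_ge0// lerDl.
Qed.

Lemma compact_operatorZ c T : compact_operator T -> compact_operator (c *: T).
Proof.
by move=> cT; rewrite -[T]mul1r -bopZl; exact: compact_operatorMl.
Qed.

Lemma compact_operatorB S T :
  compact_operator S -> compact_operator T -> compact_operator (S - T).
Proof.
move=> cS cT; rewrite -scaleN1r; apply: compact_operatorD => //.
exact: compact_operatorZ.
Qed.

Lemma compact_operatorMr S T : compact_operator T -> compact_operator (T * S).
Proof.
move=> /compact_operatorP cT.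
pose k := rnorm S + 1; have k0 : 0 < k by rewrite ltr_wpDl ?rnorm_ge0.
suff : compact_operator (T * (k^-1%:C *: S)).
  move=> /(compact_operatorZ k%:C); rewrite bopZr scalerA -rmorphM/=.
  by rewrite divff ?gt_eqF// scale1r.
apply/compact_operatorP => e e0; have [s sP] := cT e e0; exists s => v v1.
apply: sP; rewrite bopZE rnormZ.
have -> : normc k^-1%:C = k^-1.
  by rewrite normcR ger0_norm ?invr_ge0 ?ltW.
rewrite ler_pdivrMl// mulr1 (le_trans (rnorm_bop _ _))//.
by rewrite (@le_trans _ _ (rnorm S * 1)) ?ler_wpM2l ?rnorm_ge0// mulr1 lerDl.
Qed.

Lemma compact_operator_closed T :
  (forall e : R, 0 < e -> exists2 S, compact_operator S & rnorm (S - T) < e) ->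
  compact_operator T.
Proof.
move=> h; apply/compact_operatorP => e e0.
have e20 : 0 < e / 2 by rewrite divr_gt0.
have [S /compact_operatorP/(_ _ e20)[s sP] ST] := h _ e20.
exists s => v v1; have [w ws Sw] := sP v v1; exists w => //.
apply: le_lt_trans (rnorm_triangle (S v) _ _) _.
rewrite [ltRHS]splitr ltrD// rnormB -bopBE.
rewrite (le_lt_trans (rnorm_bop _ _))// (le_lt_trans _ ST)//.
by rewrite ler_piMr ?rnorm_ge0.
Qed.

Lemma compact_operator_sum (n : nat) (F : 'I_n -> bop V) :
  (forall k, compact_operator (F k)) -> compact_operator (\sum_k F k).
Proof.
move=> cF; elim/big_ind: _ => //; first exact: compact_operator0.
exact: compact_operatorD.
Qed.

(** Strong convergence is uniform on the relatively compact image of a compact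
    operator. *)
Lemma compact_operator_strong (E : nat -> bop V) T :
  (forall n, rnorm (E n) <= 1) -> (forall v, (fun n => E n v) @ \oo --> v) ->
  compact_operator T -> (fun n => E n * T) @ \oo --> T.
Proof.
move=> E1 Ev /compact_operatorP cT; apply/cvg_rnormP => e e0.
pose f := e / 4; have f0 : 0 < f by rewrite divr_gt0.
have [s sP] := cT _ f0.
have [N NP] : exists N, forall n, (N <= n)%N ->
    forall w, w \in s -> rnorm (E n w - w) < f.
  elim: s {sP} => [|w s [N NP]]; first by exists 0.
  have /cvg_rnormP/(_ _ f0)[N' N'P] := Ev w.
  exists (maxn N N') => n; rewrite geq_max => /andP[Nn N'n] x.
  rewrite inE => /orP[/eqP->|]; first exact: N'P.
  exact: NP.
exists N => n /NP{}NP; apply: (@le_lt_trans _ _ (3 * f)); last first.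
  by rewrite /f; lra.
apply: rnorm_bop_le => [|v]; first by rewrite mulr_ge0 ?ltW.
have [->|v0] := eqVneq v 0; first by rewrite bop0 rnorm0 mulr0.
have nv0 : 0 < rnorm v.
  rewrite lt_neqAle rnorm_ge0 andbT eq_sym; apply/eqP => /rnorm_eq0/eqP.
  by apply/negP.
have nE (x : R) : 0 <= x -> normc x%:C = x.
  by move=> x0; rewrite normcR ger0_norm.
pose v1 := (rnorm v)^-1%:C *: v.
have vE : v = (rnorm v)%:C *: v1.
  by rewrite scalerA -rmorphM/= divff ?gt_eqF// scale1r.
have nv1 : rnorm v1 <= 1.
  by rewrite rnormZ nE ?invr_ge0 ?rnorm_ge0// mulVf// gt_eqF.
rewrite [in leLHS]vE bopZ rnormZ nE ?rnorm_ge0// mulrC ler_wpM2r ?rnorm_ge0//.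
have [w ws Tw] := sP _ nv1.
apply: le_trans (rnorm_triangle (E n w) _ _) _.
have h1 : rnorm ((E n * T) v1 - E n w) <= f.
  rewrite bopME -bopB (le_trans (rnorm_bop _ _))//.
  by rewrite (le_trans _ (ltW Tw))// ler_piMl ?rnorm_ge0.
have h2 : rnorm (E n w - T v1) <= 2 * f.
  apply: le_trans (rnorm_triangle w _ _) _.
  by have := NP _ ws; rewrite (rnormB w); lra.
lra.
Qed.

End totally_bounded.

(** * Hilbert spaces: Riesz representation, adjoints, Schauder's theorem *)

Section inner_products.
Context (R : realType) (V : normedModType R[i]).

Record inner_product (dot : V -> V -> R[i]) : Prop := {
  dotDl : forall u v w, dot (u + v) w = dot u w + dot v w ;
  dotZl : forall c u v, dot (c *: u) v = c * dot u v ;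
  dotC : forall u v, dot v u = (dot u v)^* ;
  dot_rnorm : forall u, dot u u = (rnorm u ^+ 2)%:C
}.

Variable dot : V -> V -> R[i].
Hypothesis ip : inner_product dot.
Implicit Types (u v w : V) (A B : bop V).

Lemma dotDr u v w : dot u (v + w) = dot u v + dot u w.
Proof. by rewrite !(dotC ip _ u) (dotDl ip) rmorphD. Qed.

Lemma dotZr c u v : dot u (c *: v) = c^* * dot u v.
Proof. by rewrite !(dotC ip _ u) (dotZl ip) rmorphM. Qed.

Lemma dotNl u v : dot (- u) v = - dot u v.
Proof. by rewrite -scaleN1r (dotZl ip) mulN1r. Qed.

Lemma dotBl u v w : dot (u - v) w = dot u w - dot v w.
Proof. by rewrite (dotDl ip) dotNl. Qed.

Lemma dotNr u v : dot u (- v) = - dot u v.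
Proof. by rewrite !(dotC ip _ u) dotNl rmorphN. Qed.

Lemma dotBr u v w : dot u (v - w) = dot u v - dot u w.
Proof. by rewrite dotDr dotNr. Qed.

Lemma rnorm_sqrD u v :
  rnorm (u + v) ^+ 2 = rnorm u ^+ 2 + rnorm v ^+ 2 + 2 * ReC (dot u v).
Proof.
have E w : rnorm w ^+ 2 = ReC (dot w w) by rewrite (dot_rnorm ip).
rewrite !E (dotDl ip) !dotDr !ReD (dotC ip v u) ReJ.
ring.
Qed.

(** The squared norm of s u - <u, v> v with s = |v|^2 expands to
    s (s |u|^2 - |<u, v>|^2). *)
Lemma cauchy_schwarz u v : normc (dot u v) <= rnorm u * rnorm v.
Proof.
have [v0|v0] := eqVneq (rnorm v) 0.
  rewrite (rnorm_eq0 v0) rnorm0 mulr0.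
  by rewrite -[X in dot u X](subrr 0) dotBr subrr normc0.
have sv : 0 < rnorm v ^+ 2 by rewrite exprn_gt0// lt_neqAle eq_sym v0 rnorm_ge0.
rewrite -ler_sqr ?nnegrE ?normc_ge0 ?mulr_ge0 ?rnorm_ge0//.
rewrite -subr_ge0 -(pmulr_rge0 _ sv).
have := sqr_ge0 (rnorm ((rnorm v ^+ 2)%:C *: u - dot u v *: v)).
rewrite rnorm_sqrD rnormN !rnormZ normcR dotNr dotZr (dotZl ip).
rewrite ger0_norm ?sqr_ge0// !exprMn normc_sqr ReN !ReM ReJ ImJ !ImM/=.
set s := rnorm v; set x := ReC _; set y := ImC _ => h.
apply: le_trans h _; rewrite le_eqVlt; apply/orP; left; apply/eqP; ring.
Qed.

Lemma dot_ext u v : (forall w, dot w u = dot w v) -> u = v.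
Proof.
move=> uv; apply/eqP; rewrite -subr_eq0; apply/eqP/rnorm_eq0/eqP.
rewrite -sqrf_eq0 -(inj_eq (@complexI _)) -(dot_rnorm ip).
by rewrite dotBr uv subrr.
Qed.

Lemma cvg_dot (u v : nat -> V) (a b : V) : u @ \oo --> a -> v @ \oo --> b ->
  forall e : R, 0 < e ->
    exists N, forall n, (N <= n)%N -> normc (dot (u n) (v n) - dot a b) < e.
Proof.
move=> ua vb e e0.
have [K K0 KP] := cvg_rnorm_bound ua.
have e20 : 0 < e / 2 by rewrite divr_gt0.
have L0 : 0 < rnorm b + 1 by rewrite ltr_wpDl ?rnorm_ge0.
have K10 : 0 < K + 1 by rewrite ltr_wpDl.
have /cvg_rnormP/(_ _ (divr_gt0 e20 L0))[N1 N1P] := ua.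
have /cvg_rnormP/(_ _ (divr_gt0 e20 K10))[N2 N2P] := vb.
exists (maxn N1 N2) => n; rewrite geq_max => /andP[/N1P h1 /N2P h2].
have -> : dot (u n) (v n) - dot a b =
    dot (u n - a) b + dot (u n) (v n - b).
  by rewrite dotBl dotBr [RHS]addrC addrA subrK.
apply: le_lt_trans (le_normcD _ _) _; rewrite [ltRHS]splitr ltr_leD//.
  apply: le_lt_trans (cauchy_schwarz _ _) _.
  move: h1; rewrite ltr_pdivlMr//; apply: le_lt_trans.
  by rewrite ler_wpM2l ?rnorm_ge0// lerDl.
apply: le_trans (cauchy_schwarz _ _) _.
move: h2; rewrite ltr_pdivlMr// => /ltW; apply: le_trans.
by rewrite mulrC ler_wpM2l ?rnorm_ge0// (le_trans (KP n))// lerDl.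
Qed.

Definition adjoint_for A B := forall u v, dot (A u) v = dot u (B v).

Lemma adjoint_for_sym A B : adjoint_for A B -> adjoint_for B A.
Proof.
by move=> AB u v; rewrite (dotC ip) -AB -(dotC ip).
Qed.

Lemma adjoint_for_uniq A B C : adjoint_for A B -> adjoint_for A C -> B = C.
Proof.
by move=> AB AB'; apply: bopP => v; apply: dot_ext => w; rewrite -AB -AB'.
Qed.

Lemma adjoint_forD A B A' B' :
  adjoint_for A B -> adjoint_for A' B' -> adjoint_for (A + A') (B + B').
Proof. by move=> AB AB' u v; rewrite !bopDE (dotDl ip) dotDr AB AB'. Qed.

Lemma adjoint_forZ c A B : adjoint_for A B -> adjoint_for (c *: A) (c^* *: B).
Proof. by move=> AB u v; rewrite !bopZE (dotZl ip) dotZr conjCK AB. Qed.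

Lemma adjoint_forB A B A' B' :
  adjoint_for A B -> adjoint_for A' B' -> adjoint_for (A - A') (B - B').
Proof. by move=> AB AB' u v; rewrite !bopBE dotBl dotBr AB AB'. Qed.

Lemma adjoint_forM A B A' B' :
  adjoint_for A B -> adjoint_for A' B' -> adjoint_for (A * A') (B' * B).
Proof. by move=> AB AB' u v; rewrite !bopME AB AB'. Qed.

Lemma rnorm_adjoint_for A B : adjoint_for A B -> rnorm B <= rnorm A.
Proof.
move=> AB; apply: rnorm_bop_le; first exact: rnorm_ge0.
move=> v; have [->|Bv0] := eqVneq (rnorm (B v)) 0.
  by rewrite mulr_ge0 ?rnorm_ge0.
have Bv : 0 < rnorm (B v) by rewrite lt_neqAle eq_sym Bv0 rnorm_ge0.
rewrite -(ler_pM2l Bv) -expr2.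
have -> : rnorm (B v) ^+ 2 = ReC (dot (B v) (B v)) by rewrite (dot_rnorm ip).
rewrite -AB (le_trans (Re_le_normc _))//.
rewrite (le_trans (cauchy_schwarz _ _))// mulrCA mulrA ler_wpM2r ?rnorm_ge0//.
exact: rnorm_bop.
Qed.

Lemma adjoint_for_cvg (S T : nat -> bop V) A B :
  (forall n, adjoint_for (S n) (T n)) -> S @ \oo --> A -> T @ \oo --> B ->
  adjoint_for A B.
Proof.
move=> ST SA TB u v.
have cS : (fun n => S n u) @ \oo --> A u.
  by apply: cvg_bop_app => //; exact: cvg_cst.
have cT : (fun n => T n v) @ \oo --> B v.
  by apply: cvg_bop_app => //; exact: cvg_cst.
apply/eqP; rewrite -subr_eq0; apply/eqP/eq0_normc.
apply/le_anti; rewrite normc_ge0 andbT; apply/ler_addgt0Pl => e e0.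
rewrite addr0; have e20 : 0 < e / 2 by rewrite divr_gt0.
have [N1 N1P] := cvg_dot cS (cvg_cst v) e20.
have [N2 N2P] := cvg_dot (cvg_cst u) cT e20.
pose n := maxn N1 N2.
have := N1P n (leq_maxl _ _); have := N2P n (leq_maxr _ _).
rewrite -ST => h2 h1.
have -> : dot (A u) v - dot u (B v) =
  (dot (S n u) v - dot u (B v)) - (dot (S n u) v - dot (A u) v).
  by rewrite opprB [RHS]addrC addrA subrK.
apply: le_trans (le_normcD _ _) _.
by rewrite normcN [leRHS]splitr lerD// ltW.
Qed.

Hypothesis cV : seq_complete V.

(** The representing vector minimizes |u|^2 - 2 Re (f u): a minimizing sequence is
    Cauchy by the parallelogram identity, and the first-order condition at its
    limit says that f is the inner product with this limit. *)
Lemma riesz_representation (f : V -> R[i]) (C : R) :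
  (forall u v, f (u + v) = f u + f v) -> (forall c u, f (c *: u) = c * f u) ->
  (forall u, normc (f u) <= C * rnorm u) ->
  exists w, forall u, f u = dot u w.
Proof.
move=> fD fZ fC.
pose J u : R := rnorm u ^+ 2 - 2 * ReC (f u).
have JC u : - C ^+ 2 <= J u.
  have h := le_trans (Re_le_normc _) (fC u).
  have := sqr_ge0 (rnorm u - C); rewrite /J; nra.
have infJ : has_inf (range J).
  by split; [exists (J 0), 0|exists (- C ^+ 2) => _ [u _ <-]].
pose m := inf (range J).
have mJ u : m <= J u by apply: ge_inf; [exact: infJ.2|exists u].
pose d n : R := n.+1%:R^-1; have d0 n : 0 < d n by rewrite invr_gt0.
have dlt e : 0 < e -> exists N, forall n, (N <= n)%N -> d n < e.
  exact: harmonic_lt.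
have near_inf n : exists u, J u < m + d n.
  by have [_ [u _ <-] h] := inf_adherent (d0 n) infJ; exists u.
have [u uP] := choice near_inf.
have JD (t : R) a b : J (a + t%:C *: b) = J a + t ^+ 2 * rnorm b ^+ 2 +
    2 * t * (ReC (dot a b) - ReC (f b)).
  rewrite /J rnorm_sqrD rnormZ normcR exprMn real_normK ?num_real// dotZr fD fZ ReD.
  by rewrite !ReM ReJ ImJ/=; ring.
have par a b : rnorm (a - b) ^+ 2 <= 2 * (J a + J b - 2 * m).
  have E : a = b + 1%:C *: (a - b) by rewrite scale1r addrC subrK.
  have h1 := JD 1 b (a - b); rewrite -E in h1.
  have h2 := JD 2^-1 b (a - b).
  have := mJ (b + 2^-1%:C *: (a - b)); nra.
have [e e0|w uw] := cV (u := u).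
  have [N NP] := dlt (e ^+ 2 / 4) (divr_gt0 (exprn_gt0 2 e0) (ltr0Sn _ _)).
  exists N => k n Nk Nn; rewrite -ltr_sqr ?nnegrE ?rnorm_ge0 ?ltW//.
  apply: le_lt_trans (par _ _) _.
  have := uP k; have := uP n; have := NP k Nk; have := NP n Nn; lra.
(* The first-order condition gives the real parts; the imaginary parts follow
   by applying it to 'i *: v. *)
have reE v : ReC (f v) = ReC (dot v w).
  pose D := ReC (dot w v) - ReC (f v).
  have DP (t : R) : 0 <= t ^+ 2 * rnorm v ^+ 2 + 2 * t * D.
    apply/ler_addgt0Pl => e e0.
    have e20 : 0 < e / 2 by rewrite divr_gt0.
    have k0 : 0 < 2 * `|t| + 1 by rewrite ltr_wpDl ?mulr_ge0.
    have [N1 N1P] := dlt _ e20.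
    have [N2 N2P] := cvg_dot uw (cvg_cst v) (divr_gt0 e20 k0).
    pose n := maxn N1 N2.
    have := N1P n (leq_maxl _ _); have := N2P n (leq_maxr _ _) => /=.
    set x := dot (u n) v; set y := dot w v => xy dn.
    have h := mJ (u n + t%:C *: v); rewrite JD -/x in h.
    have un := uP n.
    have tb : 2 * t * (ReC x - ReC y) <= e / 2.
      have t2 : `|2 * t| <= 2 * `|t| + 1 by rewrite normrM ger0_norm// lerDl.
      rewrite (le_trans (ler_norm _))// normrM.
      have : `|ReC x - ReC y| <= normc (x - y).
        rewrite -ReN -ReD -sqrtr_sqr normcE2 ler_wsqrtr// lerDl.
        exact: sqr_ge0.
      move: xy; rewrite ltr_pdivlMr// => xy h1.
      have := normr_ge0 (2 * t); have := normc_ge0 (x - y); nra.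
    have -> : D = ReC x - ReC (f v) - (ReC x - ReC y) by rewrite /D; ring.
    move: h tb un dn; rewrite -/n; set P := rnorm v; lra.
  pose k := rnorm v ^+ 2 + 1; have k0 : 0 < k by rewrite ltr_wpDl ?sqr_ge0.
  have k1 : 1 <= k by rewrite lerDr sqr_ge0.
  (* k = |v|^2 + 1 instead of |v|^2, to include the case v = 0. *)
  have := DP (- D / k).
  have -> : rnorm v ^+ 2 = k - 1 by rewrite addrK.
  have -> : (- D / k) ^+ 2 * (k - 1) + 2 * (- D / k) * D =
      - (D ^+ 2 * (k + 1) / k ^+ 2).
    by field; rewrite gt_eqF.
  rewrite oppr_ge0 pmulr_lle0 ?invr_gt0 ?exprn_gt0//.
  rewrite pmulr_lle0; last by rewrite addr_gt0.
  move=> D0; have : D == 0 by rewrite -sqrf_eq0 eq_le D0 sqr_ge0.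
  by rewrite subr_eq0 => /eqP <-; rewrite (dotC ip) ReJ.
exists w => v; apply: complexP => //.
have := reE ('i *: v); rewrite fZ (dotZl ip) !ReM/= !mul0r !mul1r !sub0r.
exact: oppr_inj.
Qed.

Lemma adjoint_for_exists A : exists B, adjoint_for A B.
Proof.
have ex v : exists w, forall u, dot (A u) v = dot u w.
  apply: (@riesz_representation _ (rnorm A * rnorm v)) => [u u'|c u|u].
  - by rewrite bopD (dotDl ip).
  - by rewrite bopZ (dotZl ip).
  rewrite (le_trans (cauchy_schwarz _ _))// mulrAC ler_wpM2r ?rnorm_ge0//.
  exact: rnorm_bop.
have [B BP] := choice ex.
have Bb : B \in bounded_operator (V := V).
  apply/bounded_operatorP; split=> [c u v|].
    by apply: dot_ext => w; rewrite dotDr dotZr -!BP dotDr dotZr.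
  exists (rnorm A) => v; rewrite !rnormE -rmorphM lecR.
  have [->|Bv0] := eqVneq (rnorm (B v)) 0.
    by rewrite mulr_ge0 ?rnorm_ge0.
  have Bv : 0 < rnorm (B v) by rewrite lt_neqAle eq_sym Bv0 rnorm_ge0.
  rewrite -(ler_pM2l Bv) -expr2.
  have -> : rnorm (B v) ^+ 2 = ReC (dot (B v) (B v)) by rewrite (dot_rnorm ip).
  rewrite -BP (le_trans (Re_le_normc _))//.
  rewrite (le_trans (cauchy_schwarz _ _))// mulrCA mulrA.
  by rewrite ler_wpM2r ?rnorm_ge0 ?rnorm_bop.
by exists (MkBop Bb).
Qed.

(** Schauder: |B v|^2 = <A (B v), v>, so B is small wherever the compact
    operator A B is. *)
Lemma compact_adjoint_for A B :
  adjoint_for A B -> compact_operator A -> compact_operator B.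
Proof.
move=> AB cA.
have /(compact_operatorP cV) cAB : compact_operator (A * B).
  exact: compact_operatorMr.
apply/(compact_operatorP cV) => e e0.
have d0 : 0 < e ^+ 2 / 8 by rewrite divr_gt0// exprn_gt0.
have [s sP] := cAB _ d0.
(* The preimages of the balls of the net cut the unit ball into finitely many
   pieces; one representative of each is enough. *)
pose near_ w v := rnorm v <= 1 /\ rnorm ((A * B) v - w) < e ^+ 2 / 8.
have pick_near w : exists x, (exists v, near_ w v) -> near_ w x.
  have [[v vw]|nw] := pselect (exists v, near_ w v); first by exists v.
  by exists 0 => /nw.
have [g gP] := choice pick_near.
exists [seq B (g w) | w <- s] => v v1; have [w ws vw] := sP v v1.
exists (B (g w)); first by apply/mapP; exists w.
have [gw1 gw] : near_ w (g w) by apply: gP; exists v.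
rewrite -bopB -ltr_sqr ?nnegrE ?rnorm_ge0 ?ltW//.
have -> (x : V) : rnorm (B x) ^+ 2 = ReC (dot (B x) (B x)).
  by rewrite (dot_rnorm ip).
rewrite -AB (le_lt_trans (Re_le_normc _))//.
rewrite (le_lt_trans (cauchy_schwarz _ _))//.
have h1 : rnorm (A (B (v - g w))) <= e ^+ 2 / 4.
  have -> : A (B (v - g w)) = (A * B) v - (A * B) (g w) by rewrite -bopB.
  apply: le_trans (rnorm_triangle w _ _) _.
  rewrite (rnormB w); move: vw gw; lra.
have h2 : rnorm (v - g w) <= 2.
  by apply: le_trans (rnormD _ _) _; rewrite rnormN; lra.
have := rnorm_ge0 (v - g w); have := rnorm_ge0 (A (B (v - g w))).
have := exprn_gt0 2 e0; nra.
Qed.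

End inner_products.

Section operator_completeness.
Context (R : realType) (V : normedModType R[i]).
Hypothesis cV : seq_complete V.

Lemma bop_complete : seq_complete (bop V).
Proof.
move=> T cT.
have pw v : exists l : V, (fun n => T n v) @ \oo --> l.
  apply: cV => e e0.
  have k0 : 0 < rnorm v + 1 by rewrite ltr_wpDl ?rnorm_ge0.
  have [N NP] := cT _ (divr_gt0 e0 k0).
  exists N => m n Nm Nn; rewrite -bopBE (le_lt_trans (rnorm_bop _ _))//.
  have := NP m n Nm Nn; rewrite ltr_pdivlMr//; apply: le_lt_trans.
  by rewrite ler_wpM2l ?rnorm_ge0// lerDl.
have [L LP] := choice pw.
have Tlim (e : R) : 0 < e -> exists N, forall n, (N <= n)%N ->
    forall v, rnorm (T n v - L v) <= e * rnorm v.
  move=> e0; have [N NP] := cT _ e0; exists N => n Nn v.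
  apply/ler_addgt0Pr => f f0.
  have /cvg_rnormP/(_ _ f0)[N' N'P] := LP v.
  pose m := maxn N N'.
  apply: le_trans (rnorm_triangle (T m v) _ _) _.
  rewrite lerD//; last exact/ltW/N'P/leq_maxr.
  rewrite -bopBE (le_trans (rnorm_bop _ _))// ler_wpM2r ?rnorm_ge0// ltW//.
  by rewrite NP// leq_maxl.
have linL : linear L.
  move=> c u v.
  have h1 := LP (c *: u + v).
  have h2 : (fun n => T n (c *: u + v)) @ \oo --> c *: L u + L v.
    under eq_fun do rewrite bopD bopZ.
    by apply: cvgD; [apply: cvgZr; exact: LP|exact: LP].
  exact: (seq_cvg_unique h1 h2).
have [N NP] := Tlim _ ltr01.
have bL : L \in bounded_operator (V := V).
  apply/bounded_operatorP; split => //; exists (1 + rnorm (T N)) => v.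
  rewrite !rnormE -rmorphM lecR -[L v](subrK (T N v)).
  rewrite (le_trans (rnormD _ _))// mulrDl lerD ?rnorm_bop//.
  by rewrite rnormB NP.
exists (MkBop bL); apply/cvg_rnormP => e e0.
have [N' N'P] := Tlim _ (divr_gt0 e0 (ltr0Sn R 1)).
exists N' => n N'n; apply: (@le_lt_trans _ _ (e / 2)); last by lra.
apply: rnorm_bop_le => [|v]; first by rewrite divr_ge0// ltW.
by rewrite bopBE N'P.
Qed.

End operator_completeness.

(** * The inner product of L2 *)

Section L2_inner_product.
Context d (T : measurableType d) (R : realType).
Variable mu : {measure set T -> \bar R}.
Local Notation H := (L2 mu).
Implicit Types (f g : T -> R[i]) (u v w : H).

Definition sqint_integral f : \bar R := (\int[mu]_x (normc (f x) ^+ 2)%:E)%E.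

Lemma L2classB (f g : L2fun mu) :
  L2class (f - g) = L2class f - L2class g.
Proof. by rewrite L2classD -scaleN1r L2classZ scaleN1r. Qed.

Lemma measurable_normc_sqr f : cmeasurable f ->
  measurable_fun setT (fun x => (normc (f x) ^+ 2)%:E).
Proof.
move=> mf; apply/measurable_EFinP; apply: measurable_funX.
exact: cmeasurable_normc.
Qed.

Lemma sqint_integral_ge0 f : (0 <= sqint_integral f)%E.
Proof. by apply: integral_ge0 => x _; rewrite lee_fin sqr_ge0. Qed.

Lemma L2normE_sqint_integral f : L2normE mu f = (sqint_integral f `^ 2^-1)%E.
Proof.
rewrite /L2normE unlock; congr (_ `^ _)%E; apply: eq_integral => x _ /=.
by rewrite ger0_norm ?normc_ge0// powR_mulrn// normc_ge0.
Qed.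

Lemma sqintE f : f \in sqint mu <->
  cmeasurable f /\ (sqint_integral f < +oo)%E.
Proof.
split=> [/sqintP|] [mf foo]; [split=> //|apply/sqintP; split=> //].
  move: foo; rewrite L2normE_sqint_integral => foo.
  rewrite ltey; apply/eqP => foo'; move: foo.
  by rewrite foo' poweRyr.
rewrite L2normE_sqint_integral; move: foo (sqint_integral_ge0 f).
by case: (sqint_integral f) => //= r _ _; rewrite ltry.
Qed.

Lemma rnorm_sqint_integral (f : L2fun mu) :
  (rnorm (L2class f) ^+ 2)%:E = sqint_integral f.
Proof.
have [mf foo] := (sqintE f).1 (valP f).
rewrite /rnorm L2norm_classE L2normE_sqint_integral/=.
move: foo (sqint_integral_ge0 f).
case: (sqint_integral f) => //= r _; rewrite lee_fin => r0.
by rewrite powR12_sqrt// sqr_sqrtr.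
Qed.

Lemma normc_sqr_integrable (f : L2fun mu) :
  mu.-integrable setT (fun x => (normc (f x) ^+ 2)%:E).
Proof.
have [mf foo] := (sqintE f).1 (valP f); apply/integrableP; split.
  exact: measurable_normc_sqr.
by under eq_integral => x _ do rewrite gee0_abs ?lee_fin ?sqr_ge0//.
Qed.

Lemma cmeasurable_conj f : cmeasurable f -> cmeasurable (fun x => (f x)^*).
Proof.
move=> [mr mi]; split.
  by rewrite (_ : _ \o _ = ReC \o f)//; apply/funext => x /=; rewrite ReJ.
rewrite (_ : _ \o _ = \- (ImC \o f)); first exact: measurable_funN.
by apply/funext => x /=; rewrite ImJ.
Qed.

Lemma Re_mulJ (f g : T -> R[i]) x :
  ReC (f x * (g x)^*) = ReC (f x) * ReC (g x) + ImC (f x) * ImC (g x).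
Proof. by case: (f x) (g x) => [a b] [a' b'] /=; rewrite mulrN opprK. Qed.

Lemma Im_mulJ (f g : T -> R[i]) x :
  ImC (f x * (g x)^*) = ImC (f x) * ReC (g x) - ReC (f x) * ImC (g x).
Proof.
by case: (f x) (g x) => [a b] [a' b'] /=; rewrite mulrN addrC.
Qed.

Lemma dot_integrable (F : R[i] -> R) (f g : L2fun mu) :
  (forall z, `|F z| <= normc z) -> 
  measurable_fun setT (fun x => F (f x * (g x)^*)) ->
  mu.-integrable setT (EFin \o (fun x => F (f x * (g x)^*))).
Proof.
move=> FE mF; have h := integrableD measurableT (normc_sqr_integrable f)
  (normc_sqr_integrable g).
apply: (le_integrable _ _ _ h) => //; first exact/measurable_EFinP.
move=> x _ /=; rewrite lee_fin (le_trans (FE _))//.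
rewrite ger0_norm ?addr_ge0 ?sqr_ge0// normcM normcJ.
by have := normc_ge0 (f x); have := normc_ge0 (g x); nra.
Qed.

Lemma dot_integrable_Re (f g : L2fun mu) :
  mu.-integrable setT (EFin \o (fun x => ReC (f x * (g x)^*))).
Proof.
apply: dot_integrable => [z|]; first exact: abs_Re_le_normc.
have [mf _] := L2funP f; have [mg _] := L2funP g.
exact: (cmeasurableM mf (cmeasurable_conj mg)).1.
Qed.

Lemma dot_integrable_Im (f g : L2fun mu) :
  mu.-integrable setT (EFin \o (fun x => ImC (f x * (g x)^*))).
Proof.
apply: dot_integrable => [z|]; first exact: Im_le_normc.
have [mf _] := L2funP f; have [mg _] := L2funP g.
exact: (cmeasurableM mf (cmeasurable_conj mg)).2.
Qed.

Lemma L2dot_class (f g : L2fun mu) : L2dot (L2class f) (L2class g) =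
  (\int[mu]_x ReC (f x * (g x)^*)) +i* (\int[mu]_x ImC (f x * (g x)^*)).
Proof.
have E (F : R[i] -> R) : (forall f g : L2fun mu, mu.-integrable setT
      (EFin \o (fun x => F (f x * (g x)^*)))) ->
    \int[mu]_x F (repr (L2class f) x * (repr (L2class g) x)^*) =
    \int[mu]_x F (f x * (g x)^*).
  move=> iF; congr fine; apply: ae_eq_integral => //.
  - exact: (measurable_int mu (iF _ _)).
  - exact: (measurable_int mu (iF _ _)).
  apply: filterS2 (repr_L2class f) (repr_L2class g) => x + + _.
  by move=> /(_ I) -> /(_ I) ->.
by rewrite /L2dot !E//; [exact: dot_integrable_Im|exact: dot_integrable_Re].
Qed.

Lemma L2dot_inner_product : inner_product (@L2dot _ T R mu).
Proof.
split.
- move=> u v w; rewrite -(L2class_repr u) -(L2class_repr v) -(L2class_repr w).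
  move: (repr u) (repr v) (repr w) => {u v w} f g k.
  rewrite -L2classD !L2dot_class; apply: complexP => /=.
    rewrite -RintegralD//; [|exact: dot_integrable_Re..].
    by apply: eq_Rintegral => x _; rewrite -ReD -mulrDl.
  rewrite -RintegralD//; [|exact: dot_integrable_Im..].
  by apply: eq_Rintegral => x _; rewrite -raddfD -mulrDl.
- move=> c u v; rewrite -(L2class_repr u) -(L2class_repr v).
  move: (repr u) (repr v) => {u v} f g.
  rewrite -L2classZ !L2dot_class.
  have iR := dot_integrable_Re f g; have iI := dot_integrable_Im f g.
  case: c => a b; apply: complexP => /=.
    rewrite -!RintegralZl// -RintegralB//; last 2 first.
    + exact: (integrableZl measurableT _ iR).
    + exact: (integrableZl measurableT _ iI).
    apply: eq_Rintegral => x _.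
    transitivity (ReC ((a +i* b) * (f x * (g x)^*))); last by case: (f x * _).
    by rewrite mulrA.
  rewrite -!RintegralZl// -RintegralD//; last 2 first.
  + exact: (integrableZl measurableT _ iI).
  + exact: (integrableZl measurableT _ iR).
  apply: eq_Rintegral => x _.
  transitivity (ImC ((a +i* b) * (f x * (g x)^*))); last by case: (f x * _).
  by rewrite mulrA.
- move=> u v; rewrite -(L2class_repr u) -(L2class_repr v).
  move: (repr u) (repr v) => {u v} f g.
  rewrite !L2dot_class; apply: complexP; rewrite ?ReJ ?ImJ/=.
    apply: eq_Rintegral => x _; rewrite !Re_mulJ; ring.
  rewrite -mulN1r -RintegralZl//; last exact: dot_integrable_Im.
  apply: eq_Rintegral => x _; rewrite !Im_mulJ; ring.
move=> u; rewrite -(L2class_repr u); move: (repr u) => {u} f.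
rewrite L2dot_class; apply: complexP => /=.
  have -> : rnorm (L2class f) ^+ 2 = fine (sqint_integral f).
    by rewrite -rnorm_sqint_integral.
  congr fine; apply: eq_integral => x _.
  by rewrite normc_sqr Re_mulJ !expr2.
rewrite /Rintegral (_ : (fun x => _) = cst 0%E) ?integral_cst// ?mul0e//.
by apply/funext => x; rewrite Im_mulJ mulrC subrr.
Qed.

End L2_inner_product.

(** * Completeness of L2 *)

Section L2_completeness.
Context d (T : measurableType d) (R : realType).
Variable mu : {measure set T -> \bar R}.

(** The sequences z k -/+ 2 c / 2^k are monotone and enclose the limit, which
    gives the rate of convergence at the same time. *)
Lemma geometric_increments_cvg (z : nat -> R) (c : R) :
  (forall k, `|z k.+1 - z k| <= c / 2 ^+ k) ->
  exists2 l : R, z @ \oo --> l & forall k, `|l - z k| <= 2 * c / 2 ^+ k.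
Proof.
move=> zc; pose q k : R := (2 ^+ k)^-1.
have qS k : q k.+1 = q k / 2 by rewrite /q exprS invfM mulrC.
have q0 k : 0 < q k by rewrite invr_gt0 exprn_gt0.
have c0 : 0 <= c by have := zc 0%N; rewrite expr0 divr1; exact: le_trans.
pose a k := z k - 2 * c * q k; pose b k := z k + 2 * c * q k.
have zq k : - (c * q k) <= z k.+1 - z k <= c * q k.
  by have := zc k; rewrite ler_norml.
have a_nd : nondecreasing_seq a.
  by apply/nondecreasing_seqP => k; rewrite /a qS; have := zq k; lra.
have b_ni : nonincreasing_seq b.
  by apply/nonincreasing_seqP => k; rewrite /b qS; have := zq k; lra.
have ab j k : a j <= b k.
  apply: (@le_trans _ _ (a (maxn j k))); first by apply: a_nd; exact: leq_maxl.
  apply: (@le_trans _ _ (b (maxn j k))); last by apply: b_ni; exact: leq_maxr.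
  by rewrite /a /b; have := q0 (maxn j k); nra.
have cvga : cvgn a.
  apply: nondecreasing_is_cvgn => //.
  by exists (b 0%N) => _ [k _ <-]; exact: ab.
exists (limn a) => [|k]; last first.
  have h1 : a k <= limn a by exact: nondecreasing_cvgn_le.
  have h2 : limn a <= b k by apply: limr_le => //; apply: nearW => j; exact: ab.
  by move: h1 h2; rewrite ler_norml /a /b -/(q k); lra.
have -> : z = (fun k => a k + 2 * c * q k).
  by apply/funext => k; rewrite /a subrK.
rewrite -[X in _ --> X]addr0 -[X in _ + X](mulr0 (2 * c)).
apply: cvgD => //; apply: cvgM; first exact: cvg_cst.
rewrite (_ : q = (fun k => 2^-1 ^+ k)); last first.
  by apply/funext => k; rewrite /q exprVn.
by apply: cvg_expr; rewrite ger0_norm ?invr_ge0// invf_lt1// ltr1n.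
Qed.

Lemma fine_limn_esup (z : nat -> R) (l : R) : z @ \oo --> l ->
  fine (limn_esup (EFin \o z)) = l.
Proof.
move=> zl; have h : EFin \o z @ \oo --> l%:E by apply: cvg_EFin => //; exact: nearW.
have c : cvgn (EFin \o z) by apply/cvg_ex; exists l%:E.
by rewrite is_cvg_limn_esupE// (cvg_lim _ h).
Qed.

(** Along a subsequence the increments are square summable against the weights
    4^k, so they decrease geometrically outside a null set. The pointwise limit
    is taken as an upper limit, which is measurable everywhere. *)
Lemma L2_complete : seq_complete (L2 mu).
Proof.
move=> u cu.
pose q k : R := (4 ^+ k)^-1.
have q0 k : 0 < q k by rewrite invr_gt0 exprn_gt0.
have [N NP] := choice (fun k => cu _ (q0 k)).
pose s := fix s k := if k is j.+1 then maxn (N k) (s j) else N 0%N.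
have Ns k : (N k <= s k)%N by case: k => //= k; exact: leq_maxl.
have sS k : (s k <= s k.+1)%N by exact: leq_maxr.
pose g k : L2fun mu := repr (u (s k)).
have ug k : u (s k) = L2class (g k) by rewrite L2class_repr.
pose D k : L2fun mu := g k.+1 - g k.
have Dq k : (sqint_integral mu (D k) <= (q k ^+ 2)%:E)%E.
  rewrite -rnorm_sqint_integral lee_fin ler_sqr ?nnegrE ?rnorm_ge0 ?ltW//.
  rewrite L2classB -!ug; apply: NP => //.
  exact: leq_trans (Ns k) (sS k).
have mD k : cmeasurable (D k) := (L2funP (D k)).1.
pose w k x := ((4 ^+ k)%:E * (normc (D k x) ^+ 2)%:E)%E.
have w0 k x : (0 <= w k x)%E by rewrite mule_ge0// lee_fin ?sqr_ge0// exprn_ge0.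
have mw k : measurable_fun setT (w k).
  by apply: measurable_funeM; exact: measurable_normc_sqr.
pose W x := (\sum_(0 <= k <oo) w k x)%E.
have W0 x : (0 <= W x)%E by apply: nneseries_ge0 => k _ _; exact: w0.
have mW : measurable_fun setT W.
  by apply: (@ge0_emeasurable_sum _ _ _ setT w xpredT).
have intw k : (\int[mu]_x w k x <= (q k)%:E)%E.
  rewrite (ge0_integralZl mu measurableT (measurable_normc_sqr (mD k))); last 2 first.
  - by move=> x _; rewrite lee_fin sqr_ge0.
  - by rewrite lee_fin exprn_ge0.
  have e4 : (0 <= (4 ^+ k : R)%:E)%E by rewrite lee_fin exprn_ge0.
  apply: le_trans (lee_wpmul2l e4 (Dq k)) _.
  by rewrite -EFinM lee_fin expr2 mulrA divff ?mul1r//.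
(* The partial sums of the q k = 4^-k are at most 2 - 2 q n. *)
have intW : (\int[mu]_x W x <= 2%:E)%E.
  rewrite integral_nneseries//; apply: lime_le.
    by apply: is_cvg_nneseries => k _ _; exact: integral_ge0.
  apply: nearW => n; apply: (@le_trans _ _ (2 - 2 * q n)%:E); last first.
    by rewrite lee_fin lerBlDr lerDl mulr_ge0// ltW.
  elim: n => [|n IH]; first by rewrite big_geq// /q expr0 invr1 mulr1 subrr.
  rewrite big_nat_recr//=; apply: le_trans (leeD IH (intw n)) _.
  rewrite -EFinD lee_fin /q exprS invfM.
  have := q0 n; rewrite /q; lra.
have iW : mu.-integrable setT W.
  apply/integrableP; split => //.
  under eq_integral => x _ do rewrite gee0_abs//.
  exact: le_lt_trans intW (ltry _).
pose f x : R[i] := fine (limn_esup (fun k => (ReC (g k x))%:E)) +i*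
  fine (limn_esup (fun k => (ImC (g k x))%:E)).
have mf : cmeasurable f.
  split.
    apply: (@measurableT_comp _ _ _ _ _ _ (@fine R)) => //.
    apply: measurable_fun_limn_esup => k; apply/measurable_EFinP.
    exact: (L2funP (g k)).1.1.
  apply: (@measurableT_comp _ _ _ _ _ _ (@fine R)) => //.
  apply: measurable_fun_limn_esup => k; apply/measurable_EFinP.
  exact: (L2funP (g k)).1.2.
have fg : \forall x \ae mu, setT x -> forall k,
    ((normc (f x - g k x) ^+ 2)%:E <= (8 * q k)%:E * W x)%E.
  apply: filterS (integrable_ae measurableT iW) => x /(_ I) Wfin _ k.
  have {}Wfin : W x \is a fin_num := Wfin.
  pose c := Num.sqrt (fine (W x)).
  have c2 : c ^+ 2 = fine (W x) by rewrite sqr_sqrtr// fine_ge0.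
  have Dc j : normc (D j x) <= c / 2 ^+ j.
    rewrite ler_pdivlMr ?exprn_gt0// -ler_sqr ?nnegrE ?mulr_ge0 ?normc_ge0//;
      last exact: sqrtr_ge0.
    rewrite exprMn c2 -exprM mulnC exprM -natrX -lee_fin fineK// EFinM muleC.
    apply: (@le_trans _ _ (\sum_(0 <= i < j.+1) w i x)%E); last first.
      by apply: nneseries_lim_ge => i _ _; exact: w0.
    rewrite big_nat_recr//= -[leLHS]add0e leeD//.
    by apply: sume_ge0 => i _; exact: w0.
  have [j|lR cR lRP] := @geometric_increments_cvg (fun k => ReC (g k x)) c.
    by rewrite -raddfB; apply: le_trans (Dc j); exact: abs_Re_le_normc.
  have [j|lI cI lIP] := @geometric_increments_cvg (fun k => ImC (g k x)) c.
    by rewrite -raddfB; apply: le_trans (Dc j); exact: Im_le_normc.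
  have fx : f x = lR +i* lI.
    by apply: complexP; [exact: fine_limn_esup cR|exact: fine_limn_esup cI].
  rewrite -(fineK Wfin) -EFinM lee_fin -c2 fx normc_sqr !raddfB/=.
  have qE : q k = ((2 ^+ k)^-1) ^+ 2.
    by rewrite /q exprVn -exprM mulnC exprM -(natrX _ 2 2).
  have hR := lRP k; have hI := lIP k.
  have E (y : R) : `|y| <= 2 * c / 2 ^+ k -> y ^+ 2 <= 4 * q k * c ^+ 2.
    move=> h; rewrite -real_normK ?num_real//.
    have -> : 4 * q k * c ^+ 2 = (2 * c / 2 ^+ k) ^+ 2.
      by rewrite qE; ring.
    by rewrite ler_sqr ?nnegrE// (le_trans _ h).
  have := E _ hR; have := E _ hI; lra.
pose Q : R := fine (\int[mu]_x W x)%E.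
have QE : (\int[mu]_x W x)%E = Q%:E.
  rewrite fineK// ge0_fin_numE ?integral_ge0//.
  exact: le_lt_trans intW (ltry _).
have Q0 : 0 <= Q by rewrite fine_ge0// integral_ge0.
have sfg k : (sqint_integral mu (fun x => f x - g k x)%R <= (8 * q k * Q)%:E)%E.
  rewrite EFinM -QE -ge0_integralZl//; last by rewrite lee_fin mulr_ge0// ltW.
  have mfg : cmeasurable (fun x => f x - g k x).
    have := cmeasurableD mf (cmeasurableZ (-1) (L2funP (g k)).1).
    by congr cmeasurable; apply/funext => x; rewrite !fctE scaleN1r.
  apply: ae_ge0_le_integral => //.
  - by move=> x _; rewrite lee_fin sqr_ge0.
  - exact: measurable_normc_sqr.
  - by move=> x _; rewrite mule_ge0// lee_fin mulr_ge0// ltW.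
  - exact: measurable_funeM.
  by apply: filterS fg => x /[apply] /(_ k).
have fS : f \in sqint mu.
  have h : (fun x => f x - g 0%N x) \in sqint mu.
    apply/sqintE; split; last exact: le_lt_trans (sfg 0%N) (ltry _).
    have := cmeasurableD mf (cmeasurableZ (-1) (L2funP (g 0%N)).1).
    by congr cmeasurable; apply/funext => x; rewrite !fctE scaleN1r.
  have -> : f = (fun x => f x - g 0%N x) + val (g 0%N).
    by apply/funext => x; rewrite fctE subrK.
  exact: rpredD h (valP (g 0%N)).
pose F := MkL2fun fS; exists (L2class F); apply/cvg_rnormP => e e0.
have Fg k : rnorm (u (s k) - L2class F) ^+ 2 <= 8 * q k * Q.
  rewrite rnormB ug -L2classB -lee_fin rnorm_sqint_integral.
  exact: sfg.
have qle k : q k <= k.+1%:R^-1.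
  rewrite lef_pV2 ?posrE ?exprn_gt0// -natrX ler_nat.
  exact: ltn_expl.
have small (e' : R) : 0 < e' -> exists k, q k < e'.
  move=> /harmonic_lt[k /(_ k (leqnn k)) kP]; exists k.
  exact: le_lt_trans (qle k) kP.
(* k is taken so large that u (s k) is within e / 2 of the tail of the sequence
   and, by Fg, within e / 2 of the limit. *)
pose t := Num.min (e / 2) ((e / 2) ^+ 2 / (8 * (Q + 1))).
have Q1 : 0 < 8 * (Q + 1) by rewrite mulr_gt0// ltr_wpDl.
have [|k] := small t.
  by rewrite lt_min !divr_gt0//= ?exprn_gt0// divr_gt0.
rewrite lt_min (ltr_pdivlMr _ _ Q1) => /andP[k1 k2].
exists (s k) => n sn.
apply: le_lt_trans (rnorm_triangle (u (s k)) _ _) _.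
rewrite [ltRHS]splitr ltrD//.
  apply: le_lt_trans k1; apply/ltW/NP => //.
  exact: leq_trans (Ns k) sn.
rewrite -ltr_sqr ?nnegrE ?rnorm_ge0 ?divr_ge0 ?ltW//.
apply: le_lt_trans (Fg k) _; apply: le_lt_trans k2.
have := q0 k; nra.
Qed.

End L2_completeness.

(** * Functions with compact support on a manifold *)

Section compactly_supported_functions.
Context (R : realType) (M : ptopologicalType).
Implicit Types (U V : set M) (f g : M -> R) (phi psi : M -> R[i]).

Definition real_Cc U f := [/\ continuous f,
  compact (closure [set x | f x != 0]) & closure [set x | f x != 0] `<=` U].

Definition cplx f : M -> R[i] := fun x => (f x)%:C.

Lemma cplx_continuous f :
  continuous f -> continuous (cplx f : M -> R[i]^o).
Proof.
move=> cf x; apply/cvgrPdist_lt => e e0.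
have eE := pos_complexE e0.
have e0' : 0 < ReC e by rewrite -ltcR -eE.
have /cvgrPdist_lt/(_ _ e0') := cf x; apply: filterS => y /=.
by rewrite -rmorphB/= normCE normcR eE ltcR.
Qed.

Lemma real_Cc_cplx U f : real_Cc U f -> Cc U (cplx f).
Proof.
move=> [cf kf sf].
have E : csupport (cplx f) = closure [set x | f x != 0].
  congr closure; apply/seteqP; split=> x /=; rewrite /cplx.
    by apply: contra => /eqP ->.
  by apply: contra => /eqP[->].
by split; rewrite ?E//; exact: cplx_continuous.
Qed.

Lemma csupportP phi x : ~ csupport phi x -> phi x = 0.
Proof.
by move=> nx; apply/eqP/negPn/negP => p0; apply: nx; exact: subset_closure.
Qed.

Lemma Cc_sub U V phi : U `<=` V -> Cc U phi -> Cc V phi.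
Proof. by move=> UV [cp kp sp]; split => //; exact: subset_trans sp UV. Qed.

Lemma csupport_sub phi psi : (forall x, phi x = 0 -> psi x = 0) ->
  csupport psi `<=` csupport phi.
Proof.
by move=> h; apply: closure_subset => x /=; apply: contra => /eqP/h ->.
Qed.

Lemma Cc_mulr U phi psi : Cc U phi -> continuous (psi : M -> R[i]^o) ->
  Cc U (fun x => phi x * psi x).
Proof.
move=> [cp kp sp] cs.
have sub : csupport (fun x => phi x * psi x) `<=` csupport phi.
  by apply: csupport_sub => x ->; rewrite mul0r.
split.
- by move=> x; apply: cvgM; [exact: cp|exact: cs].
- by apply: subclosed_compact kp sub; exact: closed_closure.
- exact: subset_trans sub sp.
Qed.

Lemma Cc_mulI U V phi psi : Cc U phi -> Cc V psi ->
  Cc (U `&` V) (fun x => phi x * psi x).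
Proof.
move=> Uphi Vpsi; have [cp _ _] := Uphi; have [cs _ ss] := Vpsi.
have [c k s] := Cc_mulr Uphi cs; split => // x xs; split; first exact: s.
apply: ss; move: x xs; apply: csupport_sub => x ->; exact: mulr0.
Qed.

Lemma Cc_conj U phi : Cc U phi -> Cc U (fun x => (phi x)^*).
Proof.
move=> [cp kp sp].
have E : csupport (fun x => (phi x)^*) = csupport phi.
  by congr closure; apply/seteqP; split=> x /=; rewrite conjc_eq0.
split; rewrite ?E; [move=> x|exact: kp|exact: sp].
apply/cvgrPdist_lt => e e0; have /cvgrPdist_lt/(_ _ e0) := cp x.
apply: filterS => y; rewrite -rmorphB.
by case: (phi x - phi y) => a b; rewrite !normCE !normcE2/= sqrrN.
Qed.

Lemma Cc_C0 U phi : Cc U phi -> C0 phi.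
Proof.
move=> [cp kp _]; split => // e e0; exists (csupport phi) => // x /csupportP ->.
by rewrite normr0 ltcR.
Qed.

Lemma Cc_continuous U phi : Cc U phi -> continuous (phi : M -> R[i]^o).
Proof. by case. Qed.

End compactly_supported_functions.

Section bumps.
Context (R : realType) (d : nat) (M : ptopologicalType).
Hypothesis manifoldM : is_manifold R d M.

Lemma continuous_at_sum (T : topologicalType) (J : Type) (r : seq J)
    (F : J -> T -> R) (x : T) : (forall j, {for x, continuous (F j)}) ->
  {for x, continuous (fun y => \sum_(j <- r) F j y)}.
Proof.
move=> cF; elim: r => [|j r IH].
  rewrite (_ : (fun y => _) = cst 0); first exact: cst_continuous.
  by apply/funext => y; rewrite big_nil.
rewrite (_ : (fun y => _) = (fun y => F j y + \sum_(j <- r) F j y)).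
  by apply: cvgD; [exact: cF|exact: IH].
by apply/funext => y; rewrite big_cons.
Qed.

(** Extension by zero: V and the complement of K cover M, and b vanishes on the
    latter. *)
Lemma continuous_at_zero_ext (V K : set M) (b : M -> R) : open V -> closed K ->
  K `<=` V -> (forall x, V x -> {for x, continuous b}) ->
  (forall x, ~ K x -> b x = 0) -> continuous b.
Proof.
move=> oV cK KV bV bK x; have [Vx|nVx] := pselect (V x); first exact: bV.
have nKx : ~ K x by move/KV.
have Kx : nbhs x (~` K).
  by apply: open_nbhs_nbhs; split => //; exact: closed_openC.
apply/cvgrPdist_lt => e e0; apply: filterS Kx => y /bK ->.
by rewrite (bK _ nKx) subrr normr0.
Qed.

Lemma ball_rV (c v : 'rV[R]_d) (r : R) : 0 < r ->
  (forall i, `|v ord0 i - c ord0 i| < r) -> ball c r v.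
Proof.
move=> r0 h; split=> // i j; rewrite ord1 -ball_normE/=.
by have := h j; rewrite distrC.
Qed.

(** In a chart around x, the function r / 2 minus the l1-distance to the image
    of x, truncated at 0, is supported in a compact cube. *)
Lemma bump (U : set M) (x : M) : open U -> U x ->
  exists b : M -> R, [/\ real_Cc U b, forall y, 0 <= b y & 0 < b x].
Proof.
move=> oU Ux; have [hM _ /(_ x)[V [h [Vx chart]]]] := manifoldM.
have [oV oh ch [g gh cg]] := chart.
rewrite continuous_open_subspace// in ch.
have cg' := cg; rewrite continuous_open_subspace// in cg'.
have hVx : (h @` V) (h x) by exists x.
have nx : nbhs (h x) (h @` V `&` g @^-1` (U `&` V)).
  apply: filterI; first by apply: open_nbhs_nbhs; split.
  apply: (cg' (h x)); first exact: mem_set.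
  rewrite gh//; apply: open_nbhs_nbhs; split; first exact: openI.
  by split.
have /nbhs_ballP[r /= r0 rP] := nx.
pose c := h x.
pose seg i := `[c ord0 i - r / 2, c ord0 i + r / 2]%classic.
pose Q := [set v : 'rV[R]_d | forall i, seg i (v ord0 i)].
have cQ : compact Q.
  by apply: (@rV_compact R d seg) => i; exact: segment_compact.
have Qball : Q `<=` ball c r.
  move=> v Qv; apply: ball_rV => // i; have := Qv i.
  by rewrite /seg/= in_itv/= => /andP[? ?]; rewrite ltr_norml; apply/andP; split; lra.
have QV : Q `<=` h @` V by move=> v /Qball/rP[].
have QU : Q `<=` g @^-1` (U `&` V) by move=> v /Qball/rP[].
pose K := g @` Q.
have kK : compact K.
  apply: continuous_compact => //; exact: continuous_subspaceW cg.
have clK : closed K by exact: compact_closed.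
have KUV : K `<=` U `&` V by move=> _ [v /QU Qv <-].
pose dist y : R := \sum_i `|h y ord0 i - c ord0 i|.
pose b y : R := if y \in (V : set M) then Num.max 0 (r / 2 - dist y) else 0.
have b0 y : 0 <= b y by rewrite /b; case: ifP => // _; rewrite le_max lexx.
have bK y : ~ K y -> b y = 0.
  move=> nKy; rewrite /b; case: ifPn => // /set_mem Vy.
  apply/max_idPl; rewrite leNgt; apply/negP => dy; apply: nKy.
  exists (h y); last exact: gh.
  move=> i; rewrite /seg/= in_itv/=.
  have : `|h y ord0 i - c ord0 i| <= dist y.
    by rewrite /dist (bigD1 i)//= lerDl sumr_ge0.
  by rewrite ler_norml => /andP[? ?]; apply/andP; split; lra.
have cb : continuous b.
  apply: (continuous_at_zero_ext oV clK) => //; first by move=> y /KUV[].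
  move=> y Vy.
  have cdist : {for y, continuous dist}.
    apply: (continuous_at_sum (F := fun i z => `|h z ord0 i - c ord0 i|)) => i.
    apply: cvg_norm; apply: cvgB; last exact: cvg_cst.
    apply: (@continuous_comp _ _ _ h (fun v : 'rV[R]_d => v ord0 i)).
      by apply: ch; exact: mem_set.
    exact: coord_continuous.
  have cmax : {for y, continuous (cst 0 \max (fun z => r / 2 - dist z))}.
    apply: continuous_max; first exact: cst_continuous.
    by apply: cvgB; [exact: cvg_cst|exact: cdist].
  have near_V : \forall z \near y, (cst 0 \max (fun z => r / 2 - dist z)) z = b z.
    have : nbhs y V by apply: open_nbhs_nbhs; split.
    by apply: filterS => z Vz; rewrite /b mem_set.
  suff : b @ y --> (cst 0 \max (fun z => r / 2 - dist z)) y.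
    by rewrite (nbhs_singleton near_V).
  by apply: cvg_trans cmax; exact: near_eq_cvg.
have sub : closure [set y | b y != 0] `<=` K.
  rewrite [X in _ `<=` X](closure_id K).1//; apply: closure_subset => y /= by0.
  by apply: contrapT => /bK/eqP; exact/negP.
exists b; split => //.
- split => //; last by apply: subset_trans sub _; move=> y /KUV[].
  by apply: subclosed_compact kK sub; exact: closed_closure.
- rewrite /b mem_set// lt_max; apply/orP; right.
  rewrite /dist big1 ?subr0 ?divr_gt0// => i _.
  by rewrite subrr normr0.
Qed.

(** The bumps are scaled so that the sets where they exceed 1 cover K. Then their
    sum S is at least 1 on K, and dividing by the maximum of S and 1, which
    vanishes nowhere, normalizes S to 1 on K and keeps it at most 1 elsewhere.
    Square roots are taken because operators will be compressed on both sides. *)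
Lemma sqrt_partition_of_unity (I : Type) (U : I -> set M) (K : set M) :
  (forall i, open (U i)) -> compact K -> K `<=` \bigcup_i U i ->
  exists (n : nat) (ind : 'I_n -> I) (f : 'I_n -> M -> R),
    [/\ forall k, real_Cc (U (ind k)) (f k),
        forall x, 0 <= \sum_k f k x ^+ 2 <= 1 &
        forall x, K x -> \sum_k f k x ^+ 2 = 1].
Proof.
move=> oU kK KU.
have bumps x : exists b : M -> R, K x -> exists i,
    [/\ real_Cc (U i) b, forall y, 0 <= b y & 1 < b x].
  have [Kx|nKx] := pselect (K x); last by exists (cst 0).
  have [i _ Ux] := KU _ Kx; have [b [[cb kb sb] b0 bx]] := bump (oU i) Ux.
  have p0 : 0 < 2 / b x by rewrite divr_gt0.
  have E : [set y | 2 / b x * b y != 0] = [set y | b y != 0].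
    by apply/seteqP; split=> y /=; rewrite mulf_eq0 (gt_eqF p0).
  exists (fun y => 2 / b x * b y) => _; exists i; split.
  - by split; rewrite ?E// => y; apply: cvgM; [exact: cvg_cst|exact: cb].
  - by move=> y; rewrite mulr_ge0// ltW.
  - by rewrite divfK ?gt_eqF// ltr1n.
have [b bP] := choice bumps.
have cb x : K x -> continuous (b x) by move=> /bP[i [[]]].
have kK' := kK; rewrite compact_cover in kK'.
have [x Kx||D DK KD] := kK' M K (fun x => [set y | 1 < b x y]).
- have := open_comp (f := b x) (D := [set y | 1 < y]).
  apply; [by move=> y _; exact: cb|exact: open_gt].
- by move=> x Kx; exists x => //; have [i []] := bP _ Kx.
pose s := enum_fset D; pose n := size s; pose a k := nth point s k.
have aK (k : 'I_n) : K (a k) by apply/set_mem/DK/mem_nth.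
have [ind indP] := choice (fun k => bP _ (aK k)).
pose S x := \sum_(k < n) b (a k) x.
have S0 x : 0 <= S x by apply: sumr_ge0 => k _; have [_ ->] := indP k.
have S1 x : K x -> 1 <= S x.
  move=> /KD[y yD] /= bx; have yn : (index y s < n)%N by rewrite index_mem.
  rewrite /S (bigD1 (Ordinal yn))//= /a nth_index//.
  rewrite (le_trans (ltW bx))// lerDl sumr_ge0// => k _.
  by have [_ ->] := indP k.
have cS : continuous S.
  move=> x; apply: (continuous_at_sum (F := fun k : 'I_n => b (a k))) => k.
  exact: (cb _ (aK k)).
pose g x := Num.max 1 (S x); have g0 x : 0 < g x by rewrite lt_max ltr01.
have cg : continuous g.
  move=> x; apply: (@continuous_max _ _ (cst 1)) => //; last exact: cS.
  exact: cst_continuous.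
pose f (k : 'I_n) x := Num.sqrt (b (a k) x / g x).
have bg (k : 'I_n) x : 0 <= b (a k) x / g x.
  by apply: divr_ge0; [case: (indP k)|exact: ltW].
have sumE x : \sum_k f k x ^+ 2 = S x / g x.
  by rewrite mulr_suml; apply: eq_bigr => k _; rewrite sqr_sqrtr.
exists n, ind, f; split => [k|x|x Kx].
- have [[cbk kbk sbk] b0 _] := indP k.
  have sub : closure [set x | f k x != 0] `<=` closure [set x | b (a k) x != 0].
    apply: closure_subset => x /=; apply: contra => /eqP bx.
    by rewrite /f bx mul0r sqrtr0.
  split.
  + move=> x; apply: (@continuous_comp _ _ _ (fun x => b (a k) x / g x)).
      apply: cvgM; first exact: cbk.
      by apply: cvgV; [rewrite gt_eqF|exact: cg].
    exact: sqrt_continuous.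
  + by apply: subclosed_compact kbk sub; exact: closed_closure.
  + exact: subset_trans sub sbk.
- rewrite sumE; apply/andP; split.
    by apply: divr_ge0; [exact: S0|exact: ltW].
  by rewrite ler_pdivrMr// mul1r le_max lexx orbT.
- rewrite sumE /g (max_idPr (S1 x Kx)) divff// gt_eqF//.
  by rewrite (lt_le_trans _ (S1 x Kx)).
Qed.

(** The sum of the squares of a partition of unity for the one-set cover. *)
Lemma urysohn_Cc (U K : set M) : open U -> compact K -> K `<=` U ->
  exists f : M -> R, [/\ real_Cc U f, forall x, 0 <= f x <= 1 &
    forall x, K x -> f x = 1].
Proof.
move=> oU kK KU.
have [|n [ind [f [fU f01 f1]]]] :=
    @sqrt_partition_of_unity unit (fun _ => U) K (fun _ => oU) kK.
  by move=> x /KU Ux; exists tt.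
exists (fun x => \sum_k f k x ^+ 2); split => //.
have sub : closure [set x | \sum_k f k x ^+ 2 != 0] `<=`
    \big[setU/set0]_(k < n) closure [set x | f k x != 0].
  rewrite [X in _ `<=` X](closure_id _).1; last first.
    by apply: closed_bigsetU => k _; exact: closed_closure.
  apply: closure_subset => x /= sx; apply: contrapT => nx.
  move/eqP: sx; apply; apply: big1 => k _; apply/eqP; rewrite sqrf_eq0.
  apply/negPn/negP => fx; apply: nx; rewrite (bigD1 k)//=; left.
  exact: subset_closure.
split.
- move=> x.
  apply: (continuous_at_sum (F := fun k x => f k x ^+ 2)) => k.
  by have [cf _ _] := fU k; apply: cvgM; exact: cf.
- apply: subclosed_compact sub; first exact: closed_closure.
  by apply: bigsetU_compact => k _; case: (fU k).
- apply: subset_trans sub _; elim/big_ind: _ => // [A B AU BU|k _].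
    by rewrite subUset.
  by case: (fU k).
Qed.

End bumps.

Section exhaustion.
Context (R : realType) (d : nat) (M : ptopologicalType).
Hypothesis manifoldM : is_manifold R d M.
Context (I : Type) (U : I -> set M).
Hypotheses (countableI : countable [set: I]) (oU : forall i, open (U i)).
Hypotheses (coverU : \bigcup_i U i = [set: M]).
Hypothesis relcompactU : forall i, compact (closure (U i)).

(** chi n is 1 on the closures of the charts numbered below n; a compact set is
    covered by finitely many charts. *)
Lemma exhaustion : exists chi : nat -> M -> R,
  [/\ forall n, real_Cc setT (chi n), forall n x, 0 <= chi n x <= 1 &
    forall K, compact K ->
      exists N, forall n, (N <= n)%N -> forall x, K x -> chi n x = 1].
Proof.
have [e einj] := countable_injP _ countableI.
pose C k := \bigcup_(i in [set i | e i = k]) closure (U i).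
have kC k : compact (C k).
  have [[i ik]|nk] := pselect (exists i, e i = k).
    rewrite (_ : C k = closure (U i))//; apply/seteqP; split=> x.
      by move=> [j jk]; rewrite (einj j i) ?in_setT// jk ik.
    by exists i.
  rewrite (_ : C k = set0); first exact: compact0.
  by apply/seteqP; split=> x // [j jk]; case: nk; exists j.
pose L n := \big[setU/set0]_(k < n) C k.
have kL n : compact (L n) by apply: bigsetU_compact => k _.
have [chi chiP] := choice (fun n =>
  urysohn_Cc manifoldM openT (kL n) (@subsetT _ (L n))).
exists chi; split=> [n|n|K kK]; try by have [] := chiP n.
pose V n := \bigcup_(i in [set i | (e i < n)%N]) U i.
rewrite compact_cover in kK.
have [n _|x Kx|D _ KD] := kK nat setT V.
- by apply: bigcup_open => i _.
- have : setT x by []. 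
  by rewrite -coverU => -[i _ Ux]; exists (e i).+1 => //; exists i => /=.
exists (\max_(n <- enum_fset D) n) => n Dn x Kx.
have [_ _ ->//] := chiP n.
have [m mD [i /= em Ux]] := KD x Kx.
have mn : (e i < n)%N.
  apply: leq_trans em _; apply: leq_trans Dn.
  exact: (@leq_bigmax_seq _ _ xpredT id).
rewrite /L -bigcup_mkord; exists (e i) => //.
by exists i => //; exact: subset_closure.
Qed.

End exhaustion.

(** * Multiplication operators *)

Section multiplication_operators.
Context (R : realType) (M : ptopologicalType).
Variable nu : {measure set (borelType M) -> \bar R}.
Local Notation H := (L2 nu).
Local Notation mul := (mulop nu).
Local Notation CcM := (@Cc R M setT).
Implicit Types (phi psi : M -> R[i]) (u v : H).

Lemma L2class_eq (f g : L2fun nu) : (forall x, f x = g x) ->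
  L2class f = L2class g.
Proof. by move=> fg; congr L2class; apply/val_inj/funext. Qed.

Lemma mulop_ext (T : bop H) phi : CcM phi ->
  (forall f g : L2fun nu, (forall x, g x = phi x * f x) ->
    T (L2class f) = L2class g) -> mul phi = T.
Proof.
move=> cphi h; apply: bopP => v; rewrite -(L2class_repr v).
by have [g gE ->] := mulop_CcE (repr v) cphi; rewrite (h _ g).
Qed.

Lemma mulopM phi psi : CcM phi -> CcM psi ->
  mul (fun x => phi x * psi x) = mul phi * mul psi.
Proof.
move=> cphi cpsi; apply: mulop_ext.
  exact: Cc_mulr cphi (Cc_continuous cpsi).
move=> f g gE; rewrite bopME.
have [g1 g1E ->] := mulop_CcE f cpsi; have [g2 g2E ->] := mulop_CcE g1 cphi.
by apply: L2class_eq => x; rewrite gE g2E g1E mulrA.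
Qed.

Lemma mulopC phi psi : CcM phi -> CcM psi -> mul phi * mul psi = mul psi * mul phi.
Proof.
move=> cphi cpsi; rewrite -!mulopM//; congr mulop; apply/funext => x.
exact: mulrC.
Qed.

Lemma mulop_absorb phi psi : CcM phi -> CcM psi ->
  (forall x, psi x * phi x = phi x) ->
  mul psi * mul phi = mul phi /\ mul phi * mul psi = mul phi.
Proof.
move=> cphi cpsi h; rewrite mulopC//.
suff -> : mul phi * mul psi = mul phi by [].
rewrite mulopC// -mulopM//; congr mulop; exact/funext.
Qed.

Lemma mulop_partition (n : nat) (f : 'I_n -> M -> R[i]) chi :
  (forall k, CcM (f k)) -> CcM chi ->
  (forall x, (\sum_k f k x ^+ 2) * chi x = chi x) ->
  \sum_k mul (f k) * (mul (f k) * mul chi) = mul chi.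
Proof.
move=> cf cchi fchi; apply/esym/mulop_ext => // g g' g'E.
have term k : exists h : L2fun nu, (forall x, h x = f k x ^+ 2 * chi x * g x) /\
    (mul (f k) * (mul (f k) * mul chi)) (L2class g) = L2class h.
  rewrite !bopME; have [g1 g1E ->] := mulop_CcE g cchi.
  have [g2 g2E ->] := mulop_CcE g1 (cf k).
  have [g3 g3E ->] := mulop_CcE g2 (cf k).
  by exists g3; split=> // x; rewrite g3E g2E g1E expr2 !mulrA.
have [h hP] := choice term.
have sumE (s : seq 'I_n) :
    (\sum_(k <- s) mul (f k) * (mul (f k) * mul chi)) (L2class g) =
    L2class (\sum_(k <- s) h k).
  elim: s => [|k s IH]; first by rewrite !big_nil.
  by rewrite !big_cons bopDE IH L2classD (hP k).2.
rewrite sumE; apply: L2class_eq => x; rewrite g'E.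
have -> : (\sum_k h k : L2fun nu) x = \sum_k h k x.
  elim: (index_enum _) => [|k s IH]; first by rewrite !big_nil.
  by rewrite !big_cons -IH.
under eq_bigr => k _ do rewrite (hP k).1.
by rewrite -!mulr_suml fchi.
Qed.

Lemma mulop_adjoint phi : CcM phi ->
  is_adjoint (mul phi) (mul (fun x => (phi x)^*)).
Proof.
move=> cphi u v; rewrite -(L2class_repr u) -(L2class_repr v).
have [g1 g1E ->] := mulop_CcE (repr u) cphi.
have [g2 g2E ->] := mulop_CcE (repr v) (Cc_conj cphi).
rewrite !L2dot_class.
have E x : g1 x * (repr v x)^* = repr u x * (g2 x)^*.
  have cc (z : R[i]) : Num.conj (conjc z) = z := conjcK z.
  by rewrite g1E g2E rmorphM/= cc mulrA [phi x * _]mulrC.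
by congr (_ +i* _); apply: eq_Rintegral => x _; rewrite E.
Qed.

Lemma rnorm_mulop (K : R) phi : CcM phi -> (forall x, normc (phi x) <= K) ->
  rnorm (mul phi) <= K.
Proof.
move=> cphi phiK.
have K0 : 0 <= K by apply: le_trans (phiK point); exact: normc_ge0.
apply: rnorm_bop_le => // v; rewrite -(L2class_repr v).
have [g gE ->] := mulop_CcE (repr v) cphi.
rewrite -lecR rmorphM/= -!rnormE.
exact: (L2norm_mul (mu := nu) (phi := phi) phiK gE).
Qed.

(** Dominated convergence, with |f|^2 as the dominating function. *)
Lemma mulop_strong (chi : nat -> M -> R) :
  (forall n, CcM (cplx (chi n))) -> (forall n x, 0 <= chi n x <= 1) ->
  (forall x, exists N, forall n, (N <= n)%N -> chi n x = 1) ->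
  forall v, (fun n => mul (cplx (chi n)) v) @ \oo --> v.
Proof.
move=> cchi chi01 chi1 v; rewrite -(L2class_repr v); set f := repr v.
have ex n : exists D : L2fun nu,
    mul (cplx (chi n)) (L2class f) - L2class f = L2class D /\
    forall x, D x = (chi n x - 1)%:C * f x.
  have [g gE ->] := mulop_CcE f (cchi n).
  exists (g - f); split; first by rewrite L2classB.
  move=> x; transitivity (g x - f x) => //.
  by rewrite gE /cplx rmorphB/= mulrBl mul1r.
have [D DP] := choice ex.
have Dle n x : normc (D n x) ^+ 2 <= normc (f x) ^+ 2.
  rewrite (DP n).2 normcM normcR exprMn ler_piMl ?sqr_ge0//.
  rewrite real_normK ?num_real//; have /andP[? ?] := chi01 n x; nra.
have [||||_ _] := @dominated_convergence _ _ R nu setT measurableT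
  (fun n x => (normc (D n x) ^+ 2)%:E) (cst 0%E)
  (fun x => (normc (f x) ^+ 2)%:E) _ _ _ (normc_sqr_integrable f) _.
- by move=> n; apply: measurable_normc_sqr; exact: (L2funP (D n)).1.
- exact: measurable_cst.
- apply: aeW => x _; have [N NP] := chi1 x.
  apply: cvg_near_cst; exists N => // n Nn /=.
  by rewrite (DP n).2 NP// subrr mul0r normc0 expr0n.
- apply: aeW => x n _.
  by rewrite gee0_abs ?lee_fin ?sqr_ge0.
rewrite integral_cst// mul0e => /fine_cvg cv0.
apply/cvg_rnormP => e e0.
have /cvgrPdist_lt/(_ _ (exprn_gt0 2 e0))[N _ NP] := cv0.
exists N => n /NP /=; rewrite sub0r normrN => h1.
rewrite -ltr_sqr ?nnegrE ?rnorm_ge0 ?ltW//.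
apply: le_lt_trans h1; apply: le_trans (ler_norm _).
have E : fine (sqint_integral nu (D n)) = rnorm (L2class (D n)) ^+ 2.
  by rewrite -rnorm_sqint_integral.
by rewrite (DP n).1 -E; exact: lexx.
Qed.

End multiplication_operators.

(** * Boundedness of *-homomorphisms *)

Section cstar_algebras.
Context (R : realType) (B : cstarAlgType R).
Implicit Types a b c : B.

Lemma cmulNl a b : cmul (- a) b = - cmul a b.
Proof. by rewrite -scaleN1r cmulZl scaleN1r. Qed.

Lemma cmulNr a b : cmul a (- b) = - cmul a b.
Proof. by rewrite -scaleN1r cmulZr scaleN1r. Qed.

Lemma cmulBl a b c : cmul (a - b) c = cmul a c - cmul b c.
Proof. by rewrite cmulDl cmulNl. Qed.

Lemma cmulBr a b c : cmul a (b - c) = cmul a b - cmul a c.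
Proof. by rewrite cmulDr cmulNr. Qed.

Lemma cmul0l a : cmul 0 a = 0.
Proof. by have := cmulBl a a a; rewrite !subrr. Qed.

Lemma cmul0r a : cmul a 0 = 0.
Proof. by have := cmulBr a a a; rewrite !subrr. Qed.

Lemma cstarN a : cstar (- a) = - cstar a.
Proof. by rewrite -scaleN1r cstarZ rmorphN rmorph1 scaleN1r. Qed.

Lemma cstarB a b : cstar (a - b) = cstar a - cstar b.
Proof. by rewrite cstarD cstarN. Qed.

Lemma rnorm_cmul a b : rnorm (cmul a b) <= rnorm a * rnorm b.
Proof. by rewrite -lecR rmorphM/= -!rnormE; exact: cmul_norm. Qed.

Lemma rnorm_cstar_cmul a : rnorm (cmul (cstar a) a) = rnorm a ^+ 2.
Proof. by have := cstar_norm a; rewrite !rnormE -rmorphXn => /complexI. Qed.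

(** The C*-identity and submultiplicativity give |b| <= |b^*| for every b. *)
Lemma rnorm_cstar a : rnorm (cstar a) = rnorm a.
Proof.
have h b : rnorm b <= rnorm (cstar b).
  have [b0|b0] := eqVneq (rnorm b) 0; first by rewrite b0 rnorm_ge0.
  have pb : 0 < rnorm b by rewrite lt_neqAle eq_sym b0 rnorm_ge0.
  by rewrite -(ler_pM2r pb) -expr2 -rnorm_cstar_cmul rnorm_cmul.
by apply/le_anti; rewrite h -{2}(cstarK a) h.
Qed.

Lemma cvg_cmul (u v : nat -> B) a b : u @ \oo --> a -> v @ \oo --> b ->
  (fun n => cmul (u n) (v n)) @ \oo --> cmul a b.
Proof.
by apply: cvg_bilinear; [exact: cmulBl|exact: cmulBr|exact: rnorm_cmul].
Qed.

Lemma cvg_cstar (u : nat -> B) a : u @ \oo --> a ->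
  (fun n => cstar (u n)) @ \oo --> cstar a.
Proof.
move=> /cvg_rnormP h; apply/cvg_rnormP => e /h[N NP]; exists N => n /NP.
by rewrite -cstarB rnorm_cstar.
Qed.

Lemma cstar_complete : seq_complete B.
Proof.
move=> u cu.
have : cvg (u @ \oo).
  apply/cauchy_cvgP/cauchy_ballP => e e0.
  have eE := pos_complexE e0.
  have [|N NP] := cu (ReC e); first by rewrite -ltcR -eE.
  pose A := u @` [set n | (N <= n)%N].
  exists (A, A) => [|[_ _] [/= [m Nm <-] [n Nn <-]]].
    by split; exists N => // n Nn; exists n.
  rewrite -ball_normE/= rnormE eE ltcR.
  exact: NP.
by move=> /cvg_ex.
Qed.

Lemma scale2 (V : lmodType R[i]) (v : V) : 2%:C *: v = v + v.
Proof.
have -> : 2%:C = 1 + 1 :> R[i] by apply: complexP => //=; rewrite addr0.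
by rewrite scalerDl !scale1r.
Qed.

(** With w := x - i z one gets w^* w = 2 z and w^* - w = 2 i z, hence
    |w|^2 = 2 |z| <= 2 |w|, so that |w| <= 2, and |x| <= |w| since x is the
    selfadjoint part of w. In a unital algebra the hypothesis reads
    x^2 + (1 - z)^2 = 1, so that w + i = x + i (1 - z) is unitary. *)
Lemma rnorm_cayley (x z : B) : cstar x = x -> cstar z = z ->
  cmul x z = cmul z x -> z = 2^-1%:C *: (cmul x x + cmul z z) -> rnorm x <= 2.
Proof.
move=> xs zs xz zE.
have z2 : cmul x x + cmul z z = 2%:C *: z.
  by rewrite [in RHS]zE scalerA -rmorphM/= divff ?scale1r// pnatr_eq0.
pose w := x - 'i *: z.
have ws : cstar w = x + 'i *: z.
  have iJ : Num.conj ('i : R[i]) = - 'i by apply: complexP => //=; rewrite oppr0.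
  by rewrite cstarB cstarZ xs zs iJ scaleNr opprK.
have ww : cmul (cstar w) w = 2%:C *: z.
  rewrite ws cmulDl !cmulBr !cmulZl !cmulZr scalerA -z2 xz.
  have -> : 'i * 'i = - 1 :> R[i].
    by apply: complexP => /=; rewrite ?mulr0 ?mul0r ?mulr1 ?mul1r ?sub0r
      ?addr0 ?oppr0.
  by rewrite scaleN1r opprK addrA subrK.
have n2 (c : B) : rnorm (2%:C *: c) = 2 * rnorm c.
  by rewrite rnormZ normcR ger0_norm.
have ni (c : B) : rnorm ('i *: c) = rnorm c.
  by rewrite rnormZ normcE2/= expr0n expr1n add0r sqrtr1 mul1r.
have zw : 2 * rnorm z <= 2 * rnorm w.
  have E : 2%:C *: ('i *: z) = cstar w - w.
    by rewrite ws opprB [x + _]addrC addrACA subrr addr0 scale2.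
  rewrite -[rnorm z]ni -n2 E (le_trans (rnormD _ _))// rnormN rnorm_cstar.
  by rewrite mulr_natl mulr2n.
have xw : 2 * rnorm x <= 2 * rnorm w.
  have E : 2%:C *: x = cstar w + w.
    by rewrite ws addrACA subrr addr0 scale2.
  rewrite -n2 E (le_trans (rnormD _ _))// rnorm_cstar.
  by rewrite mulr_natl mulr2n.
have : rnorm w ^+ 2 = 2 * rnorm z by rewrite -rnorm_cstar_cmul ww n2.
have := rnorm_ge0 w; nra.
Qed.

End cstar_algebras.

Lemma cauchy_of_geometric_increments (R : realType) (V : normedModType R[i])
    (u : nat -> V) (K : R) : seq_complete V ->
  (forall n, rnorm (u n.+1 - u n) <= K / 2 ^+ n) -> exists l : V, u @ \oo --> l.
Proof.
move=> cV uK; apply: cV => e e0.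
pose q n : R := (2 ^+ n)^-1; have q0 n : 0 < q n by rewrite invr_gt0 exprn_gt0.
have qS n : q n.+1 = q n / 2 by rewrite /q exprS invfM mulrC.
have K0 : 0 <= K.
  by have := uK 0%N; rewrite expr0 divr1; apply: le_trans; exact: rnorm_ge0.
have tail n k : rnorm (u (n + k)%N - u n) <= 2 * K * q n - 2 * K * q (n + k)%N.
  elim: k => [|k IH]; first by rewrite addn0 !subrr rnorm0.
  rewrite addnS qS; apply: le_trans (rnorm_triangle (u (n + k)%N) _ _) _.
  have := uK (n + k)%N; rewrite -/(q _); lra.
have k0 : 0 < 4 * K + 1 by rewrite ltr_wpDl// mulr_ge0.
have [N /(_ N (leqnn N)) NP] := harmonic_lt (divr_gt0 e0 k0).
have qN : q N * (4 * K + 1) < e.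
  rewrite -ltr_pdivlMr//; apply: le_lt_trans NP.
  by rewrite lef_pV2 ?posrE ?exprn_gt0// -natrX ler_nat; exact: ltn_expl.
exists N => m n /subnKC <- /subnKC <-.
apply: le_lt_trans (rnorm_triangle (u N) _ _) _; rewrite [X in _ + X]rnormB.
have := tail N (m - N)%N; have := tail N (n - N)%N.
set x := q (N + (m - N))%N; set y := q (N + (n - N))%N.
have x0 : 0 < x by exact: q0.
have y0 : 0 < y by exact: q0.
have := q0 N; nra.
Qed.

Section star_homs_are_bounded.
Context (R : realType) (M : ptopologicalType).
Variable nu : {measure set (borelType M) -> \bar R}.
Local Notation H := (L2 nu).
Context (B : cstarAlgType R) (S : set (bop H)) (F : bop H -> B).
Hypotheses (sS : star_subalgebra S) (cS : closed S) (hF : star_hom_on S F).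

Let ip : inner_product (@L2dot _ _ R nu) := L2dot_inner_product nu.

Lemma star_hom0 : F 0 = 0.
Proof.
have [S0 _ _ _ _] := sS; have [_ FZ _ _] := hF.
by rewrite -(scale0r (0 : bop H)) FZ// scale0r.
Qed.

(** The fixed point c = (a^2 + c^2) / 2 is 1 - sqrt (1 - a^2); it is obtained
    by iteration inside S, which avoids both square roots and the unit. *)
Lemma one_minus_sqrt (a : bop H) : S a -> is_adjoint a a -> rnorm a <= 2^-1 ->
  exists c : bop H, [/\ S c, is_adjoint c c, a * c = c * a &
    c = 2^-1%:C *: (a * a + c * c)].
Proof.
move=> Sa sa a2; have [S0 SD SZ SM _] := sS.
pose s := fix s n : bop H := if n is k.+1 then 2^-1%:C *: (a * a + s k * s k) else 0.
have hR : (2^-1%:C : R[i])^* = 2^-1%:C by apply: complexP => //=; rewrite oppr0.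
have n2 : normc (2^-1%:C : R[i]) = 2^-1 by rewrite normcR ger0_norm// invr_ge0.
have sP n : [/\ S (s n), is_adjoint (s n) (s n), a * s n = s n * a &
    rnorm (s n) <= 2^-1].
  elim: n => [|n [Sn an cn bn]] /=.
    split; rewrite ?mulr0 ?mul0r ?rnorm0 ?invr_ge0//.
    by have := adjoint_forZ ip 0 sa; rewrite conjC0 !scale0r.
  split.
  - by apply: SZ; apply: SD; apply: SM.
  - rewrite -{2}hR; apply: (adjoint_forZ ip); apply: (adjoint_forD ip).
      exact: (adjoint_forM sa sa).
    exact: (adjoint_forM an an).
  - by rewrite bopZr bopZl mulrDr mulrDl !mulrA cn -!mulrA cn.
  - rewrite rnormZ n2.
    have h1 : rnorm (a * a) <= 2^-1 * 2^-1.
      by rewrite (le_trans (rnormM _ _))// ler_pM ?rnorm_ge0.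
    have h2 : rnorm (s n * s n) <= 2^-1 * 2^-1.
      by rewrite (le_trans (rnormM _ _))// ler_pM ?rnorm_ge0.
    by have := rnormD (a * a) (s n * s n); lra.
have incr n : rnorm (s n.+1 - s n) <= 1 / 2 ^+ n.
  elim: n => [|n IH].
    rewrite expr0 divr1 subr0; have [_ _ _ h] := sP 1%N.
    by apply: le_trans h _; lra.
  have -> : s n.+2 - s n.+1 = 2^-1%:C *:
      (s n.+1 * (s n.+1 - s n) + (s n.+1 - s n) * s n).
    rewrite -[s n.+2]/(2^-1%:C *: (a * a + s n.+1 * s n.+1)).
    rewrite -[X in _ - X]/(2^-1%:C *: (a * a + s n * s n)).
    rewrite -scalerBr; congr (_ *: _).
    move: (s n.+1) (s n) => x y.
    by rewrite mulrBr mulrBl addrA subrK opprD addrACA subrr add0r.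
  have [_ _ _ b1] := sP n.+1; have [_ _ _ b0] := sP n.
  rewrite rnormZ n2 exprS; set D := s n.+1 - s n in IH *.
  have h1 : rnorm (s n.+1 * D) <= 2^-1 * rnorm D.
    by rewrite (le_trans (rnormM _ _))// ler_wpM2r ?rnorm_ge0.
  have h2 : rnorm (D * s n) <= rnorm D * 2^-1.
    by rewrite (le_trans (rnormM _ _))// ler_wpM2l ?rnorm_ge0.
  have := rnormD (s n.+1 * D) (D * s n).
  move: IH; rewrite invfM; set q := (2 ^+ n)^-1; lra.
have [c sc] := cauchy_of_geometric_increments
  (bop_complete (@L2_complete _ _ R nu)) incr.
exists c; split.
- apply: (closed_cvg _ cS) sc; first by apply: nearW => n; have [] := sP n.
- by apply: (adjoint_for_cvg ip _ sc sc) => n; have [] := sP n.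
- have h1 : (fun n => a * s n) @ \oo --> a * c.
    by apply: cvg_bopM => //; exact: cvg_cst.
  have h2 : (fun n => a * s n) @ \oo --> c * a.
    rewrite (_ : (fun n => _) = (fun n => s n * a)).
      by apply: cvg_bopM => //; exact: cvg_cst.
    by apply/funext => n; have [] := sP n.
  exact: (seq_cvg_unique h1 h2).
have h1 : (fun n => s n.+1) @ \oo --> c by rewrite (cvg_shiftS s).
have h2 : (fun n => s n.+1) @ \oo --> 2^-1%:C *: (a * a + c * c).
  apply: cvgZr; apply: cvgD; first exact: cvg_cst.
  exact: cvg_bopM.
exact: (seq_cvg_unique h1 h2).
Qed.

(** The relation between a and 1 - sqrt (1 - a^2) is algebraic, hence it is
    preserved by F. *)
Lemma star_hom_small_selfadjoint (a : bop H) :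
  S a -> is_adjoint a a -> rnorm a <= 2^-1 -> rnorm (F a) <= 2.
Proof.
move=> Sa sa a2; have [_ SD SZ SM _] := sS; have [FD FZ FM FJ] := hF.
have [c [Sc sc ac cE]] := one_minus_sqrt Sa sa a2.
apply: (@rnorm_cayley _ _ (F a) (F c)).
- by rewrite -(FJ a a).
- by rewrite -(FJ c c).
- by rewrite -!FM// ac.
- by rewrite -!FM// -FD -?FZ -?cE//; [exact: SD (SM _ _ _ _) (SM _ _ _ _)|exact: SM..].
Qed.

Lemma star_hom_selfadjoint (a : bop H) :
  S a -> is_adjoint a a -> rnorm (F a) <= 4 * rnorm a.
Proof.
move=> Sa sa; have [_ _ SZ _ _] := sS; have [_ FZ _ _] := hF.
have [a0|a0] := eqVneq (rnorm a) 0.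
  by rewrite (rnorm_eq0 a0) star_hom0 !rnorm0 mulr0.
have pa : 0 < rnorm a by rewrite lt_neqAle eq_sym a0 rnorm_ge0.
pose t := (2 * rnorm a)^-1; have t0 : 0 < t by rewrite invr_gt0 mulr_gt0.
have tR : Num.conj (t%:C : R[i]) = t%:C by apply: complexP => //=; rewrite oppr0.
have nt : normc (t%:C : R[i]) = t by rewrite normcR gtr0_norm.
have := @star_hom_small_selfadjoint (t%:C *: a) (SZ _ _ Sa).
rewrite FZ// !rnormZ nt => h.
have ta : t * rnorm a = 2^-1 by rewrite /t invfM -mulrA mulVf ?mulr1.
have : t * rnorm (F a) <= 2.
  apply: h; last by rewrite ta.
  by rewrite -{2}tR; exact: (adjoint_forZ ip).
by rewrite mulrC -ler_pdivlMr// /t invrK mulrA -natrM.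
Qed.

(** Reduces to the selfadjoint T^* T by the C*-identity in B. *)
Lemma star_hom_bounded (T : bop H) : S T -> rnorm (F T) <= 2 * rnorm T.
Proof.
move=> ST; have [_ _ _ SM SJ] := sS; have [_ _ FM FJ] := hF.
have [T' ST' TT'] := SJ _ ST.
have T'T := adjoint_for_sym ip TT'.
have h := @star_hom_selfadjoint (T' * T) (SM _ _ ST' ST) (adjoint_forM T'T TT').
rewrite -ler_sqr ?nnegrE ?mulr_ge0 ?rnorm_ge0//.
rewrite -rnorm_cstar_cmul -(FJ _ _ ST ST' TT') -FM//.
apply: le_trans h _; rewrite exprMn -natrX ler_pM2l//.
rewrite (le_trans (rnormM _ _))// expr2 ler_wpM2r ?rnorm_ge0//.
exact: (rnorm_adjoint_for ip TT').
Qed.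

End star_homs_are_bounded.

(** * The global algebra *)

Section local_units.
Context (R : realType) (d : nat) (M : ptopologicalType).
Hypothesis manifoldM : is_manifold R d M.
Variable nu : {measure set (borelType M) -> \bar R}.
Local Notation mul := (mulop nu).
Implicit Types (phi psi : M -> R[i]).

Lemma Cc_setT (U : set M) phi : Cc U phi -> Cc setT phi.
Proof. exact: Cc_sub. Qed.

Lemma local_unit (U : set M) phi : open U -> Cc U phi ->
  exists2 f : M -> R, Cc U (cplx f) & forall x, cplx f x * phi x = phi x.
Proof.
move=> oU [cp kp sp]; have [f [fU f01 f1]] := urysohn_Cc manifoldM oU kp sp.
exists f => [|x]; first exact: real_Cc_cplx.
have [/f1 fx|/csupportP ->] := pselect (csupport phi x); last by rewrite mulr0.
by rewrite /cplx fx mul1r.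
Qed.

Lemma local_unit_mul (U : set M) phi : open U -> Cc U phi ->
  exists psi, [/\ Cc U psi, Cc setT psi,
    mul psi * mul phi = mul phi & mul phi * mul psi = mul phi].
Proof.
move=> oU Uphi; have [f fU fphi] := local_unit oU Uphi.
have [h1 h2] := mulop_absorb nu (Cc_setT Uphi) (Cc_setT fU) fphi.
by exists (cplx f); split => //; exact: Cc_setT fU.
Qed.

Lemma compactly_supported_mul (U : set M) phi (T : bop (L2 nu)) :
  open U -> Cc U phi -> compactly_supported U (mul phi * T * mul phi).
Proof.
move=> oU Uphi; have [psi [cpsi _ h1 h2]] := local_unit_mul oU Uphi.
exists psi => //; split; first by rewrite !mulrA h1.
by rewrite -!mulrA h2.
Qed.

End local_units.

(** Inserting P between T and S costs a commutator with P * P. *)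
Lemma compression_mul (K : pzRingType) (a P T S : K) : P * a = a -> a * P = a ->
  a * (T * S) * a = a * ((P * T * P) * (P * S * P)) * a -
    a * ((T * (P * P) - (P * P) * T) * S) * a.
Proof.
move=> Pa aP.
have e1 : a * ((P * T * P) * (P * S * P)) * a = a * (T * (P * P) * S) * a.
  by rewrite !mulrA aP -!mulrA Pa.
have e2 : a * (P * P * T * S) * a = a * (T * S) * a.
  by rewrite !mulrA aP aP.
by rewrite !(mulrBl, mulrBr) e1 e2 opprB addrC subrK.
Qed.

Section global_algebra.
Context (R : realType) (d : nat) (M : ptopologicalType).
Hypothesis manifoldM : is_manifold R d M.
Context (I : Type) (U : I -> set M).
Hypothesis oU : forall i, open (U i).
Variable nu : {measure set (borelType M) -> \bar R}.
Local Notation H := (L2 nu).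
Local Notation mul := (mulop nu).
Context (Aloc : I -> set (bop H)) (algA : local_algebras U Aloc).
Local Notation A := (global_algebra U Aloc).
Implicit Types (T S : bop H) (phi psi : M -> R[i]).

Let ip : inner_product (@L2dot _ _ R nu) := L2dot_inner_product nu.
Let cH : seq_complete H := @L2_complete _ _ R nu.

Variable chi : nat -> M -> R.
Hypotheses (chi_Cc : forall n, Cc setT (cplx (chi n)))
  (chi01 : forall n x, 0 <= chi n x <= 1)
  (chi1 : forall K, compact K ->
    exists N, forall n, (N <= n)%N -> forall x, K x -> chi n x = 1).
Local Notation E n := (mul (cplx (chi n))).

Lemma cutoff_norm n : rnorm (E n) <= 1.
Proof.
apply: rnorm_mulop => // x; have /andP[? ?] := chi01 n x.
by rewrite normcR ger0_norm.
Qed.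

Lemma cutoff_strong v : (fun n => E n v) @ \oo --> v.
Proof.
apply: mulop_strong => // x; have [N NP] := chi1 (@compact_set1 _ x).
by exists N => n /NP; apply.
Qed.

Lemma cutoff_absorb phi : Cc setT phi -> exists N, forall n, (N <= n)%N ->
  E n * mul phi = mul phi /\ mul phi * E n = mul phi.
Proof.
move=> cphi; have [_ kphi _] := cphi; have [N NP] := chi1 kphi.
exists N => n Nn; apply: mulop_absorb => // x.
have [/(NP n Nn) cx|/csupportP ->] := pselect (csupport phi x).
  by rewrite /cplx cx mul1r.
by rewrite mulr0.
Qed.

Lemma cutoff_adjoint n : is_adjoint (E n) (E n).
Proof.
have {2}-> : E n = mul (fun x => (cplx (chi n) x)^*).
  by congr mulop; apply/funext => x; exact/esym/conjc_real.
exact: mulop_adjoint.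
Qed.

Lemma cutoff_compact T : compact_operator T -> (fun n => E n * T) @ \oo --> T.
Proof.
exact: (compact_operator_strong cH cutoff_norm cutoff_strong).
Qed.

Lemma cutoff_mul phi T : Cc setT phi ->
  (fun n => E n * (mul phi * T)) @ \oo --> mul phi * T.
Proof.
move=> /cutoff_absorb[N NP]; apply: cvg_near_cst; exists N => // n /NP[h _] /=.
by rewrite mulrA h.
Qed.

(** The operators E n are uniformly bounded. *)
Lemma cutoff_closed T :
  (forall e : R, 0 < e -> exists2 S, (fun n => E n * S) @ \oo --> S &
    rnorm (S - T) < e) ->
  (fun n => E n * T) @ \oo --> T.
Proof.
move=> h; apply/cvg_rnormP => e e0.
have e40 : 0 < e / 4 by rewrite divr_gt0.
have e4e : e / 4 + (e / 4 + e / 4) < e by lra.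
have [S /cvg_rnormP/(_ _ e40)[N NP] ST] := h _ e40.
exists N => n /NP nS.
have E1 : rnorm (E n * T - E n * S) <= rnorm (S - T).
  rewrite -mulrBr (le_trans (rnormM _ _))// [in leRHS]rnormB.
  by rewrite ler_piMl ?rnorm_ge0 ?cutoff_norm.
apply: le_lt_trans (rnorm_triangle (E n * S) _ _) _.
apply: le_lt_trans (lerD E1 (rnorm_triangle S _ _)) _.
exact: lt_trans (ltrD ST (ltrD nS ST)) e4e.
Qed.

(** A function psi in C_c(M) is eventually fixed by the cutoffs, so that
    M_psi T is close to T only if E n T eventually is; this replaces a sequence
    that depends on T by one that serves all operators. *)
Lemma global_algebraP T : A T <->
  [/\ forall i phi, Cc (U i) phi -> Aloc i (mul phi * T * mul phi),
      forall phi, Cc setT phi -> compact_operator (T * mul phi - mul phi * T) &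
      (fun n => E n * T) @ \oo --> T].
Proof.
split=> [[A1 A2 [psi cpsi psiT]]|[A1 A2 A3]]; split => //; last first.
  by exists (fun n => cplx (chi n)).
apply: cutoff_closed => e /((cvg_rnormP _ _).1 psiT)[N /(_ N (leqnn N)) NP].
by exists (mul (psi N) * T) => //; exact: cutoff_mul.
Qed.

Lemma local_mulr i T phi : Aloc i T -> Cc setT phi -> Aloc i (T * mul phi).
Proof.
move=> AT cphi; have [psi Upsi [_ Tpsi]] := local_compactly_supported algA AT.
rewrite Tpsi -mulrA -mulopM//; last exact: Cc_setT Upsi.
have [_ _ _ AM _] := local_star_subalgebra algA i; apply: AM => //.
by apply: (local_mulop algA); exact: Cc_mulr Upsi (Cc_continuous cphi).
Qed.

Lemma local_mull i T phi : Aloc i T -> Cc setT phi -> Aloc i (mul phi * T).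
Proof.
move=> AT cphi; have [psi Upsi [psiT _]] := local_compactly_supported algA AT.
have cpsi := Cc_setT Upsi.
rewrite psiT mulrA (mulopC nu cphi cpsi) -mulopM//.
have [_ _ _ AM _] := local_star_subalgebra algA i; apply: AM => //.
by apply: (local_mulop algA); exact: Cc_mulr Upsi (Cc_continuous cphi).
Qed.

Lemma local_commutator_compact i T phi : Aloc i T -> Cc setT phi ->
  compact_operator (T * mul phi - mul phi * T).
Proof.
move=> AT cphi; have [psi Upsi [psiT Tpsi]] := local_compactly_supported algA AT.
have cpsi := Cc_setT Upsi.
have -> : T * mul phi = T * mul (fun x => psi x * phi x).
  by rewrite mulopM// mulrA -Tpsi.
have -> : mul phi * T = mul (fun x => psi x * phi x) * T.
  by rewrite mulopM// (mulopC nu cpsi cphi) -mulrA -psiT.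
apply: (local_commutator algA AT).
exact: Cc_mulr Upsi (Cc_continuous cphi).
Qed.

(** With T supported by psi, the compression phi T phi is also the compression
    of T by psi phi, which is supported in U i and in U j, so that
    [local_overlap] transfers it from one algebra to the other. *)
Lemma local_sub_global i : Aloc i `<=` A.
Proof.
move=> T AT; apply/global_algebraP; split=> [j phi Uphi|phi cphi|].
- have cphi := Cc_setT Uphi.
  apply: (local_overlap algA (i := i)).
    by apply: local_mulr => //; apply: local_mull.
  have [psi Upsi [psiT Tpsi]] := local_compactly_supported algA AT.
  have cpsi := Cc_setT Upsi.
  pose chi' x := psi x * phi x.
  have Uchi : Cc (U i `&` U j) chi' by exact: Cc_mulI.
  have -> : mul phi * T * mul phi = mul chi' * T * mul chi'.
    rewrite {1}Tpsi {1}psiT !mulopM// !mulrA (mulopC nu cphi cpsi).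
    by rewrite -!mulrA.
  by apply: (compactly_supported_mul manifoldM) => //; exact: openI.
- exact: local_commutator_compact AT cphi.
- have [psi Upsi [-> _]] := local_compactly_supported algA AT.
  exact: cutoff_mul (Cc_setT Upsi).
Qed.

Lemma compact_sub_global : [set T : bop H | compact_operator T] `<=` A.
Proof.
move=> T cT; apply/global_algebraP; split=> [i phi Uphi|phi cphi|].
- apply: (local_compact_operator algA).
    by apply: (compact_operatorMr cH); exact: (compact_operatorMl cH).
  exact: (compactly_supported_mul manifoldM).
- apply: (compact_operatorB cH).
    exact: (compact_operatorMr cH).
  exact: (compact_operatorMl cH).
- exact: cutoff_compact.
Qed.

Lemma global_cutoffl T : A T -> (fun n => E n * T) @ \oo --> T.
Proof. by case/global_algebraP. Qed.

(** For the convergence E n * S --> S: S * E N is close to S because E N * T is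
    close to T, and it differs from E N * S by a compact operator. *)
Lemma global_adjoint T S : A T -> adjoint_for (@L2dot _ _ R nu) T S -> A S.
Proof.
move=> AT TS; have [A1 A2 A3] := (global_algebraP T).1 AT.
have mulJ phi : Cc setT phi -> is_adjoint (mul (fun x => (phi x)^*)) (mul phi).
  move=> cphi; apply: (adjoint_for_sym ip); exact: mulop_adjoint.
have comm phi : Cc setT phi -> compact_operator (S * mul phi - mul phi * S).
  move=> cphi; have cphi' := Cc_conj cphi; have h := A2 _ cphi'.
  have : compact_operator (mul phi * S - S * mul phi).
    apply: (compact_adjoint_for ip cH _ h); apply: (adjoint_forB ip).
      exact: adjoint_forM TS (mulJ _ cphi).
    exact: adjoint_forM (mulJ _ cphi) TS.
  by move=> /(compact_operatorZ cH (-1)); rewrite scaleN1r opprB.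
apply/global_algebraP; split => // [i phi Uphi|].
  have cphi := Cc_setT Uphi; have Uphi' := Cc_conj Uphi.
  have [_ _ _ _ AJ] := local_star_subalgebra algA i.
  have [B AB adjB] := AJ _ (A1 i _ Uphi').
  suff <- : B = mul phi * S * mul phi by [].
  apply: (adjoint_for_uniq ip adjB); rewrite -(mulrA (mul phi) S).
  exact: (adjoint_forM (adjoint_forM (mulJ _ cphi) TS) (mulJ _ cphi)).
apply: cutoff_closed => e e0.
have [N /(_ N (leqnn N)) NP] := (cvg_rnormP _ _).1 A3 e e0.
exists (S * E N); last first.
  apply: le_lt_trans NP; apply: (rnorm_adjoint_for ip).
  by apply: (adjoint_forB ip) => //; apply: adjoint_forM => //; exact: cutoff_adjoint.
rewrite -[S * E N](subrK (E N * S)).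
rewrite (_ : (fun n => _) = (fun n => E n * (S * E N - E N * S) + E n * (E N * S))).
  apply: cvgD; first exact/cutoff_compact/comm.
  exact: cutoff_mul.
by apply/funext => n; rewrite mulrDr.
Qed.

Lemma global_star_subalgebra : star_subalgebra A.
Proof.
split.
- exact: compact_sub_global (compact_operator0 cH).
- move=> T S /global_algebraP[T1 T2 T3] /global_algebraP[S1 S2 S3].
  apply/global_algebraP; split=> [i phi Uphi|phi cphi|].
  + have [_ AD _ _ _] := local_star_subalgebra algA i.
    by rewrite mulrDr mulrDl; apply: AD; [exact: T1|exact: S1].
  + rewrite mulrDl mulrDr opprD addrACA; apply: (compact_operatorD cH).
      exact: T2.
    exact: S2.
  + rewrite (_ : (fun n => _) = (fun n => E n * T + E n * S)); first exact: cvgD.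
    by apply/funext => n; rewrite mulrDr.
- move=> c T /global_algebraP[T1 T2 T3].
  apply/global_algebraP; split=> [i phi Uphi|phi cphi|].
  + have [_ _ AZ _ _] := local_star_subalgebra algA i.
    by rewrite bopZr bopZl; apply: AZ; exact: T1.
  + by rewrite bopZr bopZl -scalerBr; apply: (compact_operatorZ cH); exact: T2.
  + rewrite (_ : (fun n => _) = (fun n => c *: (E n * T))); first exact: cvgZr.
    by apply/funext => n; rewrite bopZr.
- move=> T S /global_algebraP[T1 T2 T3] /global_algebraP[S1 S2 S3].
  apply/global_algebraP; split=> [i phi Uphi|phi cphi|].
  + have [_ AD AZ AM _] := local_star_subalgebra algA i.
    have [psi [Upsi cpsi h1 h2]] := local_unit_mul manifoldM nu (oU i) Uphi.
    set a := mul phi in h1 h2 *; pose P := mul psi.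
    rewrite (compression_mul T S h1 h2) -/P -scaleN1r.
    have Aa : Aloc i a by exact: (local_mulop algA).
    apply: AD.
      apply: (AM _ _ (AM _ _ Aa (AM _ _ _ _)) Aa); [exact: T1|exact: S1].
    apply: AZ; apply: (local_compact_operator algA).
      apply: (compact_operatorMr cH); apply: (compact_operatorMl cH).
      apply: (compact_operatorMr cH); rewrite -mulopM//; apply: T2.
      exact: Cc_mulr cpsi (Cc_continuous cpsi).
    exact: (compactly_supported_mul manifoldM).
  + have -> : T * S * mul phi - mul phi * (T * S) =
        T * (S * mul phi - mul phi * S) + (T * mul phi - mul phi * T) * S.
      by rewrite mulrBr mulrBl !mulrA addrA subrK.
    apply: (compact_operatorD cH).
      by apply: (compact_operatorMl cH); exact: S2.
    by apply: (compact_operatorMr cH); exact: T2.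
  + rewrite (_ : (fun n => _) = (fun n => (E n * T) * S)).
      by apply: cvg_bopM => //; exact: cvg_cst.
    by apply/funext => n; rewrite mulrA.
- move=> T AT; have [S TS] := adjoint_for_exists ip cH T.
  by exists S => //; exact: global_adjoint TS.
Qed.

(** phi T_n phi = psi (phi T_n phi) psi with psi a local unit for phi, so that
    [local_closure] applies to the limit. *)
Lemma global_closed : closed A.
Proof.
move=> T /closure_rnormP AT; apply/global_algebraP.
split=> [i phi Uphi|phi cphi|].
- have [psi [Upsi cpsi h1 h2]] := local_unit_mul manifoldM nu (oU i) Uphi.
  apply: (local_closure algA Upsi); apply/closure_rnormP => e e0.
  pose k := rnorm (mul phi); have k0 : 0 <= k := rnorm_ge0 _.
  have k1 : 0 < k * k + 1 by rewrite ltr_wpDl// mulr_ge0.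
  have [S /global_algebraP[S1 _ _] ST] := AT _ (divr_gt0 e0 k1).
  exists (mul phi * S * mul phi).
    exists (mul phi * S * mul phi); first exact: S1.
    by rewrite !mulrA h1 -!mulrA h2.
  rewrite -mulrBl -mulrBr; move: ST; rewrite ltr_pdivlMr//.
  apply: le_lt_trans; apply: le_trans (rnormM _ _) _.
  have h := rnormM (mul phi) (S - T); have d0 := rnorm_ge0 (S - T).
  apply: le_trans (ler_wpM2r k0 h) _; rewrite -/k; nra.
- apply: (compact_operator_closed cH) => e e0.
  pose k := rnorm (mul phi); have k0 : 0 <= k := rnorm_ge0 _.
  have k1 : 0 < 2 * k + 1 by rewrite ltr_wpDl// mulr_ge0.
  have [S /global_algebraP[_ S2 _] ST] := AT _ (divr_gt0 e0 k1).
  exists (S * mul phi - mul phi * S); first exact: S2.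
  have -> : S * mul phi - mul phi * S - (T * mul phi - mul phi * T) =
      (S - T) * mul phi - mul phi * (S - T).
    rewrite mulrBl mulrBr !opprB addrACA [RHS]addrACA; congr (_ + _).
    by rewrite addrC.
  move: ST; rewrite ltr_pdivlMr//; apply: le_lt_trans.
  apply: le_trans (rnormD _ _) _; rewrite rnormN.
  have h1 := rnormM (mul phi) (S - T); have h2 := rnormM (S - T) (mul phi).
  have d0 := rnorm_ge0 (S - T); rewrite -/k in h1 h2; nra.
- apply: cutoff_closed => e /AT[S /global_algebraP[_ _ S3] ST].
  by exists S.
Qed.

End global_algebra.

(** * Symbols and the global homomorphism *)

Section symbols.
Context (R : realType) (d : nat) (M : ptopologicalType).
Hypothesis manifoldM : is_manifold R d M.
Context (I : Type) (U : I -> set M).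
Hypotheses (oU : forall i, open (U i)) (coverU : \bigcup_i U i = [set: M]).
Variable nu : {measure set (borelType M) -> \bar R}.
Local Notation H := (L2 nu).
Local Notation mul := (mulop nu).
Context (Aloc : I -> set (bop H)) (algA : local_algebras U Aloc).
Local Notation A := (global_algebra U Aloc).
Context (B : cstarAlgType R) (hom : I -> bop H -> B).
Hypothesis homsA : local_homs U Aloc hom.
Implicit Types (T S : bop H) (phi psi : M -> R[i]) (b c : B).

Let ip : inner_product (@L2dot _ _ R nu) := L2dot_inner_product nu.
Let cH : seq_complete H := @L2_complete _ _ R nu.

Variable chi : nat -> M -> R.
Hypotheses (chi_Cc : forall n, Cc setT (cplx (chi n)))
  (chi01 : forall n x, 0 <= chi n x <= 1)
  (chi1 : forall K, compact K ->
    exists N, forall n, (N <= n)%N -> forall x, K x -> chi n x = 1).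
Local Notation X n := (cplx (chi n)).
Local Notation E n := (mul (cplx (chi n))).

Variable Hom : (M -> R[i]) -> B.
Hypotheses (HomC0 : star_hom_C0 Hom)
  (HomE : forall i phi, Cc (U i) phi -> Hom phi = hom i (mul phi)).

Let global_algebra_mul : star_subalgebra A :=
  global_star_subalgebra manifoldM oU algA chi_Cc chi01 chi1.

Lemma partition_of_unity phi : Cc setT phi ->
  exists (n : nat) (ind : 'I_n -> I) (f : 'I_n -> M -> R[i]),
    [/\ forall k, Cc (U (ind k)) (f k), forall k, Cc setT (f k) &
      forall x, (\sum_k f k x ^+ 2) * phi x = phi x].
Proof.
move=> [cp kp _].
have [|n [ind [f [fU _ f1]]]] := sqrt_partition_of_unity manifoldM oU kp.
  by rewrite coverU.
have Uf k : Cc (U (ind k)) (cplx (f k)) by exact: real_Cc_cplx.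
exists n, ind, (fun k => cplx (f k)); split=> [k|k|x].
- exact: Uf.
- exact: Cc_setT (Uf k).
have [/f1 fx|/csupportP ->] := pselect (csupport phi x); last by rewrite mulr0.
have -> : \sum_k cplx (f k) x ^+ 2 = (\sum_k f k x ^+ 2)%:C.
  by rewrite rmorph_sum; apply: eq_bigr => k _; rewrite rmorphXn.
by rewrite fx mul1r.
Qed.

(** Up to a compact operator T is the sum of its compressions f_k T f_k to
    charts, since f_k^2 T = f_k T f_k + f_k [f_k, T]. *)
Lemma local_decomposition T phi : A T -> Cc setT phi -> mul phi * T = T ->
  exists (n : nat) (ind : 'I_n -> I) (f : 'I_n -> M -> R[i]),
    [/\ forall k, Cc (U (ind k)) (f k), forall k, Cc setT (f k) &
      compact_operator (T - \sum_k mul (f k) * T * mul (f k))].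
Proof.
move=> AT cphi phiT; have [n [ind [f [Uf cf f1]]]] := partition_of_unity cphi.
exists n, ind, f; split => //.
have [_ A2 _] := AT.
have -> : T - \sum_k mul (f k) * T * mul (f k) =
    - \sum_k mul (f k) * (T * mul (f k) - mul (f k) * T).
  rewrite -{1}phiT -(mulop_partition nu cf cphi f1) mulr_suml -sumrB -sumrN.
  apply: eq_bigr => k _.
  by rewrite mulrBr opprB !mulrA -(mulrA _ (mul phi)) phiT.
rewrite -scaleN1r; apply: (compact_operatorZ cH).
apply: (compact_operator_sum cH) => k; apply: (compact_operatorMl cH).
exact: A2.
Qed.

Lemma local_subr i T S : Aloc i T -> Aloc i S -> Aloc i (T - S).
Proof.
move=> AT AS; have [_ AD AZ _ _] := local_star_subalgebra algA i.
by rewrite -scaleN1r; apply: AD => //; exact: AZ.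
Qed.

(** hom i factors through the quotient by the compact operators. *)
Lemma local_hom_compact i T S : Aloc i T -> Aloc i S ->
  compact_operator (T - S) -> hom i T = hom i S.
Proof.
move=> AT AS cTS; have [FD FZ _ _] := local_hom_star homsA i.
have [_ _ AZ _ _] := local_star_subalgebra algA i.
have := (local_hom_kernel homsA (local_subr AT AS)).1 cTS.
rewrite -scaleN1r FD ?FZ//; last exact: AZ.
by rewrite scaleN1r => /eqP; rewrite subr_eq0 => /eqP.
Qed.

Lemma local_hom_sum i (n : nat) (T : 'I_n -> bop H) :
  (forall k, Aloc i (T k)) ->
  Aloc i (\sum_k T k) /\ hom i (\sum_k T k) = \sum_k hom i (T k).
Proof.
move=> AT; have [A0 AD _ _ _] := local_star_subalgebra algA i.
have [FD FZ _ _] := local_hom_star homsA i.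
elim: (index_enum _) => [|k s [IH1 IH2]].
  rewrite !big_nil; split => //.
  by rewrite -(scale0r (0 : bop H)) FZ// scale0r.
rewrite !big_cons -IH2; split; first exact: AD.
exact: FD.
Qed.

Lemma HomM phi psi : Cc setT phi -> Cc setT psi ->
  Hom (fun x => phi x * psi x) = cmul (Hom phi) (Hom psi).
Proof.
move=> cphi cpsi; have [_ _ HM _] := HomC0.
exact: HM (Cc_C0 cphi) (Cc_C0 cpsi).
Qed.

Lemma HomJ phi : Cc setT phi -> Hom (fun x => (phi x)^*) = cstar (Hom phi).
Proof. by move=> cphi; have [_ _ _] := HomC0; apply; exact: Cc_C0 cphi. Qed.

Lemma Hom_absorb phi psi : Cc setT phi -> Cc setT psi ->
  (forall x, psi x * phi x = phi x) ->
  cmul (Hom psi) (Hom phi) = Hom phi /\ cmul (Hom phi) (Hom psi) = Hom phi.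
Proof.
move=> cphi cpsi h; rewrite -!HomM//.
by split; congr Hom; apply/funext => x; rewrite // mulrC h.
Qed.

(** A local unit for T turns multiplication by a function in C_c(M) into
    multiplication by a function in C_c(U i), where Hom and hom i agree. *)
Lemma local_homMr i T phi : Aloc i T -> Cc setT phi ->
  cmul (hom i T) (Hom phi) = hom i (T * mul phi).
Proof.
move=> AT cphi; have [psi Upsi [_ Tpsi]] := local_compactly_supported algA AT.
have [_ _ FM _] := local_hom_star homsA i.
have cpsi := Cc_setT Upsi.
have Uprod : Cc (U i) (fun x => psi x * phi x).
  exact: Cc_mulr Upsi (Cc_continuous cphi).
rewrite {1}Tpsi FM//; last exact: (local_mulop algA).
rewrite -cmulA -HomE// -HomM// (HomE Uprod) -FM//; last exact: (local_mulop algA).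
by rewrite mulopM// mulrA -Tpsi.
Qed.

Lemma local_homMl i T phi : Aloc i T -> Cc setT phi ->
  cmul (Hom phi) (hom i T) = hom i (mul phi * T).
Proof.
move=> AT cphi; have [psi Upsi [psiT _]] := local_compactly_supported algA AT.
have [_ _ FM _] := local_hom_star homsA i.
have cpsi := Cc_setT Upsi.
have Uprod : Cc (U i) (fun x => psi x * phi x).
  exact: Cc_mulr Upsi (Cc_continuous cphi).
have E1 : (fun x => phi x * psi x) = (fun x => psi x * phi x).
  by apply/funext => x; rewrite mulrC.
rewrite {1}psiT FM//; last exact: (local_mulop algA).
rewrite cmulA -HomE// -HomM// E1 (HomE Uprod) -FM//; last exact: (local_mulop algA).
by rewrite -E1 mulopM// -mulrA -psiT.
Qed.

Lemma local_hom_commute i T phi : Aloc i T -> Cc setT phi ->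
  cmul (Hom phi) (hom i T) = cmul (hom i T) (Hom phi).
Proof.
move=> AT cphi; rewrite local_homMl// local_homMr//; apply/esym.
apply: local_hom_compact.
- exact: (local_mulr algA).
- exact: (local_mull algA).
- exact: (local_commutator_compact algA AT cphi).
Qed.

Lemma Cc_add phi psi : Cc setT phi -> Cc setT psi ->
  Cc setT (fun x => phi x + psi x).
Proof.
move=> [cphi kphi _] [cpsi kpsi _].
have sub : csupport (fun x => phi x + psi x) `<=` csupport phi `|` csupport psi.
  rewrite -closureU; apply: closure_subset => x /= xs; apply/orP.
  rewrite -negb_and; apply: contra xs => /andP[/eqP -> /eqP ->].
  by rewrite addr0.
split; last exact: subsetT.
- by move=> x; apply: cvgD; [exact: cphi|exact: cpsi].
- apply: subclosed_compact sub; first exact: closed_closure.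
  exact: compactU.
Qed.

Lemma Hom_sum (n : nat) (f : 'I_n -> M -> R[i]) (b : B) :
  (forall k, Cc setT (f k)) ->
  cmul (Hom (fun x => \sum_k f k x)) b = \sum_k cmul (Hom (f k)) b.
Proof.
move=> cf; have [FD FZ _ _] := HomC0.
have C00 : Cc setT (fun _ : M => 0 : R[i]).
  have E0 : csupport (fun _ : M => 0 : R[i]) = set0.
    by rewrite /csupport (_ : [set x | _] = set0) ?closure0//; apply/seteqP;
      split=> x //=; rewrite eqxx.
  split; rewrite ?E0//; first exact: cst_continuous.
  exact: compact0.
suff [_ ->] : Cc setT (fun x => \sum_k f k x) /\
    Hom (fun x => \sum_k f k x) = \sum_k Hom (f k).
  elim: (index_enum _) => [|k s IH]; first by rewrite !big_nil cmul0l.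
  by rewrite !big_cons cmulDl IH.
elim: (index_enum _) => [|k s [IH1 IH2]].
  have E0 : (fun x => \sum_(k <- [::]) f k x) = (fun=> 0).
    by apply/funext => x; rewrite big_nil.
  rewrite E0 big_nil; split => //.
  have -> : (fun _ : M => 0 : R[i]) = (fun x => 0 * 0).
    by apply/funext => x; rewrite mul0r.
  by rewrite (FZ 0) ?scale0r//; exact: Cc_C0 C00.
have E1 : (fun x => \sum_(k <- k :: s) f k x) =
    (fun x => f k x + \sum_(k <- s) f k x).
  by apply/funext => x; rewrite big_cons.
rewrite E1 big_cons -IH2; split; first exact: Cc_add.
by apply: FD; [exact: Cc_C0 (cf k)|exact: Cc_C0 IH1].
Qed.

(** The characterization of the image of T under the sought homomorphism by its
    compressions to charts. The last clause says that b is compactly supported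
    in M, which makes b unique. *)
Definition is_symbol T b := [/\
  forall i phi, Cc (U i) phi ->
    cmul (cmul (Hom phi) b) (Hom phi) = hom i (mul phi * T * mul phi),
  forall phi, Cc setT phi -> cmul (Hom phi) b = cmul b (Hom phi) &
  exists N, forall n, (N <= n)%N -> cmul (Hom (X n)) b = b].

(** Writing the cutoff of the difference with the f_k^2 and using that it commutes
    with Hom (f_k) exhibits it as a sum of differences of compressions. *)
Lemma symbol_unique T b c : is_symbol T b -> is_symbol T c -> b = c.
Proof.
move=> [b1 b2 [N1 b3]] [c1 c2 [N2 c3]].
have Hd (psi : M -> R[i]) : cmul (Hom psi) (b - c) =
  cmul (Hom psi) b - cmul (Hom psi) c by exact: cmulBr.
pose n := maxn N1 N2.
have dn : cmul (Hom (X n)) (b - c) = b - c.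
  by rewrite Hd b3 ?c3// ?leq_maxl ?leq_maxr.
apply/eqP; rewrite -subr_eq0 -dn; apply/eqP.
have [m [ind [f [Uf cf f1]]]] := partition_of_unity (chi_Cc n).
pose g k x := f k x * f k x * X n x.
have cff k : Cc setT (fun x => f k x * f k x).
  exact: Cc_mulr (cf k) (Cc_continuous (cf k)).
have cg k : Cc setT (g k).
  exact: Cc_mulr (cff k) (Cc_continuous (chi_Cc n)).
have -> : X n = fun x => \sum_k g k x.
  by apply/funext => x; rewrite -[LHS]f1 mulr_suml.
rewrite Hom_sum//; apply: big1 => k _.
rewrite (HomM (cff k) (chi_Cc n)) -cmulA dn (HomM (cf k) (cf k)) -cmulA.
have -> : cmul (Hom (f k)) (b - c) = cmul (b - c) (Hom (f k)).
  by rewrite cmulBr cmulBl b2// c2.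
by rewrite cmulA cmulBr cmulBl (b1 _ _ (Uf k)) (c1 _ _ (Uf k)) subrr.
Qed.

Lemma symbolD T S b c : A T -> A S -> is_symbol T b -> is_symbol S c ->
  is_symbol (T + S) (b + c).
Proof.
move=> [A1 _ _] [A1' _ _] [b1 b2 [N1 b3]] [c1 c2 [N2 c3]]; split.
- move=> i phi Uphi; have [FD _ _ _] := local_hom_star homsA i.
  rewrite cmulDr cmulDl (b1 i)// (c1 i)// mulrDr mulrDl FD//; [exact: A1|exact: A1'].
- by move=> phi cphi; rewrite cmulDr cmulDl b2// c2.
- exists (maxn N1 N2) => n; rewrite geq_max => /andP[/b3 h1 /c3 h2].
  by rewrite cmulDr h1 h2.
Qed.

Lemma symbolZ T b (z : R[i]) : A T -> is_symbol T b ->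
  is_symbol (z *: T) (z *: b).
Proof.
move=> [A1 _ _] [b1 b2 [N1 b3]]; split.
- move=> i phi Uphi; have [_ FZ _ _] := local_hom_star homsA i.
  by rewrite cmulZr cmulZl (b1 i)// bopZr bopZl FZ//; exact: A1.
- by move=> phi cphi; rewrite cmulZr cmulZl b2.
- by exists N1 => n /b3 h; rewrite cmulZr h.
Qed.

(** Modulo compact operators phi T S phi is phi (psi T psi) (psi S psi) phi for a
    local unit psi of phi. *)
Lemma symbolM T S b c : A T -> A S -> is_symbol T b -> is_symbol S c ->
  is_symbol (T * S) (cmul b c).
Proof.
move=> AT AS [b1 b2 [N1 b3]] [c1 c2 [N2 c3]].
have [A1 A2 _] := AT; have [A1' A2' _] := AS; split.
- move=> i phi Uphi.
  have [_ _ FM _] := local_hom_star homsA i.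
  have [_ _ _ AM _] := local_star_subalgebra algA i.
  have [f Uf fphi] := local_unit manifoldM (oU i) Uphi.
  set psi := cplx f in Uf fphi; have cpsi := Cc_setT Uf; have cphi := Cc_setT Uphi.
  have [h1 h2] := mulop_absorb nu cphi cpsi fphi.
  have [k1 k2] := Hom_absorb cphi cpsi fphi.
  have APT : Aloc i (mul psi * T * mul psi) by exact: A1.
  have APS : Aloc i (mul psi * S * mul psi) by exact: A1'.
  have Aphi : Aloc i (mul phi) by exact: (local_mulop algA).
  transitivity (hom i (mul phi * (mul psi * T * mul psi *
      (mul psi * S * mul psi)) * mul phi)).
    rewrite (FM _ _ (AM _ _ Aphi (AM _ _ APT APS)) Aphi).
    rewrite (FM _ _ Aphi (AM _ _ APT APS)) (FM _ _ APT APS).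
    rewrite -(b1 i)// -(c1 i)// -HomE//.
    rewrite !cmulA k2 -(cmulA (Hom phi) b (Hom psi)) -(b2 psi cpsi) !cmulA k2.
    rewrite -(cmulA (Hom phi) b (Hom psi)) -(b2 psi cpsi) !cmulA k2.
    by rewrite -(cmulA _ (Hom psi)) k1.
  apply: local_hom_compact.
  - exact: (AM _ _ (AM _ _ Aphi (AM _ _ APT APS)) Aphi).
  - by have [_ _ _ /(_ _ _ AT AS)[+ _ _] _] := global_algebra_mul; apply.
  - rewrite (compression_mul T S h1 h2) opprB addrCA subrr addr0.
    apply: (compact_operatorMr cH); apply: (compact_operatorMl cH).
    apply: (compact_operatorMr cH); rewrite -mulopM//; apply: A2.
    exact: Cc_mulr cpsi (Cc_continuous cpsi).
- by move=> phi cphi; rewrite cmulA b2// -cmulA c2// cmulA.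
- by exists N1 => n /b3 h; rewrite cmulA h.
Qed.

Lemma symbolJ T S b : A T -> is_adjoint T S -> is_symbol T b ->
  is_symbol S (cstar b).
Proof.
move=> [A1 _ _] TS [b1 b2 [N1 b3]].
have J phi : Cc setT phi -> Hom phi = cstar (Hom (fun x => (phi x)^*)).
  move=> cphi; rewrite -HomJ; last exact: Cc_conj.
  by congr Hom; apply/funext => x; exact/esym/conjcK.
have comm phi : Cc setT phi -> cmul (Hom phi) (cstar b) = cmul (cstar b) (Hom phi).
  move=> cphi; rewrite J// -!cstarM b2//.
  exact: Cc_conj.
split => //.
- move=> i phi Uphi; have [_ _ _ FJ] := local_hom_star homsA i.
  have cphi := Cc_setT Uphi; have Uphi' := Cc_conj Uphi.
  have AT := A1 i _ Uphi'.
  have adj : is_adjoint (mul (fun x => (phi x)^*) * T * mul (fun x => (phi x)^*))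
      (mul phi * S * mul phi).
    have mJ : is_adjoint (mul (fun x => (phi x)^*)) (mul phi).
      by apply: (adjoint_for_sym ip); exact: mulop_adjoint.
    rewrite -(mulrA (mul phi) S).
    exact: (adjoint_forM (adjoint_forM mJ TS) mJ).
  have [_ _ _ _ AJ] := local_star_subalgebra algA i.
  have [S' AS' adj'] := AJ _ AT.
  have S'E := adjoint_for_uniq ip adj' adj; rewrite -S'E.
  rewrite (FJ _ _ AT AS' adj') -(b1 i)// !cstarM cmulA.
  by rewrite -(J _ cphi).
- exists N1 => n /b3 h; rewrite comm// J// -cstarM.
  have -> : (fun x => (X n x)^*) = X n by apply/funext => x; exact: conjc_real.
  by rewrite h.
Qed.

Lemma Hom_cutoff_local i T : Aloc i T -> exists N, forall n, (N <= n)%N ->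
  cmul (Hom (X n)) (hom i T) = hom i T.
Proof.
move=> AT; have [psi Upsi [psiT _]] := local_compactly_supported algA AT.
have cpsi := Cc_setT Upsi.
have [N NP] := cutoff_absorb nu chi_Cc chi1 cpsi.
exists N => n /NP[h _]; rewrite (local_homMl AT (chi_Cc n)).
by rewrite psiT mulrA h.
Qed.

Lemma symbol_local i T : Aloc i T -> is_symbol T (hom i T).
Proof.
move=> AT; split.
- move=> j phi Uphi; have cphi := Cc_setT Uphi.
  have AphiT := local_mull algA AT cphi.
  rewrite (local_homMl AT cphi) (local_homMr AphiT cphi).
  apply: (local_hom_overlap homsA); first exact: (local_mulr algA AphiT cphi).
  have [h _ _] := local_sub_global manifoldM oU algA chi_Cc chi01 chi1 AT.
  exact: h.
- by move=> phi cphi; exact: local_hom_commute.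
- exact: Hom_cutoff_local.
Qed.

Lemma symbol_compact T : compact_operator T -> is_symbol T 0.
Proof.
move=> cT; have [A1 _ _] := compact_sub_global manifoldM oU algA chi_Cc chi01 chi1 cT.
split.
- move=> i phi Uphi; rewrite cmul0r cmul0l; apply/esym.
  apply: (local_hom_kernel homsA (A1 i phi Uphi)).1.
  by apply: (compact_operatorMr cH); exact: (compact_operatorMl cH).
- by move=> phi _; rewrite cmul0r cmul0l.
- by exists 0%N => n _; rewrite cmul0r.
Qed.

(** Support is expressed by the cutoffs, so that any two operators of this set are
    supported by the same one. *)
Definition supported_algebra : set (bop H) := [set T | A T /\
  exists N, forall n, (N <= n)%N -> E n * T = T /\ T * E n = T].
Local Notation Ac := supported_algebra.

Lemma max_threshold (m : nat) (P : 'I_m -> nat -> Prop) :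
  (forall k, exists N, forall n, (N <= n)%N -> P k n) ->
  exists N, forall n, (N <= n)%N -> forall k, P k n.
Proof.
move=> h; have [N NP] := choice h; exists (\max_k N k) => n Nn k.
by apply: NP; apply: leq_trans Nn; exact: leq_bigmax.
Qed.

(** The symbol is the sum of the hom_(i_k) (f_k T f_k). Its compression by phi in
    C_c(U i) can be computed in the single algebra of U i, as
    phi f_k T f_k phi = f_k (phi T phi) f_k belongs to it. *)
Lemma symbol_exists T : Ac T -> exists b, is_symbol T b.
Proof.
move=> [AT [N0 /(_ N0 (leqnn N0))[ET _]]]; have [A1 A2 _] := AT.
have [m [ind [f [Uf cf cT]]]] := local_decomposition AT (chi_Cc N0) ET.
pose P k := mul (f k) * T * mul (f k).
have AP k : Aloc (ind k) (P k) by exact: A1.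
exists (\sum_k hom (ind k) (P k)); split.
- move=> i phi Uphi; have cphi := Cc_setT Uphi.
  pose Q k := mul phi * P k * mul phi.
  have AQ k : Aloc i (Q k).
    have -> : Q k = mul (f k) * (mul phi * T * mul phi) * mul (f k).
      rewrite /Q /P !mulrA (mulopC nu cphi (cf k)) -!mulrA.
      by rewrite (mulopC nu cphi (cf k)).
    apply: (local_mulr algA _ (cf k)); apply: (local_mull algA _ (cf k)).
    exact: A1.
  have [AQs homQ] := local_hom_sum AQ.
  have -> : cmul (cmul (Hom phi) (\sum_k hom (ind k) (P k))) (Hom phi) =
      \sum_k hom i (Q k).
    have E1 (s : seq 'I_m) :
        cmul (cmul (Hom phi) (\sum_(k <- s) hom (ind k) (P k))) (Hom phi) =
        \sum_(k <- s) cmul (cmul (Hom phi) (hom (ind k) (P k))) (Hom phi).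
      elim: s => [|k s IH]; first by rewrite !big_nil cmul0r cmul0l.
      by rewrite !big_cons cmulDr cmulDl IH.
    rewrite E1; apply: eq_bigr => k _.
    have AphiP := local_mull algA (AP k) cphi.
    rewrite (local_homMl (AP k) cphi) (local_homMr AphiP cphi).
    apply: (local_hom_overlap homsA _ (AQ k)).
    exact: (local_mulr algA AphiP cphi).
  rewrite -homQ; apply/esym; apply: local_hom_compact AQs _; first exact: A1.
  have -> : \sum_k Q k = mul phi * (\sum_k P k) * mul phi.
    by rewrite mulr_sumr mulr_suml.
  rewrite -mulrBl -mulrBr.
  by apply: (compact_operatorMr cH); apply: (compact_operatorMl cH).
- move=> phi cphi; elim: (index_enum _) => [|k s IH].
    by rewrite big_nil cmul0l cmul0r.
  by rewrite big_cons cmulDl cmulDr IH (local_hom_commute (AP k) cphi).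
- have [N NP] := max_threshold (fun k => Hom_cutoff_local (AP k)).
  exists N => n /NP h; elim: (index_enum _) => [|k s IH].
    by rewrite big_nil cmul0r.
  by rewrite big_cons cmulDr IH h.
Qed.

Let gAD T S : A T -> A S -> A (T + S).
Proof. by have [_ h _ _ _] := global_algebra_mul; exact: h. Qed.

Let gAZ (z : R[i]) T : A T -> A (z *: T).
Proof. by have [_ _ h _ _] := global_algebra_mul; exact: h. Qed.

Let gAM T S : A T -> A S -> A (T * S).
Proof. by have [_ _ _ h _] := global_algebra_mul; exact: h. Qed.

Lemma supportedD T S : Ac T -> Ac S -> Ac (T + S).
Proof.
move=> [AT [N1 T1]] [AS [N2 S2]]; split; first exact: gAD.
exists (maxn N1 N2) => n; rewrite geq_max => /andP[/T1[h1 h2] /S2[k1 k2]].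
by rewrite mulrDr mulrDl h1 h2 k1 k2.
Qed.

Lemma supportedZ (z : R[i]) T : Ac T -> Ac (z *: T).
Proof.
move=> [AT [N1 T1]]; split; first exact: gAZ.
by exists N1 => n /T1[h1 h2]; rewrite bopZl bopZr h1 h2.
Qed.

Lemma supportedM T S : Ac T -> Ac S -> Ac (T * S).
Proof.
move=> [AT [N1 T1]] [AS [N2 S2]]; split; first exact: gAM.
exists (maxn N1 N2) => n; rewrite geq_max => /andP[/T1[h1 _] /S2[_ k2]].
by rewrite mulrA h1 -mulrA k2.
Qed.

Lemma supportedB T S : Ac T -> Ac S -> Ac (T - S).
Proof.
by move=> AT AS; rewrite -scaleN1r; apply: supportedD => //; exact: supportedZ.
Qed.

Lemma supported_local i T : Aloc i T -> Ac T.
Proof.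
move=> AT; split.
  exact: (local_sub_global manifoldM oU algA chi_Cc chi01 chi1 AT).
have [psi Upsi [psiT Tpsi]] := local_compactly_supported algA AT.
have [N NP] := cutoff_absorb nu chi_Cc chi1 (Cc_setT Upsi).
exists N => n /NP[h1 h2]; split; first by rewrite psiT mulrA h1.
by rewrite Tpsi -mulrA h2.
Qed.

Lemma cutoff_absorb_cutoff N : exists N', forall n, (N' <= n)%N ->
  E n * E N = E N /\ E N * E n = E N.
Proof. exact: (cutoff_absorb nu chi_Cc chi1 (chi_Cc N)). Qed.

Lemma supported_of_cutoff N T : A T -> E N * T = T -> T * E N = T -> Ac T.
Proof.
move=> AT ET TE; split=> //; have [N' N'P] := cutoff_absorb_cutoff N.
exists N' => n /N'P[h1 h2]; split; first by rewrite -ET mulrA h1.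
by rewrite -TE -mulrA h2.
Qed.

Lemma global_mull T phi : A T -> Cc setT phi -> A (mul phi * T).
Proof.
move=> AT cphi; have [A1 A2 A3] := (global_algebraP U Aloc chi_Cc chi01 chi1 T).1 AT.
apply/(global_algebraP U Aloc chi_Cc chi01 chi1); split=> [i psi Upsi|psi cpsi|].
- rewrite mulrA (mulopC nu (Cc_setT Upsi) cphi) -!mulrA mulrA -mulrA.
  apply: (local_mull algA _ cphi); rewrite mulrA; exact: A1.
- have -> : mul phi * T * mul psi - mul psi * (mul phi * T) =
      mul phi * (T * mul psi - mul psi * T).
    by rewrite mulrBr !mulrA (mulopC nu cpsi cphi).
  by apply: (compact_operatorMl cH); exact: A2.
- exact: (cutoff_mul chi_Cc chi1 cphi).
Qed.

Lemma global_mulr T phi : A T -> Cc setT phi -> A (T * mul phi).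
Proof.
move=> AT cphi; have [A1 A2 A3] := (global_algebraP U Aloc chi_Cc chi01 chi1 T).1 AT.
apply/(global_algebraP U Aloc chi_Cc chi01 chi1); split=> [i psi Upsi|psi cpsi|].
- rewrite mulrA -(mulrA _ (mul phi)) (mulopC nu cphi (Cc_setT Upsi)) mulrA.
  by apply: (local_mulr algA _ cphi); exact: A1.
- have -> : T * mul phi * mul psi - mul psi * (T * mul phi) =
      (T * mul psi - mul psi * T) * mul phi.
    by rewrite mulrBl -!mulrA (mulopC nu cpsi cphi).
  by apply: (compact_operatorMr cH); exact: A2.
- rewrite (_ : (fun n => _) = (fun n => (E n * T) * mul phi)).
    by apply: cvg_bopM => //; exact: cvg_cst.
  by apply/funext => n; rewrite mulrA.
Qed.

Local Notation cut n T := (E n * T * E n).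

Lemma supported_cut n T : A T -> Ac (cut n T).
Proof.
move=> AT; split; first exact: global_mulr (global_mull AT (chi_Cc n)) (chi_Cc n).
have [N NP] := cutoff_absorb_cutoff n; exists N => k /NP[h1 h2].
by split; [rewrite !mulrA h1|rewrite -!mulrA h2].
Qed.

(** The right cutoffs converge because the left ones do on the adjoint of T. *)
Lemma cut_cvg T : A T -> (fun n => cut n T) @ \oo --> T.
Proof.
move=> AT; have ET := global_cutoffl chi_Cc chi01 chi1 AT.
have [_ _ _ _ AJ] := global_algebra_mul; have [S AS TS] := AJ _ AT.
have ES := global_cutoffl chi_Cc chi01 chi1 AS.
apply: (@cvg_rnorm_le _ _ _ _
  (fun n => rnorm (E n * S - S) + rnorm (E n * T - T))) => [n|]; last first.
  rewrite -[Z in _ --> Z]addr0; apply: cvgD; apply/cvg_rnorm0; [exact: ES|exact: ET].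
apply: le_trans (rnorm_triangle (E n * T) _ _) _; rewrite lerD2r.
rewrite -mulrA -mulrBr (le_trans (rnormM _ _))//.
apply: (@le_trans _ _ (rnorm (T * E n - T))).
  rewrite ler_piMl ?rnorm_ge0//; exact: (cutoff_norm nu chi_Cc chi01).
apply: (rnorm_adjoint_for ip); apply: (adjoint_forB ip).
  exact: (adjoint_forM (cutoff_adjoint chi_Cc n) (adjoint_for_sym ip TS)).
exact: (adjoint_for_sym ip TS).
Qed.

(** Operators supported where a single cutoff is 1 form a norm-closed
    *-subalgebra, which is where boundedness, with a constant independent of the
    support, comes from. *)
Lemma supported_hom_exists : exists F : bop H -> B, [/\ star_hom_on Ac F,
  forall i T, Aloc i T -> F T = hom i T,
  forall T, Ac T -> compact_operator T -> F T = 0 &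
  forall T, Ac T -> rnorm (F T) <= 2 * rnorm T].
Proof.
have ex T : exists b, Ac T -> is_symbol T b.
  have [/symbol_exists[b bP]|nT] := pselect (Ac T); first by exists b.
  by exists 0.
have [F FP] := choice ex; exists F.
have F_hom : star_hom_on Ac F.
  split=> [T S AT AS|z T AT|T S AT AS|T S AT AS TS].
  - apply: symbol_unique (FP _ (supportedD AT AS)) _.
    by apply: symbolD; [exact: AT.1|exact: AS.1|exact: FP|exact: FP].
  - apply: symbol_unique (FP _ (supportedZ z AT)) _.
    by apply: symbolZ; [exact: AT.1|exact: FP].
  - apply: symbol_unique (FP _ (supportedM AT AS)) _.
    by apply: symbolM; [exact: AT.1|exact: AS.1|exact: FP|exact: FP].
  - apply: symbol_unique (FP _ AS) _.
    by apply: (symbolJ AT.1 TS); exact: FP.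
split=> // [i T AT|T AT cT|T AT].
- exact: symbol_unique (FP _ (supported_local AT)) (symbol_local AT).
- exact: symbol_unique (FP _ AT) (symbol_compact cT).
have [AT' [N /(_ N (leqnn N))[ET TE]]] := AT.
pose S' : set (bop H) := [set S | [/\ A S, E N * S = S & S * E N = S]].
have S'Ac S : S' S -> Ac S by move=> [AS ES SE]; exact: supported_of_cutoff AS ES SE.
have [A0 _ _ _ AJ] := global_algebra_mul.
have S'_alg : star_subalgebra S'.
  split.
  - by split; rewrite ?mulr0 ?mul0r.
  - move=> S1 S2 [a1 a2 a3] [b1 b2 b3]; split; first exact: gAD.
      by rewrite mulrDr a2 b2.
    by rewrite mulrDl a3 b3.
  - move=> z S1 [a1 a2 a3]; split; first exact: gAZ.
      by rewrite bopZr a2.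
    by rewrite bopZl a3.
  - move=> S1 S2 [a1 a2 a3] [b1 b2 b3]; split; first exact: gAM.
      by rewrite mulrA a2.
    by rewrite -mulrA b3.
  - move=> S1 [a1 a2 a3]; have [S2 b1 adj] := AJ _ a1; exists S2 => //.
    have EJ : is_adjoint (E N) (E N) by exact: cutoff_adjoint.
    have h1 := adjoint_forM adj EJ; have h2 := adjoint_forM EJ adj.
    rewrite a3 in h1; rewrite a2 in h2.
    split; [exact: b1|exact: (adjoint_for_uniq ip h1 adj)|].
    exact: (adjoint_for_uniq ip h2 adj).
have S'_closed : closed S'.
  move=> S cS; have AS : A S.
    apply: (global_closed manifoldM oU algA chi_Cc chi01 chi1).
    by apply: closure_subset cS => S1 [].
  move/closure_rnormP: cS => cS.
  have EN1 := cutoff_norm nu chi_Cc chi01 N.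
  split=> //; apply/eqP; rewrite -subr_eq0; apply/eqP/rnorm_small_eq0 => e e0.
    have [S1 [_ ES1 _] S1S] := cS _ (divr_gt0 e0 (ltr0Sn R 1)).
    apply: le_trans (rnorm_triangle S1 _ _) _; rewrite [leRHS]splitr.
    apply: lerD (ltW S1S); rewrite -{1}ES1 -mulrBr (le_trans (rnormM _ _))//.
    by rewrite (le_trans (ler_piMl (rnorm_ge0 _) EN1))// rnormB ltW.
  have [S1 [_ _ SE1] S1S] := cS _ (divr_gt0 e0 (ltr0Sn R 1)).
  apply: le_trans (rnorm_triangle S1 _ _) _; rewrite [leRHS]splitr.
  apply: lerD (ltW S1S); rewrite -{1}SE1 -mulrBl (le_trans (rnormM _ _))//.
  by rewrite (le_trans (ler_piMr (rnorm_ge0 _) EN1))// rnormB ltW.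
have F_hom' : star_hom_on S' F.
  have [h1 h2 h3 h4] := F_hom.
  split.
  - by move=> S1 S2 /S'Ac a /S'Ac b; exact: h1.
  - by move=> z S1 /S'Ac a; exact: h2.
  - by move=> S1 S2 /S'Ac a /S'Ac b; exact: h3.
  - by move=> S1 S2 /S'Ac a /S'Ac b; exact: h4.
by apply: (star_hom_bounded S'_alg S'_closed F_hom'); split.
Qed.

(** G T is the limit of F (E n T E n). By boundedness of F any other sequence of
    supported operators that tends to T gives the same limit, so that the
    algebraic identities pass to the limit. *)
Lemma global_hom_exists : exists G : bop H -> B, global_hom U Aloc hom G.
Proof.
have [F [F_hom Floc Fcpt Fb]] := supported_hom_exists.
have [FD FZ FM FJ] := F_hom.
have FB T S : Ac T -> Ac S -> F T - F S = F (T - S).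
  move=> AT AS; rewrite -[in RHS]scaleN1r FD//; last exact: supportedZ.
  by rewrite FZ// scaleN1r.
have Fcvg T : exists l : B, A T -> (fun n => F (cut n T)) @ \oo --> l.
  have [AT|nT] := pselect (A T); last by exists 0.
  have [e e0|l lP] := @cstar_complete _ B (fun n => F (cut n T)); last by exists l.
  have e40 : 0 < e / 4 by rewrite divr_gt0.
  have e4e : 2 * (e / 4 + e / 4) = e by lra.
  have [N NP] := (cvg_rnormP _ _).1 (cut_cvg AT) _ e40.
  exists N => m n Nm Nn; rewrite FB; [|exact: supported_cut..].
  apply: le_lt_trans (Fb _ (supportedB (supported_cut m AT) (supported_cut n AT))) _.
  rewrite -[ltRHS]e4e ltr_pM2l//; apply: le_lt_trans (rnorm_triangle T _ _) _.
  by apply: ltrD (NP m Nm) _; rewrite rnormB; exact: NP.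
have [G GP] := choice Fcvg; exists G.
have G_lim (V : nat -> bop H) T : A T -> (forall n, Ac (V n)) ->
    V @ \oo --> T -> (fun n => F (V n)) @ \oo --> G T.
  move=> AT AV VT.
  apply: (@cvg_rnorm_le _ _ _ _ (fun n => 2 * (rnorm (V n - T) +
      rnorm (cut n T - T)) + rnorm (F (cut n T) - G T))) => [n|]; last first.
    have h1 := (cvg_rnorm0 _ _).1 VT; have h2 := (cvg_rnorm0 _ _).1 (cut_cvg AT).
    have h3 := (cvg_rnorm0 _ _).1 (GP T AT).
    rewrite -[Z in _ --> Z]addr0; apply: cvgD h3.
    rewrite -[Z in _ --> Z](mulr0 2); apply: cvgM; first exact: cvg_cst.
    by rewrite -[Z in _ --> Z]addr0; exact: (cvgD h1 h2).
  apply: le_trans (rnorm_triangle (F (cut n T)) _ _) _; rewrite lerD2r.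
  have AT' := supported_cut n AT; rewrite FB//.
  apply: le_trans (Fb _ (supportedB (AV n) AT')) _; rewrite ler_pM2l//.
  by apply: le_trans (rnorm_triangle T _ _) _; rewrite lerD2l rnormB.
have G_supported T : Ac T -> G T = F T.
  move=> AT; have cT : (fun _ : nat => T) @ \oo --> T by exact: cvg_cst.
  have h : (fun _ : nat => F T) @ \oo --> G T by exact: G_lim AT.1 (fun=> AT) cT.
  have h' : (fun _ : nat => F T) @ \oo --> F T by exact: cvg_cst.
  exact: (seq_cvg_unique h h').
have Gloc i T : Aloc i T -> G T = hom i T.
  by move=> AT; rewrite (G_supported _ (supported_local AT)) (Floc i).
have G_hom : star_hom_on A G.
  split=> [T S AT AS|z T AT|T S AT AS|T S AT AS TS].
  - have h1 : (fun n => F (cut n T + cut n S)) @ \oo --> G (T + S).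
      apply: (G_lim _ _ (gAD AT AS)) => [n|].
        exact: (supportedD (supported_cut n AT) (supported_cut n AS)).
      exact: (cvgD (cut_cvg AT) (cut_cvg AS)).
    suff h2 : (fun n => F (cut n T + cut n S)) @ \oo --> G T + G S.
      exact: (seq_cvg_unique h1 h2).
    rewrite (_ : (fun n => _) = (fun n => F (cut n T) + F (cut n S))).
      exact: (cvgD (GP T AT) (GP S AS)).
    by apply/funext => n; rewrite FD//; exact: supported_cut.
  - have h1 : (fun n => F (z *: cut n T)) @ \oo --> G (z *: T).
      apply: (G_lim _ _ (gAZ z AT)) => [n|].
        exact: (supportedZ z (supported_cut n AT)).
      exact: (cvgZr (cut_cvg AT)).
    suff h2 : (fun n => F (z *: cut n T)) @ \oo --> z *: G T.
      exact: (seq_cvg_unique h1 h2).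
    rewrite (_ : (fun n => _) = (fun n => z *: F (cut n T))).
      exact: (cvgZr (GP T AT)).
    by apply/funext => n; rewrite FZ//; exact: supported_cut.
  - have h1 : (fun n => F (cut n T * cut n S)) @ \oo --> G (T * S).
      apply: (G_lim _ _ (gAM AT AS)) => [n|].
        exact: (supportedM (supported_cut n AT) (supported_cut n AS)).
      exact: (cvg_bopM (cut_cvg AT) (cut_cvg AS)).
    suff h2 : (fun n => F (cut n T * cut n S)) @ \oo --> cmul (G T) (G S).
      exact: (seq_cvg_unique h1 h2).
    rewrite (_ : (fun n => _) = (fun n => cmul (F (cut n T)) (F (cut n S)))).
      exact: (cvg_cmul (GP T AT) (GP S AS)).
    by apply/funext => n; rewrite FM//; exact: supported_cut.
  - suff h2 : (fun n => F (cut n S)) @ \oo --> cstar (G T).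
      exact: (seq_cvg_unique (GP S AS) h2).
    rewrite (_ : (fun n => _) = (fun n => cstar (F (cut n T)))).
      exact: (cvg_cstar (GP T AT)).
    apply/funext => n; apply: FJ; [exact: supported_cut..|].
    have EJ : is_adjoint (E n) (E n) by exact: cutoff_adjoint.
    rewrite -(mulrA (E n) S).
    exact: (adjoint_forM (adjoint_forM EJ TS) EJ).
split=> //; apply/seteqP; split=> [T [AT GT]|T cT] /=; last first.
  have AT := compact_sub_global manifoldM oU algA chi_Cc chi01 chi1 cT.
  split; first exact: AT.
  suff h2 : (fun n => F (cut n T)) @ \oo --> (0 : B).
    exact: (seq_cvg_unique (GP T AT) h2).
  rewrite (_ : (fun n => _) = (fun=> 0)); first exact: cvg_cst.
  apply/funext => n; apply: Fcpt; first exact: supported_cut.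
  by apply: (compact_operatorMr cH); exact: (compact_operatorMl cH).
have [A1 A2 A3] := AT.
have [_ _ GM _] := G_hom.
have loc_cpt i phi : Cc (U i) phi -> compact_operator (mul phi * T * mul phi).
  move=> Uphi; apply/(local_hom_kernel homsA (A1 i _ Uphi)).
  have Aphi : A (mul phi).
    have Aphi := local_mulop algA Uphi.
    exact: (local_sub_global manifoldM oU algA chi_Cc chi01 chi1 Aphi).
  rewrite -(Gloc i _ (A1 i _ Uphi)) (GM _ _ (gAM Aphi AT) Aphi) (GM _ _ Aphi AT).
  by rewrite GT cmul0r cmul0l.
have cut_cpt n : compact_operator (E n * T).
  have [N /(_ N (leqnn N))[EN _]] := cutoff_absorb_cutoff n.
  have AET := global_mull AT (chi_Cc n).
  have [|m [ind [f [Uf cf cT]]]] := local_decomposition AET (chi_Cc N).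
    by rewrite mulrA EN.
  rewrite -[E n * T](subrK (\sum_k mul (f k) * (E n * T) * mul (f k))).
  apply: (compact_operatorD cH) => //; apply: (compact_operator_sum cH) => k.
  rewrite mulrA (mulopC nu (cf k) (chi_Cc n)) -!mulrA mulrA -mulrA.
  by apply: (compact_operatorMl cH); rewrite mulrA; exact: loc_cpt (Uf k).
apply: (compact_operator_closed cH) => e e0.
have ET := global_cutoffl chi_Cc chi01 chi1 AT.
have [N /(_ N (leqnn N)) NP] := (cvg_rnormP _ _).1 ET e e0.
by exists (E N * T).
Qed.

(** On supported operators both maps are given by the sum of the
    hom_(i_k) (f_k T f_k), because they vanish on compact operators; and both
    are bounded. *)
Lemma global_hom_unique (G1 G2 : bop H -> B) :
  global_hom U Aloc hom G1 -> global_hom U Aloc hom G2 ->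
  forall T, A T -> G1 T = G2 T.
Proof.
move=> hG1 hG2.
have A_closed : closed A := global_closed manifoldM oU algA chi_Cc chi01 chi1.
have decomp (G : bop H -> B) (T : bop H) (m : nat) (ind : 'I_m -> I)
    (f : 'I_m -> M -> R[i]) : global_hom U Aloc hom G -> A T ->
    (forall k, Cc (U (ind k)) (f k)) ->
    compact_operator (T - \sum_k mul (f k) * T * mul (f k)) ->
    G T = \sum_k hom (ind k) (mul (f k) * T * mul (f k)).
  move=> [Ghom Gloc Gker] AT Uf cT; have [A1 _ _] := AT.
  have [GD _ _ _] := Ghom.
  have Asum (s : seq 'I_m) : A (\sum_(k <- s) mul (f k) * T * mul (f k)) /\
      G (\sum_(k <- s) mul (f k) * T * mul (f k)) =
      \sum_(k <- s) hom (ind k) (mul (f k) * T * mul (f k)).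
    elim: s => [|k s [IH1 IH2]].
      rewrite !big_nil; have [A0 _ _ _ _] := global_algebra_mul; split => //.
      exact: star_hom0 global_algebra_mul Ghom.
    have Ak := A1 _ _ (Uf k).
    have gAk := local_sub_global manifoldM oU algA chi_Cc chi01 chi1 Ak.
    by rewrite !big_cons GD// IH2 (Gloc _ _ Ak); split => //; exact: gAD.
  have [As Gs] := Asum (index_enum _).
  have : [set T | A T /\ G T = 0] (T - \sum_k mul (f k) * T * mul (f k)).
    by rewrite Gker.
  move=> [Ad Gd]; rewrite -{1}[T](subrK (\sum_k mul (f k) * T * mul (f k))).
  by rewrite GD// Gd add0r Gs.
have eq_supported T : Ac T -> G1 T = G2 T.
  move=> [AT [N /(_ N (leqnn N))[ET _]]].
  have [m [ind [f [Uf cf cT]]]] := local_decomposition AT (chi_Cc N) ET.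
  by rewrite (decomp G1 T m ind f)// (decomp G2 T m ind f).
have lim (G : bop H -> B) T : global_hom U Aloc hom G -> A T ->
    (fun n => G (cut n T)) @ \oo --> G T.
  move=> [Ghom _ _] AT; have [GD GZ _ _] := Ghom.
  apply: (@cvg_rnorm_le _ _ _ _ (fun n => 2 * rnorm (cut n T - T))) => [n|].
    have Acut := (supported_cut n AT).1; have AN : A (-1 *: T) by exact: gAZ.
    have -> : G (cut n T) - G T = G (cut n T - T).
      by rewrite -[in RHS]scaleN1r GD// GZ// scaleN1r.
    apply: (star_hom_bounded global_algebra_mul A_closed Ghom).
    by rewrite -scaleN1r; exact: gAD.
  rewrite -[Z in _ --> Z](mulr0 2); apply: cvgM; first exact: cvg_cst.
  by apply/cvg_rnorm0; exact: cut_cvg.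
move=> T AT; suff h2 : (fun n => G1 (cut n T)) @ \oo --> G2 T.
  exact: (seq_cvg_unique (lim G1 T hG1 AT) h2).
rewrite (_ : (fun n => _) = (fun n => G2 (cut n T))); first exact: lim.
by apply/funext => n; apply: eq_supported; exact: supported_cut.
Qed.

End symbols.

Theorem theorem5p5 (R : realType) (d : nat) (M : ptopologicalType)
    (manifoldM : is_manifold R d M)
    (I : Type) (U : I -> set M) (h : I -> M -> 'rV[R]_d)
    (countableI : countable [set: I]) (atlasU : is_atlas U h)
    (finU : locally_finite_cover U)
    (relcompactU : forall i, compact (closure (U i)))
    (nu : {measure set (borelType M) -> \bar R})
    (Aloc : I -> set (bop (L2 nu))) (algA : local_algebras U Aloc)
    (B : cstarAlgType R) (homloc : I -> bop (L2 nu) -> B)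
    (homsA : local_homs U Aloc homloc) :
  let A := global_algebra U Aloc in
  [/\ operator_cstar_algebra A,
      (forall i, Aloc i `<=` A) &
      [set T : bop (L2 nu) | compact_operator T] `<=` A] /\
  (exists hom : bop (L2 nu) -> B, global_hom U Aloc homloc hom) /\
  (forall hom1 hom2 : bop (L2 nu) -> B,
     global_hom U Aloc homloc hom1 -> global_hom U Aloc homloc hom2 ->
     forall T, A T -> hom1 T = hom2 T).
Proof.
move=> A; have [charts coverU] := atlasU.
have oU i : open (U i) by have [] := charts i.
have [chi [real_chi chi01 chi1]] :=
  exhaustion manifoldM countableI oU coverU relcompactU.
have chi_Cc n : Cc setT (cplx (chi n)) by exact: real_Cc_cplx.
have [Hom HomC0 HomE] := local_hom_mulop homsA.
split; [split|split].
- split; first exact: (global_star_subalgebra manifoldM oU algA chi_Cc chi01 chi1).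
  exact: (global_closed manifoldM oU algA chi_Cc chi01 chi1).
- by move=> i T; exact: (local_sub_global manifoldM oU algA chi_Cc chi01 chi1).
- exact: (compact_sub_global manifoldM oU algA chi_Cc chi01 chi1).
- exact: (global_hom_exists manifoldM oU coverU algA homsA chi_Cc chi01 chi1 HomC0 HomE).
- exact: (global_hom_unique manifoldM oU coverU algA chi_Cc chi01 chi1).
Qed.
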